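(* Let $p$ be a positive integer such that the Burnside group $B(2,p)$ is not amenable. Then for any integer $n\ge 2$, the Burnside group $B(2,np)$ is not unitarizable.
   Context: Burnside group: $B(m,p)$ is the universal group with $m$ generators in which $g^p=1$ for every element $g$ (i.e. the quotient of the free group on $m$ generators by the normal subgroup generated by all $p$-th powers). All groups are regarded as discrete groups. Unitarizable: a representation $\pi\colon G\to B(H)$ of a discrete group $G$ on a Hilbert space $H$ (a group homomorphism into the invertible bounded operators) is uniformly bounded if $\sup_{t\in G}\|\pi(t)\|<\infty$; it is unitarizable if there is a bounded invertible operator $S\colon H\to H$ such that $t\mapsto S^{-1}\pi(t)S$ is a unitary representation. The discrete group $G$ is unitarizable if every uniformly bounded representation of $G$ on every Hilbert space is unitarizable. *)

(* Defs.v *)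
From HB Require Import structures.
From mathcomp Require Import all_boot all_order all_algebra.
From mathcomp Require Import complex.
From mathcomp Require Import all_classical all_reals all_analysis.

Set Implicit Arguments.
Unset Strict Implicit.
Unset Printing Implicit Defensive.

Import Order.TTheory GRing.Theory Num.Theory.
Import numFieldNormedType.Exports.

Local Open Scope complex_scope.
Local Open Scope classical_set_scope.
Local Open Scope group_scope.
Local Open Scope ring_scope.

(* The letter [(x, b)] stands for [x^-1] if [b] is true, and for [x] if [b] is
   false. *)
Definition word (T : Type) := seq (T * bool).

Definition word_inv T (w : word T) : word T :=
  rev [seq (a.1, ~~ a.2) | a <- w].

Inductive word_equiv (T : Type) : word T -> word T -> Prop :=
| word_equiv_refl w : word_equiv w w
| word_equiv_sym v w : word_equiv v w -> word_equiv w v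
| word_equiv_trans u v w : word_equiv u v -> word_equiv v w -> word_equiv u w
| word_equiv_cancel u v x b :
    word_equiv (u ++ (x, b) :: (x, ~~ b) :: v) (u ++ v).

Section FreeGroup.
Variable T : choiceType.
Implicit Types u v w : word T.

Definition word_rel : rel (word T) := fun u v => `[< word_equiv u v >].

Lemma word_rel_is_equiv : equiv_class_of word_rel.
Proof.
split=> [w|v w|v u w].
- by apply/asboolP; exact: word_equiv_refl.
- by apply/asboolP/asboolP; exact: word_equiv_sym.
- by move=> /asboolP uv /asboolP vw; apply/asboolP; exact: word_equiv_trans vw.
Qed.

Canonical word_equiv_rel := EquivRelPack word_rel_is_equiv.

Definition freeGroup := {eq_quot word_equiv_rel}%qT.

HB.instance Definition _ := EqQuotient.on freeGroup.
HB.instance Definition _ := Choice.on freeGroup.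

Definition free_class (w : word T) : freeGroup := (\pi w)%qT.

Definition free_gen (x : T) : freeGroup := free_class [:: (x, false)].

Definition free_one : freeGroup := free_class [::].
Definition free_mul (a b : freeGroup) : freeGroup :=
  free_class (repr a ++ repr b).
Definition free_inv (a : freeGroup) : freeGroup := free_class (word_inv (repr a)).

Lemma free_classP u v : free_class u = free_class v <-> word_equiv u v.
Proof.
split; first by move/eqmodP/asboolP.
by move=> uv; apply/eqmodP/asboolP.
Qed.

Lemma free_classK (a : freeGroup) : free_class (repr a) = a.
Proof. exact: reprK. Qed.

Lemma repr_free_class w : word_equiv (repr (free_class w)) w.
Proof. by apply/free_classP; rewrite free_classK. Qed.

Lemma word_equiv_cat u u' v v' :
  word_equiv u u' -> word_equiv v v' -> word_equiv (u ++ v) (u' ++ v').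
Proof.
move=> uu' vv'; apply: (@word_equiv_trans _ _ (u' ++ v)).
  elim: uu' => {u u'} [*|v0 w _ h|u v0 w _ h1 _ h2|u v0 x b].
  - exact: word_equiv_refl.
  - exact: word_equiv_sym.
  - exact: word_equiv_trans h2.
  - by rewrite -!catA; exact: word_equiv_cancel.
elim: vv' => {v v'} [*|v0 w _ h|v1 v0 w _ h1 _ h2|v1 v0 x b].
- exact: word_equiv_refl.
- exact: word_equiv_sym.
- exact: word_equiv_trans h2.
- by rewrite !catA; exact: word_equiv_cancel.
Qed.

Lemma word_invK : involutive (@word_inv T).
Proof.
move=> w; rewrite /word_inv map_rev revK -map_comp -[RHS]map_id.
by apply: eq_map => -[x b] /=; rewrite negbK.
Qed.

Lemma word_inv_cat u v : word_inv (u ++ v) = word_inv v ++ word_inv u.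
Proof. by rewrite /word_inv map_cat rev_cat. Qed.

Lemma word_inv_equiv u v : word_equiv u v -> word_equiv (word_inv u) (word_inv v).
Proof.
elim=> {u v} [*|v w _ h|u v w _ h1 _ h2|u v x b].
- exact: word_equiv_refl.
- exact: word_equiv_sym.
- exact: word_equiv_trans h2.
- rewrite -[_ :: _ :: v]/([:: (x, b); (x, ~~ b)] ++ v) !word_inv_cat -catA.
  by rewrite /(word_inv [:: _; _]) /= negbK; exact: word_equiv_cancel.
Qed.

Lemma word_mulwV w : word_equiv (w ++ word_inv w) [::].
Proof.
elim: w => [|[x b] w ih]; first exact: word_equiv_refl.
rewrite -cat1s word_inv_cat !catA -(catA [:: _]).
apply: (@word_equiv_trans _ _ (([:: (x, b)] ++ [::]) ++ word_inv [:: (x, b)])).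
  apply: word_equiv_cat; last exact: word_equiv_refl.
  by apply: word_equiv_cat ih; exact: word_equiv_refl.
exact: (word_equiv_cancel [::] [::]).
Qed.

Lemma free_classM u v : free_mul (free_class u) (free_class v) = free_class (u ++ v).
Proof. by apply/free_classP/word_equiv_cat; exact: repr_free_class. Qed.

Lemma free_classV w : free_inv (free_class w) = free_class (word_inv w).
Proof. by apply/free_classP/word_inv_equiv; exact: repr_free_class. Qed.

Lemma free_mulA : associative free_mul.
Proof.
move=> a b c; rewrite -(free_classK a) -(free_classK b) -(free_classK c).
by rewrite !free_classM catA.
Qed.

Lemma free_mul1g : left_id free_one free_mul.
Proof. by move=> a; rewrite -(free_classK a) free_classM. Qed.

Lemma free_mulg1 : right_id free_one free_mul.
Proof. by move=> a; rewrite -(free_classK a) free_classM cats0. Qed.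

Lemma free_mulgV : right_inverse free_one free_inv free_mul.
Proof.
move=> a; rewrite -(free_classK a) free_classV free_classM.
by apply/free_classP; exact: word_mulwV.
Qed.

Lemma free_mulVg : left_inverse free_one free_inv free_mul.
Proof.
move=> a; rewrite -(free_classK a) free_classV free_classM.
by apply/free_classP; rewrite -[X in _ ++ X]word_invK; exact: word_mulwV.
Qed.

HB.instance Definition _ := isGroup.Build freeGroup
  free_mulA free_mul1g free_mulg1 free_mulVg free_mulgV.

End FreeGroup.

Definition normal_subgroup (G : groupType) (N : set G) : Prop :=
  [/\ N 1%g, forall x y, N x -> N y -> N (x * y)%g,
      forall x, N x -> N (x^-1)%g & forall x y, N x -> N (x ^ y)%g].

Definition normal_closure (G : groupType) (A : set G) : set G :=
  \bigcap_(N in [set N | normal_subgroup N /\ A `<=` N]) N.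

Lemma normal_closureP (G : groupType) (A : set G) :
  normal_subgroup (normal_closure A).
Proof.
split=> [N [[]]//|x y Nx Ny N NA|x Nx N NA|x y Nx N NA].
- by case: (NA) => -[_ NM _ _] _; apply: NM; [exact: Nx | exact: Ny].
- by case: (NA) => -[_ _ NV _] _; apply: NV; exact: Nx.
- by case: (NA) => -[_ _ _ NJ] _; apply: NJ; exact: Nx.
Qed.

Lemma sub_normal_closure (G : groupType) (A : set G) : A `<=` normal_closure A.
Proof. by move=> x Ax N [_]; exact. Qed.

Section QuotientGroup.
Variables (G : groupType) (A : set G).
Let N := normal_closure A.
Implicit Types x y : G.

Definition coset_rel : rel G := fun x y => `[< N (x^-1 * y)%g >].

Lemma coset_rel_is_equiv : equiv_class_of coset_rel.
Proof.
have [N1 NM NV _] := normal_closureP A.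
split=> [x|x y|y x z].
- by apply/asboolP; rewrite mulVg.
- by apply/asboolP/asboolP => /NV; rewrite invgM invgK.
- move=> /asboolP xy /asboolP yz; apply/asboolP.
  by have := NM _ _ xy yz; rewrite mulgA mulgK.
Qed.

Canonical coset_equiv_rel := EquivRelPack coset_rel_is_equiv.

(* The quotient of [G] by [normal_closure A], not by [A] itself. *)
Definition quotientGroup := {eq_quot coset_equiv_rel}%qT.

HB.instance Definition _ := EqQuotient.on quotientGroup.
HB.instance Definition _ := Choice.on quotientGroup.

Definition quo_class (x : G) : quotientGroup := (\pi x)%qT.

Definition quo_one : quotientGroup := quo_class 1%g.
Definition quo_mul (a b : quotientGroup) : quotientGroup :=
  quo_class (repr a * repr b)%g.
Definition quo_inv (a : quotientGroup) : quotientGroup :=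
  quo_class (repr a)^-1%g.

Lemma quo_classP x y :
  quo_class x = quo_class y <-> normal_closure A (x^-1 * y)%g.
Proof.
split; first by move/eqmodP/asboolP.
by move=> xy; apply/eqmodP/asboolP.
Qed.

Lemma quo_classK (a : quotientGroup) : quo_class (repr a) = a.
Proof. exact: reprK. Qed.

Lemma repr_quo_class x : normal_closure A ((repr (quo_class x))^-1 * x)%g.
Proof. by apply/quo_classP; rewrite quo_classK. Qed.

Lemma quo_classM x y : quo_mul (quo_class x) (quo_class y) = quo_class (x * y)%g.
Proof.
have [_ NM _ NJ] := normal_closureP A.
apply/quo_classP; set x' := repr _; set y' := repr _.
have -> : ((x' * y')^-1 * (x * y) = ((x'^-1 * x) ^ y') * (y'^-1 * y))%g.
  by rewrite conjgE invgM !mulgA mulgK.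
exact: (NM _ _ (NJ _ _ (repr_quo_class x)) (repr_quo_class y)).
Qed.

Lemma quo_classV x : quo_inv (quo_class x) = quo_class x^-1%g.
Proof.
have [_ _ NV NJ] := normal_closureP A.
apply/quo_classP; set x' := repr _.
have -> : (x'^-1^-1 * x^-1 = ((x'^-1 * x)^-1) ^ x'^-1)%g.
  by rewrite conjgE invgM !invgK -!mulgA mulgV mulg1.
exact: (NJ _ _ (NV _ (repr_quo_class x))).
Qed.

Lemma quo_mulA : associative quo_mul.
Proof.
move=> a b c; rewrite -(quo_classK a) -(quo_classK b) -(quo_classK c).
by rewrite !quo_classM mulgA.
Qed.

Lemma quo_mul1g : left_id quo_one quo_mul.
Proof. by move=> a; rewrite -(quo_classK a) quo_classM mul1g. Qed.

Lemma quo_mulg1 : right_id quo_one quo_mul.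
Proof. by move=> a; rewrite -(quo_classK a) quo_classM mulg1. Qed.

Lemma quo_mulVg : left_inverse quo_one quo_inv quo_mul.
Proof. by move=> a; rewrite -(quo_classK a) quo_classV quo_classM mulVg. Qed.

Lemma quo_mulgV : right_inverse quo_one quo_inv quo_mul.
Proof. by move=> a; rewrite -(quo_classK a) quo_classV quo_classM mulgV. Qed.

HB.instance Definition _ := isGroup.Build quotientGroup
  quo_mulA quo_mul1g quo_mulg1 quo_mulVg quo_mulgV.

End QuotientGroup.

Definition burnside (m p : nat) : groupType :=
  quotientGroup [set (g ^+ p)%g | g in [set: freeGroup 'I_m]].

Definition burnside_gen (m p : nat) (i : 'I_m) : burnside m p :=
  quo_class _ (free_gen i).

Lemma burnside_exp (m p : nat) (x : burnside m p) : (x ^+ p = 1)%g.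
Proof.
rewrite -(quo_classK x); set g := repr x.
have -> n : (quo_class _ g ^+ n)%g = quo_class _ (g ^+ n)%g :> burnside m p.
  elim: n => // n ih.
  by rewrite !expgS ih -[LHS]/(quo_mul _ _) quo_classM.
apply/quo_classP; rewrite mulg1.
have [_ _ NV _] := normal_closureP [set (g ^+ p)%g | g in [set: freeGroup 'I_m]].
by apply: NV; apply: sub_normal_closure; exists g.
Qed.

Lemma burnside_lift (m p : nat) (G : groupType) (h : 'I_m -> G) :
    (forall x : G, (x ^+ p = 1)%g) ->
  exists2 phi : burnside m p -> G,
    {morph phi : x y / (x * y)%g} & forall i, phi (burnside_gen p i) = h i.
Proof.
move=> Gp.
pose letter (a : 'I_m * bool) := if a.2 then (h a.1)^-1%g else h a.1.
pose ev (w : word 'I_m) : G := foldr (fun a z => (letter a * z)%g) 1%g w.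
have ev_cat u v : ev (u ++ v) = (ev u * ev v)%g.
  by elim: u => [|a u ih]; rewrite /= ?mul1g// ih mulgA.
have ev_equiv u v : word_equiv u v -> ev u = ev v.
  elim=> {u v} [//|//|u v w _ -> _ ->//|u v x b].
  by rewrite !ev_cat /= /letter; case: b; rewrite /= ?mulKg ?mulVKg.
pose psi (a : freeGroup 'I_m) := ev (repr a).
have psi_class w : psi (free_class w) = ev w.
  by apply: ev_equiv; exact: repr_free_class.
have psiM a b : psi (a * b)%g = (psi a * psi b)%g.
  by rewrite -[(a * b)%g]/(free_mul a b) psi_class ev_cat.
have psi1 : psi 1%g = 1%g by exact: (psi_class [::]).
have psiX a n : psi (a ^+ n)%g = (psi a ^+ n)%g.
  by elim: n => // n ih; rewrite !expgS psiM ih.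
have psiV a : psi a^-1%g = (psi a)^-1%g.
  by apply: (mulIg (psi a)); rewrite -psiM !mulVg psi1.
pose K : set (freeGroup 'I_m) := [set a | psi a = 1%g].
have KA : normal_closure [set (g ^+ p)%g | g in setT] `<=` K.
  move=> a; apply; split; last by move=> _ [g _ <-]; rewrite /K /= psiX Gp.
  rewrite /K; split=> //= [x y px py|x px|x y px].
  - by rewrite psiM px py mulg1.
  - by rewrite psiV px invg1.
  - by rewrite conjgE !psiM px mul1g psiV mulVg.
have psi_quo x : psi (repr (quo_class _ x : burnside m p)) = psi x.
  have /KA := repr_quo_class (A := [set (g ^+ p)%g | g in setT]) x.
  rewrite /K /= psiM psiV => rx.
  by apply: (mulgI ((psi (repr (quo_class _ x : burnside m p)))^-1)%g); rewrite mulVg rx.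
exists (fun x => psi (repr x)) => [x y|i].
  by rewrite -[(x * y)%g]/(quo_mul x y) psi_quo psiM.
by rewrite psi_quo psi_class /= /letter mulg1.
Qed.

Lemma burnside_lift_unique (m p : nat) (G : groupType)
    (phi psi : burnside m p -> G) :
    {morph phi : x y / (x * y)%g} -> {morph psi : x y / (x * y)%g} ->
  (forall i, phi (burnside_gen p i) = psi (burnside_gen p i)) -> phi =1 psi.
Proof.
have morph1 (f : burnside m p -> G) : {morph f : x y / (x * y)%g} -> f 1%g = 1%g.
  by move=> fM; apply: (mulgI (f 1%g)); rewrite -fM !mulg1.
have morphV (f : burnside m p -> G) :
    {morph f : x y / (x * y)%g} -> forall x, f x^-1%g = (f x)^-1%g.
  by move=> fM x; apply: (mulIg (f x)); rewrite -fM !mulVg morph1.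
move=> phiM psiM gens x.
rewrite -(quo_classK x) -(free_classK (repr x)).
elim: {x}(repr (repr x)) => [|[i b] w ih]; first by rewrite [LHS]morph1// [RHS]morph1.
have -> : quo_class _ (free_class ((i, b) :: w)) =
    ((if b then (burnside_gen p i)^-1 else burnside_gen p i) *
     (quo_class _ (free_class w) : burnside m p))%g.
  rewrite -cat1s -free_classM -[RHS]/(quo_mul _ _).
  case: b; last by rewrite quo_classM.
  by rewrite -[(_^-1)%g]/(quo_inv _) quo_classV quo_classM
    -[(free_gen i)^-1%g]/(free_inv _) free_classV.
by rewrite phiM psiM ih; congr (_ * _)%g; case: b; rewrite ?morphV// gens.
Qed.

Record invariant_mean (R : realType) (G : groupType) (mu : (G -> R) -> R) :
    Prop := InvariantMean {
  mean_linear : forall (a : R) (f g : G -> R), bounded_fun f -> bounded_fun g ->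
    mu (fun x => a * f x + g x) = a * mu f + mu g ;
  mean_ge0 : forall f : G -> R, bounded_fun f -> (forall x, 0 <= f x) -> 0 <= mu f ;
  mean1 : mu (fun=> 1) = 1 ;
  (* Left translation acts by [(g . f) x = f (g^-1 x)]. *)
  mean_inv : forall (g : G) (f : G -> R), bounded_fun f ->
    mu (fun x => f (g^-1 * x)%g) = mu f }.

(* A mean is a functional on bounded functions: the values of [mu] on unbounded
   functions are irrelevant. *)
Definition amenable (R : realType) (G : groupType) : Prop :=
  exists mu : (G -> R) -> R, invariant_mean mu.

(* Hilbert spaces are complex. Scalar products are linear in the first variable and conjugate-linear in the
   second one. *)
HB.mixin Record NormedModule_isHilbert (R : realType) V
    & NormedModule R[i] V := {
  hdot : {dot V for (@Num.conj R[i])} ;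
  hdotE : forall x : V, hdot x x = `|x| ^+ 2 }.

#[short(type="hilbertType")]
HB.structure Definition Hilbert (R : realType) :=
  {V of CompleteNormedModule R[i] V & NormedModule_isHilbert R V}.

Lemma normr_Re (R : realType) (V : normedModType R[i]) (x : V) :
  `|x| = (complex.Re `|x|)%:C.
Proof.
have := normr_ge0 x; rewrite lecE => /andP[/eqP Im0 _].
by rewrite [LHS]complexE Im0 mulr0 addr0.
Qed.

(* Norms over [R[i]] are [R[i]]-valued, with real values: [complex.Re] brings
   them back to [R]. *)
Definition opnorm (R : realType) (V W : normedModType R[i]) (f : V -> W) : \bar R :=
  ereal_sup [set (complex.Re `|f x|)%:E | x in [set x : V | `|x| <= 1]].

Definition bounded_operator (R : realType) (V W : normedModType R[i])
    (f : V -> W) : Prop :=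
  linear f /\ (opnorm f < +oo)%E.

Lemma opnorm_le (R : realType) (V W : normedModType R[i]) (f : V -> W) (M : R) :
    linear f -> 0 <= M ->
  (opnorm f <= M%:E)%E <-> (forall x, `|f x| <= M%:C * `|x|).
Proof.
move=> lf M0; split=> [fM x|fM].
  pose F : {linear V -> W} := HB.pack f (GRing.isLinear.Build _ _ _ _ _ lf).
  have fE : f = F by [].
  have [->|x0] := eqVneq x 0; first by rewrite fE linear0 !normr0 mulr0.
  have nx0 : 0 < `|x| by rewrite normr_gt0.
  have fx : f x = `|x| *: f (`|x|^-1 *: x).
    by rewrite fE linearZ /= scalerA divff ?gt_eqF// scale1r.
  have nx1 : `|(`|x|^-1 *: x)| <= 1.
    by rewrite normrZ normfV normr_id mulVf ?gt_eqF.
  rewrite fx normrZ normr_id mulrC ler_pM2r//.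
  move: (_ *: x) nx1 => y y1.
  rewrite normr_Re lecR -lee_fin.
  by apply: le_trans fM; apply: ereal_sup_ubound; exists y.
apply: ge_ereal_sup => _ [x /= x1 <-].
rewrite lee_fin -lecR -normr_Re (le_trans (fM x))//.
by rewrite -[leRHS]mulr1 ler_wpM2l// lecR.
Qed.

(* [pi t] is invertible, with inverse [pi t^-1], by the last two fields. *)
Record representation (R : realType) (G : groupType) (H : hilbertType R)
    (pi : G -> H -> H) : Prop := Representation {
  rep_bounded : forall t, bounded_operator (pi t) ;
  rep1 : pi 1%g = id ;
  repM : forall s t, pi (s * t)%g = pi s \o pi t }.

Definition uniformly_bounded (R : realType) (G : groupType) (H : hilbertType R)
    (pi : G -> H -> H) : Prop :=
  (ereal_sup [set opnorm (pi t) | t in [set: G]] < +oo)%E.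

Definition unitary_operator (R : realType) (H : hilbertType R) (U : H -> H) : Prop :=
  [/\ bounded_operator U, forall x y, hdot (U x) (U y) = hdot x y
    & forall y, exists x, U x = y].

Definition unitary_representation (R : realType) (G : groupType)
    (H : hilbertType R) (pi : G -> H -> H) : Prop :=
  representation pi /\ forall t, unitary_operator (pi t).

Definition unitarizable_representation (R : realType) (G : groupType)
    (H : hilbertType R) (pi : G -> H -> H) : Prop :=
  exists S Sinv : H -> H,
    [/\ bounded_operator S, bounded_operator Sinv, cancel S Sinv, cancel Sinv S
      & unitary_representation (fun t => Sinv \o pi t \o S)].

Definition unitarizable (R : realType) (G : groupType) : Prop :=
  forall (H : hilbertType R) (pi : G -> H -> H),
    representation pi -> uniformly_bounded pi -> unitarizable_representation pi.

(* Main.v *)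
(* Let G = B(2,p). The wreath-like product W of two families of lamps with values
   in Z/n, placed at the points of G, by G has exponent dividing np, so that
   B(2,np) maps to W, a generator going to itself together with one lit lamp at 1;
   the p-th power of that element lights the lamps of a coset of a cyclic
   subgroup. Averaging over such a lamp gives commuting projections on l2(W),
   whose joint spectral measure at the point mass at 1 is a Bernoulli percolation
   of density 1/n, equivariant under left translations.

   As G is not amenable, Kesten's theorem gives large families of letters s_i
   with |sum_i s_i| much smaller than their number. An edge from v to v s_i is
   open when the lamps around v and v s_i show a rare pattern depending on i; the
   smallness of |sum_i s_i| makes short cycles of open edges rare, although
   many edges are open. Deleting the edges on short cycles, the open graph is a
   forest on every finite set, so it can be oriented with at most one outgoing
   edge at each vertex. The operator T moving along outgoing edges is an
   ultralimit of finite truncations; two orientations of the same forest differ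
   by an antisymmetric kernel with at most two entries per row, so commutators of
   T with left translations have norm at most 2. If T' has the same commutators,
   then T - T' commutes with left translations, and pairing it with the vectors
   of the percolation bounds |T'| from below by a quantity as large as desired.

   Summing such operators over a sequence of parameters, the representation with
   matrix [[lambda, [T, lambda]], [0, lambda]] is uniformly bounded; were it
   unitarizable, the orthogonal complement of the invariant subspace for an
   invariant scalar product would be the graph of a bounded T'. *)

From HB Require Import structures.
From mathcomp Require Import all_boot all_order all_algebra.
From mathcomp Require Import complex finmap.
From mathcomp Require Import all_classical all_reals all_analysis.
From mathcomp Require Import ring lra zify.
Require Import Defs.

Set Implicit Arguments.
Unset Strict Implicit.
Unset Printing Implicit Defensive.

Import Order.TTheory GRing.Theory Num.Theory.
Import numFieldNormedType.Exports.

Local Open Scope classical_set_scope.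
Local Open Scope ring_scope.

(** * Limits along ultrafilters *)

(** Let m bound the norm of the sum of the d letters; a vertex is marked by 2t lamps, and a tail of
    a lamps singles out a letter. A marked vertex has about x = d / n^(2t+a) open edges, while a T'
    of norm at most C would force x < 33 (1 + C)^2; so x has to be large. There are at most (2m)^l
    closed words of length l, and each edge of a cycle costs n^-(t+a) only, since two tails at a
    common vertex may share t lamps. Kesten's theorem for long products makes m/d small enough to
    absorb this loss and to keep cycles rare.

    The obstacle is that all sites of a coset carry the same lamp. The windows are therefore spread
    along a sequence [u] so sparse that, apart from diagonal coincidences (g u_j and u_j in one
    coset), a translate of the window meets it at two places at most. Each vertex is marked in two
    families of lamps, because a nontrivial g cannot have diagonal coincidences in both. Isolation
    of the marked vertices then makes the lamps at different vertices of an open cycle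
    independent. *)

Section UltraLimit.
Variables (R : realType) (T : Type) (U : set_system T).
Hypothesis UU : UltraFilter U.

Lemma ultra_fmap (V : Type) (u : T -> V) : UltraFilter (u @ U).
Proof.
split=> [|G GF UG]; first exact: fmap_proper_filter.
apply/seteqP; split=> [A GA|//].
have [//|UA] := in_ultra_setVsetC (u @^-1` A) UU.
have /(filterI GA) : G (~` A) by exact: UG.
by rewrite setICr => /filter_ex[].
Qed.

(** By compactness of the segment. Sums, means and operators are all built below as limits of
    bounded nets along an ultrafilter, without any Cauchy estimate. *)
Lemma ulim_cvg (u : T -> R) (M : R) : (forall t, `|u t| <= M) -> cvg (u @ U).
Proof.
move=> uM; have := @segment_compact R (- M) M; rewrite compact_ultra.
have uU : (u @ U) `[- M, M]%classic.
  rewrite /fmap /=; apply: filterE => t /=; rewrite in_itv /= -ler_norml; exact: uM.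
move=> /(_ _ (ultra_fmap u) uU)[l [_ ul]].
by apply/cvg_ex; exists l.
Qed.

End UltraLimit.

Section FinsetFilter.
Variable I : choiceType.

Definition fset_filter : set_system {fset I} :=
  [set A | exists F0 : {fset I}, [set F : {fset I} | (F0 `<=` F)%fset] `<=` A].

Lemma fset_filter_proper : ProperFilter fset_filter.
Proof.
split; first by case=> F0 /(_ F0); apply; rewrite /= fsubset_refl.
split; first by exists fset0.
- move=> A B [F FA] [G GB]; exists (F `|` G)%fset => K /= /fsubUsetP[FK GK].
  by split; [exact: FA | exact: GB].
- by move=> A B AB [F FA]; exists F; exact: subset_trans AB.
Qed.

(** An ultrafilter containing, for every finite set, the family of its finite supersets. Limits
    along it serve both as unordered sums and as limits of finite truncations. *)
Definition fset_ultra : set_system {fset I} :=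
  projT1 (cid (ultraFilterLemma fset_filter_proper)).

Lemma fset_ultraP : UltraFilter fset_ultra.
Proof. by rewrite /fset_ultra; case: cid => /= ? []. Qed.

Lemma fset_ultra_ge (F0 : {fset I}) : fset_ultra [set F : {fset I} | (F0 `<=` F)%fset].
Proof. by rewrite /fset_ultra; case: cid => /= ? [_]; apply; exists F0. Qed.

End FinsetFilter.
Arguments fset_ultraP {I}.
#[export] Existing Instance fset_ultraP.

Lemma ler_sum_fset (R : realDomainType) (I : choiceType) (F G : {fset I}) (a : I -> R) :
  (F `<=` G)%fset -> (forall i, 0 <= a i) ->
  \sum_(i <- F) a i <= \sum_(i <- G) a i.
Proof.
move=> /fsubsetP FG a0; rewrite [leRHS](bigID [in F])/=.
have -> : \sum_(i <- G | i \in F) a i = \sum_(i <- F) a i.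
  rewrite -big_filter; apply: perm_big; apply: uniq_perm => [||i].
  - by rewrite filter_uniq.
  - by [].
  - by rewrite mem_filter andb_idr// => /FG.
by rewrite lerDl sumr_ge0.
Qed.

(** * Real Hilbert spaces of square summable functions *)

Section L2.
Variables (R : realType) (I : choiceType).

(** Bounded finite sums stand for convergence, so that index sets of any cardinality are covered. *)
Definition square_summable : {pred I -> R} := fun f =>
  `[< exists M, forall F : {fset I}, \sum_(i <- F) f i ^+ 2 <= M >].

Lemma square_summable_submod : submod_closed square_summable.
Proof.
split=> [|a f g]; rewrite ?unfold_in.
  by apply/asboolP; exists 0 => F; rewrite big1// => i _; rewrite [X in X ^+ _]/(0 : R) expr0n.
move=> /asboolP[M fM] /asboolP[N gN]; apply/asboolP.
exists (2 * a ^+ 2 * M + 2 * N) => F.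
apply: (@le_trans _ _
    (\sum_(i <- F) (2 * a ^+ 2 * f i ^+ 2 + 2 * g i ^+ 2))).
  apply: ler_sum => i _; rewrite -subr_ge0.
  rewrite [X in 0 <= X](_ : _ = (a * f i - g i) ^+ 2) ?sqr_ge0//.
  by rewrite -[(_ + _) i]/(a * f i + g i); ring.
rewrite big_split/= -!mulr_sumr lerD ?ler_wpM2l//.
by rewrite mulr_ge0// sqr_ge0.
Qed.

HB.instance Definition _ :=
  GRing.isSubmodClosed.Build R (I -> R) square_summable square_summable_submod.

Record l2 := L2 { l2fun :> I -> R; _ : l2fun \in square_summable }.

HB.instance Definition _ := [isSub for l2fun].
HB.instance Definition _ := [Choice of l2 by <:].
HB.instance Definition _ := [SubChoice_isSubLmodule of l2 by <:].

Lemma l2P (f g : l2) : f =1 g -> f = g.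
Proof. by move=> fg; apply/val_inj/funext. Qed.

Lemma l2D (f g : l2) i : (f + g) i = f i + g i. Proof. by []. Qed.
Lemma l2N (f : l2) i : (- f) i = - f i. Proof. by []. Qed.
Lemma l2B (f g : l2) i : (f - g) i = f i - g i. Proof. by []. Qed.
Lemma l2Z a (f : l2) i : (a *: f) i = a * f i. Proof. by []. Qed.
Lemma l2_sum T (r : seq T) P (F : T -> l2) i :
  (\sum_(t <- r | P t) F t) i = \sum_(t <- r | P t) F t i.
Proof. by elim/big_rec2: _ => // t y x _ <-. Qed.

Definition l2_of (f : I -> R) (M : R)
    (fM : forall F : {fset I}, \sum_(i <- F) f i ^+ 2 <= M) : l2 :=
  L2 (asboolT (ex_intro _ M fM)).

Lemma l2_bound (f : l2) : exists M, forall F : {fset I}, \sum_(i <- F) f i ^+ 2 <= M.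
Proof. by apply/asboolP; exact: (valP f). Qed.

Definition dot (f g : l2) : R :=
  lim ((fun F : {fset I} => \sum_(i <- F) f i * g i) @ @fset_ultra I).

Lemma dot_cvg (f g : l2) :
  cvg ((fun F : {fset I} => \sum_(i <- F) f i * g i) @ @fset_ultra I).
Proof.
have [M fM] := l2_bound f; have [N gN] := l2_bound g.
apply: (@ulim_cvg _ _ _ _ _ (M + N)) => F.
apply: le_trans (ler_norm_sum _ _ _) _.
apply: le_trans (lerD (fM F) (gN F)); rewrite -big_split/=.
apply: ler_sum => i _; rewrite normrM -(real_normK (num_real (f i))).
rewrite -(real_normK (num_real (g i))) -subr_ge0.
have := sqr_ge0 (`|f i| - `|g i|); have := sqr_ge0 (`|f i| + `|g i|).
by nra.
Qed.

Lemma dotE (f g : l2) l :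
  (fun F : {fset I} => \sum_(i <- F) f i * g i) @ @fset_ultra I --> l -> dot f g = l.
Proof. by move=> h; apply/cvg_lim. Qed.

Lemma dotC f g : dot f g = dot g f.
Proof.
by rewrite /dot; under eq_fun do under eq_bigr do rewrite mulrC.
Qed.

Lemma dotDl f g h : dot (f + g) h = dot f h + dot g h.
Proof.
apply: dotE.
under eq_fun do (under eq_bigr do rewrite l2D mulrDl; rewrite big_split/=).
by apply: cvgD; exact: dot_cvg.
Qed.

Lemma dotZl a f g : dot (a *: f) g = a * dot f g.
Proof.
apply: dotE.
under eq_fun do (under eq_bigr do rewrite l2Z -mulrA; rewrite -mulr_sumr).
by apply: cvgMr; exact: dot_cvg.
Qed.

Lemma dotDr f g h : dot h (f + g) = dot h f + dot h g.
Proof. by rewrite dotC dotDl !(dotC h). Qed.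
Lemma dotZr a f g : dot f (a *: g) = a * dot f g.
Proof. by rewrite dotC dotZl dotC. Qed.
Lemma dotNl f g : dot (- f) g = - dot f g.
Proof. by rewrite -scaleN1r dotZl mulN1r. Qed.
Lemma dotNr f g : dot f (- g) = - dot f g.
Proof. by rewrite dotC dotNl dotC. Qed.
Lemma dotBl f g h : dot (f - g) h = dot f h - dot g h.
Proof. by rewrite dotDl dotNl. Qed.
Lemma dotBr f g h : dot h (f - g) = dot h f - dot h g.
Proof. by rewrite dotDr dotNr. Qed.
Lemma dot0l f : dot 0 f = 0. Proof. by rewrite -(scale0r 0) dotZl mul0r. Qed.
Lemma dot0r f : dot f 0 = 0. Proof. by rewrite dotC dot0l. Qed.
Lemma dot_suml T (r : seq T) P (F : T -> l2) g :
  dot (\sum_(t <- r | P t) F t) g = \sum_(t <- r | P t) dot (F t) g.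
Proof.
by elim/big_rec2: _ => [|t y x _ <-]; rewrite ?dot0l// dotDl.
Qed.
Lemma dot_sumr T (r : seq T) P (F : T -> l2) g :
  dot g (\sum_(t <- r | P t) F t) = \sum_(t <- r | P t) dot g (F t).
Proof. by rewrite dotC dot_suml; apply: eq_bigr => t _; rewrite dotC. Qed.

Definition sqn (f : l2) := dot f f.

Lemma sum_le_sqn (f : l2) (F : {fset I}) : \sum_(i <- F) f i ^+ 2 <= sqn f.
Proof.
apply: limr_ge; first exact: dot_cvg.
apply: filterS (fset_ultra_ge F) => G /= FG.
by under [leRHS]eq_bigr do rewrite -expr2; apply: ler_sum_fset => // i; exact: sqr_ge0.
Qed.

End L2.

Section L2Norm.
Variables (R : realType) (I : choiceType).
Implicit Types f g h : l2 R I.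

Lemma sqn_le f M : (forall F : {fset I}, \sum_(i <- F) f i ^+ 2 <= M) -> sqn f <= M.
Proof.
move=> fM; apply: limr_le; first exact: dot_cvg.
by apply: nearW => F; under eq_bigr do rewrite -expr2; exact: fM.
Qed.

Lemma sqn_ge0 f : 0 <= sqn f.
Proof. by apply: le_trans (sum_le_sqn f fset0); rewrite big_seq_fset0. Qed.

Lemma coord_le_sqn f i : f i ^+ 2 <= sqn f.
Proof. by apply: le_trans (sum_le_sqn f [fset i]%fset); rewrite big_seq_fset1. Qed.

Lemma sqn_eq0 f : sqn f = 0 -> f = 0.
Proof.
move=> f0; apply: l2P => i; have := coord_le_sqn f i; rewrite f0 => fi.
by apply/eqP; rewrite -sqrf_eq0 eq_le fi sqr_ge0.
Qed.

Lemma sqn0 : sqn (0 : l2 R I) = 0. Proof. exact: dot0l. Qed.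

Lemma sqnZ a f : sqn (a *: f) = a ^+ 2 * sqn f.
Proof. by rewrite /sqn dotZl dotZr mulrA expr2. Qed.
Lemma sqnN f : sqn (- f) = sqn f.
Proof. by rewrite -scaleN1r sqnZ sqrrN expr1n mul1r. Qed.
Lemma sqnD f g : sqn (f + g) = sqn f + 2 * dot f g + sqn g.
Proof. by rewrite /sqn !dotDl !dotDr (dotC g f); ring. Qed.
Lemma sqnB f g : sqn (f - g) = sqn f - 2 * dot f g + sqn g.
Proof. by rewrite sqnD sqnN dotNr; ring. Qed.
Lemma sqnBC f g : sqn (f - g) = sqn (g - f).
Proof. by rewrite -opprB sqnN. Qed.

Lemma dot_sqr_le f g : dot f g ^+ 2 <= sqn f * sqn g.
Proof.
have [g0|g0] := eqVneq (sqn g) 0.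
  by rewrite g0 mulr0 (sqn_eq0 g0) dot0r expr0n.
have gp : 0 < sqn g by rewrite lt_neqAle eq_sym g0 sqn_ge0.
have := sqn_ge0 (sqn g *: f - dot f g *: g).
rewrite sqnB !sqnZ dotZl dotZr.
rewrite [X in 0 <= X](_ : _ = sqn g * (sqn f * sqn g - dot f g ^+ 2)).
  by rewrite pmulr_rge0// subr_ge0.
by ring.
Qed.

Definition nrm f : R := Num.sqrt (sqn f).

Lemma nrm_ge0 f : 0 <= nrm f. Proof. exact: sqrtr_ge0. Qed.
Lemma nrm_sqr f : nrm f ^+ 2 = sqn f. Proof. by rewrite sqr_sqrtr// sqn_ge0. Qed.
Lemma nrm_eq0 f : nrm f = 0 -> f = 0.
Proof. by move=> f0; apply: sqn_eq0; rewrite -nrm_sqr f0 expr0n. Qed.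
Lemma nrm0 : nrm 0 = 0. Proof. by rewrite /nrm sqn0 sqrtr0. Qed.
Lemma nrmZ a f : nrm (a *: f) = `|a| * nrm f.
Proof. by rewrite /nrm sqnZ sqrtrM ?sqr_ge0// sqrtr_sqr. Qed.
Lemma nrmN f : nrm (- f) = nrm f. Proof. by rewrite /nrm sqnN. Qed.

Lemma dot_le f g : `|dot f g| <= nrm f * nrm g.
Proof.
rewrite -(ler_pXn2r (ltn0Sn 1)) ?nnegrE ?mulr_ge0 ?nrm_ge0//.
by rewrite real_normK ?num_real// exprMn !nrm_sqr dot_sqr_le.
Qed.

Lemma nrmD f g : nrm (f + g) <= nrm f + nrm g.
Proof.
rewrite -(ler_pXn2r (ltn0Sn 1)) ?nnegrE ?addr_ge0 ?nrm_ge0//.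
rewrite nrm_sqr sqnD sqrrD !nrm_sqr -mulr_natl.
have := le_trans (ler_norm _) (dot_le f g); lra.
Qed.

Lemma nrmB f g : nrm (f - g) <= nrm f + nrm g.
Proof. by rewrite -(nrmN g) nrmD. Qed.

Lemma nrm_le_sqn f M : 0 <= M -> (nrm f <= M) = (sqn f <= M ^+ 2).
Proof.
by move=> M0; rewrite -nrm_sqr ler_pXn2r// nnegrE nrm_ge0.
Qed.

Lemma sqnD_le f g : sqn (f + g) <= 2 * sqn f + 2 * sqn g.
Proof. by have := sqn_ge0 (f - g); rewrite sqnB sqnD; lra. Qed.

Lemma dot_fin f g (F : {fset I}) :
  (forall i, i \notin F -> f i = 0) -> dot f g = \sum_(i <- F) f i * g i.
Proof.
move=> f0; apply: dotE; apply: cvg_near_cst; apply: filterS (fset_ultra_ge F) => G /= FG.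
by apply/esym/big_fset_incl => // i _ /f0 ->; rewrite mul0r.
Qed.

Lemma mask_subproof (P : pred I) f (F : {fset I}) :
  \sum_(i <- F) (if P i then f i else 0) ^+ 2 <= sqn f.
Proof.
apply: le_trans (sum_le_sqn f F); apply: ler_sum => i _.
by case: ifP => // _; rewrite expr0n sqr_ge0.
Qed.
Definition mask P f : l2 R I := l2_of (mask_subproof P f).

Lemma maskE P f i : mask P f i = if P i then f i else 0. Proof. by []. Qed.

Lemma maskD P f g : mask P (f + g) = mask P f + mask P g.
Proof. by apply: l2P => i; rewrite l2D !maskE l2D; case: ifP; rewrite ?addr0. Qed.
Lemma maskZ P a f : mask P (a *: f) = a *: mask P f.
Proof. by apply: l2P => i; rewrite l2Z !maskE l2Z; case: ifP; rewrite ?mulr0. Qed.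
Lemma mask_dot P f g : dot (mask P f) g = dot f (mask P g).
Proof.
rewrite /dot.
have -> // : (fun F : {fset I} => \sum_(i <- F) mask P f i * g i) =
    (fun F : {fset I} => \sum_(i <- F) f i * mask P g i).
apply/funext => F; apply: eq_bigr => i _.
by rewrite !maskE; case: ifP; rewrite ?mul0r ?mulr0.
Qed.
Lemma mask_dot2 P f g : dot (mask P f) g = dot (mask P f) (mask P g).
Proof.
rewrite -mask_dot; congr dot; apply: l2P => i; rewrite !maskE.
by case: ifP => // ->.
Qed.
Lemma mask_sqn P f : sqn f = sqn (mask P f) + sqn (f - mask P f).
Proof.
by rewrite sqnB [dot f _]dotC mask_dot2; rewrite /sqn; ring.
Qed.
Lemma mask_sqn_le P f : sqn (mask P f) <= sqn f.
Proof. by rewrite (mask_sqn P f) lerDl sqn_ge0. Qed.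

(** If every finite restriction missed more than [e], all finite sums would be at most [sqn f - e],
    hence so would [sqn f]. *)
Lemma trunc_approx f e : 0 < e ->
  exists F : {fset I}, sqn (f - mask [in F] f) <= e.
Proof.
move=> e0; apply: contrapT => /forallNP nF.
have := sqn_ge0 f; suff : sqn f <= sqn f - e by lra.
apply: sqn_le => F; have /negP := nF F; rewrite -ltNge => ltF.
have -> : \sum_(i <- F) f i ^+ 2 = sqn (mask [in F] f).
  rewrite /sqn (@dot_fin _ _ F) => [|i /negbTE iF]; last by rewrite maskE /= iF.
  by rewrite !big_seq; apply: eq_bigr => i iF; rewrite maskE /= iF expr2.
by rewrite [sqn f](mask_sqn [in F] f) lerBrDr lerD2l ltW.
Qed.

Lemma delta_subproof (k : I) (F : {fset I}) :
  \sum_(i <- F) ((i == k)%:R : R) ^+ 2 <= 1.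
Proof.
have -> : \sum_(i <- F) ((i == k)%:R : R) ^+ 2 = \sum_(i <- F | i == k) 1.
  by rewrite [RHS]big_mkcond; apply: eq_bigr => i _; case: eqP; rewrite ?expr1n ?expr0n.
rewrite -big_filter big_const_seq iter_addr_0 count_predT size_filter.
have := count_uniq_mem k (fset_uniq F) => ->.
by case: (_ \in _).
Qed.
Definition delta k : l2 R I := l2_of (delta_subproof k).

Lemma deltaE k i : delta k i = (i == k)%:R. Proof. by []. Qed.
Lemma dot_delta k f : dot (delta k) f = f k.
Proof.
rewrite (@dot_fin _ _ [fset k]%fset) ?big_seq_fset1 ?deltaE ?eqxx ?mul1r//.
by move=> i; rewrite inE => /negbTE ik; rewrite deltaE ik.
Qed.
Lemma sqn_delta k : sqn (delta k) = 1.
Proof. by rewrite /sqn dot_delta deltaE eqxx. Qed.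

Lemma l2_complete (F : set_system (l2 R I)) : ProperFilter F ->
    (forall e, 0 < e -> exists f, F [set g | sqn (f - g) <= e]) ->
  exists l, forall e, 0 < e -> F [set g | sqn (l - g) <= e].
Proof.
move=> FF cauchyF; have [V [UV FV]] := ultraFilterLemma FF.
have [f0 Ff0] := cauchyF 1 ltr01.
(* Off the ball of radius 1 around [f0] the coordinate is replaced by that of [f0]: [ulim_cvg] asks
   for a bound at every point, not only on a large set. *)
pose u (i : I) (g : l2 R I) : R := if sqn (f0 - g) <= 1 then g i else f0 i.
have u_cvg i : cvg (u i @ V).
  apply: (@ulim_cvg _ _ _ _ _ (`|f0 i| + 1)) => g; rewrite /u.
  case: ifP => [h|_]; last by rewrite lerDl.
  have -> : g i = f0 i - (f0 - g) i by rewrite l2B; ring.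
  apply: le_trans (ler_normB _ _) _; rewrite lerD2l.
  rewrite -(ler_pXn2r (ltn0Sn 1)) ?nnegrE// expr1n real_normK ?num_real//.
  exact: le_trans (coord_le_sqn _ _) h.
pose l i := lim (u i @ V).
have lF f e : F [set g | sqn (f - g) <= e] ->
    forall S : {fset I}, \sum_(i <- S) (f i - l i) ^+ 2 <= e.
  move=> Fe S.
  have hc : (fun g => \sum_(i <- S) (f i - u i g) ^+ 2) @ V -->
      \sum_(i <- S) (f i - l i) ^+ 2.
    apply: cvg_big => [x|i _]; first exact: add_continuous.
    by rewrite expr2; apply: cvgM; apply: cvgB => //; exact: cvg_cst.
  rewrite -(cvg_lim _ hc)//; apply: limr_le; first by apply/cvg_ex; eexists; exact: hc.
  apply: FV; apply: filterS (filterI Fe Ff0) => g /= [ge g1].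
  apply: le_trans ge; apply: le_trans (sum_le_sqn _ S).
  by apply: ler_sum => i _; rewrite /u g1.
have l_in (S : {fset I}) : \sum_(i <- S) l i ^+ 2 <= 2 * sqn f0 + 2 * 1.
  apply: (@le_trans _ _ (\sum_(i <- S) (2 * f0 i ^+ 2 + 2 * (f0 i - l i) ^+ 2))).
    by apply: ler_sum => i _; have := sqr_ge0 (f0 i * 2 - l i); lra.
  rewrite big_split/= -!mulr_sumr lerD ?ler_wpM2l ?sum_le_sqn//.
  exact: lF.
exists (l2_of l_in) => e e0; have [|f Ff] := cauchyF (e / 4); first by rewrite divr_gt0.
move: (Ff); apply: filterS => g /= fg.
have fl : sqn (f - l2_of l_in) <= e / 4 by apply: sqn_le => S; exact: lF.
have -> : l2_of l_in - g = (f - g) - (f - l2_of l_in) by apply: l2P => i; rewrite !l2B; ring.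
apply: le_trans (sqnD_le _ _) _; rewrite sqnN.
by lra.
Qed.

End L2Norm.

(** * Linear maps and pullbacks along injections *)

Section Linear.
Variables (R : realType) (V W : lmodType R) (A : V -> W).

Definition lin := forall a f g, A (a *: f + g) = a *: A f + A g.

Hypothesis linA : lin.
Lemma linD f g : A (f + g) = A f + A g.
Proof. by have := linA 1 f g; rewrite !scale1r. Qed.
Lemma lin0 : A 0 = 0.
Proof. by apply: (addrI (A 0)); rewrite -linD !addr0. Qed.
Lemma linZ a f : A (a *: f) = a *: A f.
Proof. by have := linA a f 0; rewrite lin0 !addr0. Qed.
Lemma linN f : A (- f) = - A f.
Proof. by rewrite -scaleN1r linZ scaleN1r. Qed.
Lemma linB f g : A (f - g) = A f - A g.
Proof. by rewrite linD linN. Qed.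
Lemma lin_sum T (r : seq T) P (F : T -> V) :
  A (\sum_(t <- r | P t) F t) = \sum_(t <- r | P t) A (F t).
Proof. by elim/big_rec2: _ => [|t y x _ <-]; rewrite ?lin0// linD. Qed.
End Linear.

Lemma lin_comp (R : realType) (U V W : lmodType R) (A : V -> W) (B : U -> V) :
  lin A -> lin B -> lin (A \o B).
Proof. by move=> lA lB a f g /=; rewrite lB lA. Qed.

Lemma linZZ (R : realType) (V W : lmodType R) (c : R) (A : V -> W) :
  lin A -> lin (fun f => c *: A f).
Proof. by move=> lA a f g; rewrite lA scalerDr !scalerA mulrC. Qed.

Lemma linBB (R : realType) (V W : lmodType R) (A B : V -> W) :
  lin A -> lin B -> lin (fun f => A f - B f).
Proof. by move=> lA lB a f g; rewrite lA lB scalerBr opprD addrACA. Qed.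

Lemma linSS (R : realType) (V W : lmodType R) T (r : seq T) (P : pred T)
    (A : T -> V -> W) :
  (forall t, lin (A t)) -> lin (fun f => \sum_(t <- r | P t) A t f).
Proof.
move=> lA a f g; rewrite scaler_sumr -big_split; apply: eq_bigr => t _.
exact: lA.
Qed.

Lemma lin_isom_dot (R : realType) (I J : choiceType) (A : l2 R I -> l2 R J) :
  lin A -> (forall f, sqn (A f) = sqn f) -> forall f g, dot (A f) (A g) = dot f g.
Proof.
move=> lA iA f g; have := iA (f + g); rewrite linD// !sqnD !iA; lra.
Qed.

Lemma lin_mask (R : realType) (I : choiceType) (P : pred I) : lin (@mask R I P).
Proof. by move=> a f g; rewrite maskD maskZ. Qed.

Section Pull.
Variables (R : realType) (I J : choiceType) (s : J -> I).
Hypothesis s_inj : injective s.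

Lemma pull_subproof (f : l2 R I) (F : {fset J}) :
  \sum_(j <- F) f (s j) ^+ 2 <= sqn f.
Proof.
apply: le_trans (sum_le_sqn f (s @` F)%fset); rewrite -(big_map s xpredT (fun i => f i ^+ 2)).
rewrite le_eqVlt; apply/orP; left; apply/eqP/perm_big; apply: uniq_perm => //.
  by rewrite map_inj_uniq.
move=> i; apply/mapP/imfsetP => -[j jF ->]; by exists j.
Qed.
Definition pull f : l2 R J := l2_of (pull_subproof f).

Lemma pullE f j : pull f j = f (s j). Proof. by []. Qed.
Lemma lin_pull : lin pull. Proof. by move=> a f g; apply: l2P. Qed.
Lemma sqn_pull_le f : sqn (pull f) <= sqn f.
Proof. by apply: sqn_le => F; exact: pull_subproof. Qed.
End Pull.

Lemma sqn_pull (R : realType) (I J : choiceType) (s : J -> I) (s_inj : injective s)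
    (t : I -> J) : cancel t s -> forall f : l2 R I, sqn (pull s_inj f) = sqn f.
Proof.
move=> ts f; apply/eqP; rewrite eq_le sqn_pull_le/=.
rewrite [X in X <= _](_ : _ = sqn (pull (can_inj ts) (pull s_inj f))).
  exact: sqn_pull_le.
by congr sqn; apply: l2P => i; rewrite -[RHS]/(f (s (t i))) ts.
Qed.

(** * Orthogonal projection for an equivalent scalar product *)

Section Projection.
Variables (R : realType) (I J : choiceType) (N : l2 R I -> l2 R J).
Hypothesis linN : lin N.
Variables (c c' : R).
Hypothesis c_gt0 : 0 < c.
Hypothesis N_lb : forall f, sqn f <= c * sqn (N f).
Hypothesis N_ub : forall f, sqn (N f) <= c' * sqn f.
Variable Q : pred I.

Lemma quad_ge0_lin0 (a b : R) : 0 <= a ->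
  (forall t, 0 <= 2 * t * b + t ^+ 2 * a) -> b = 0.
Proof.
(* The minimiser is - b / a; the denominator a + 1 avoids a separate case a = 0. *)
move=> a0 /(_ (- b / (a + 1))).
have a1 : 0 < a + 1 by lra.
rewrite [X in 0 <= X](_ : _ = - ((b / (a + 1)) ^+ 2 * (a + 2))); last first.
  by field; rewrite gt_eqF.
rewrite oppr_ge0 pmulr_lle0; last lra.
move=> h; have : (b / (a + 1)) ^+ 2 == 0 by rewrite eq_le h sqr_ge0.
by rewrite sqrf_eq0 mulf_eq0 invr_eq0 (gt_eqF a1) orbF => /eqP.
Qed.

(** Minimisation of [sqn (N f)] over the affine space [mask Q f = mask Q w]. Near-minimisers form a
    Cauchy filter, by the parallelogram identity for [N] and the lower bound [N_lb]; the first-order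
    condition at the limit is the orthogonality. *)
Lemma projection_exists w : exists l, mask Q l = mask Q w /\
  forall u, mask Q u = 0 -> dot (N l) (N u) = 0.
Proof.
pose Y := [set x | exists f, mask Q f = mask Q w /\ x = sqn (N f)].
have Y0 : Y !=set0 by exists (sqn (N w)), w.
have Ylb : lbound Y 0 by move=> _ [f [_ ->]]; exact: sqn_ge0.
have hY : has_inf Y by split => //; exists 0.
pose m := inf Y.
have mle f : mask Q f = mask Q w -> m <= sqn (N f).
  by move=> fw; apply: (ge_inf hY.2); exists f.
pose E e := [set f | mask Q f = mask Q w /\ sqn (N f) <= m + e].
have E_ne e : 0 < e -> E e !=set0.
  move=> e0; have [_ [f [fw ->]]] := inf_adherent e0 hY.
  by rewrite -/m => /ltW fm; exists f.
have E_mono e e' : e <= e' -> E e `<=` E e'.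
  by move=> ee f [fw fm]; split => //; apply: le_trans fm _; rewrite lerD2l.
have E_dist e f g : E e f -> E e g -> sqn (f - g) <= 4 * c * e.
  move=> [fw fm] [gw gm]; apply: le_trans (N_lb _) _.
  have : m <= sqn (N (2^-1 *: (f + g))).
    apply: mle; rewrite maskZ maskD fw gw; apply: l2P => i.
    by rewrite l2Z l2D; lra.
  rewrite (linZ linN) (linD linN) (linB linN) sqnZ sqnD sqnB => mm.
  rewrite (mulrC 4) -mulrA ler_pM2l//.
  move: mm; rewrite exprVn; lra.
pose F : set_system (l2 R I) := [set A | exists2 e, 0 < e & E e `<=` A].
have FF : ProperFilter F.
  split; first by case=> e e0 Ee; have [f] := E_ne _ e0; exact: Ee.
  split; first by exists 1.
  - move=> A B [e e0 EA] [e' e'0 EB]; exists (Num.min e e').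
      by rewrite lt_min e0.
    move=> f Ef; split; [apply: EA|apply: EB]; apply: E_mono Ef.
      by rewrite ge_min lexx.
    by rewrite ge_min lexx orbT.
  - by move=> A B AB [e e0 EA]; exists e => //; exact: subset_trans AB.
have [l Fl] : exists l, forall e, 0 < e -> F [set g | sqn (l - g) <= e].
  apply: l2_complete => e e0; pose e' := e / (4 * c).
  have e'0 : 0 < e' by rewrite divr_gt0// mulr_gt0.
  have [f Ef] := E_ne _ e'0; exists f, e' => // g Eg /=.
  apply: le_trans (E_dist _ _ _ Ef Eg) _.
  by rewrite /e' mulrC divfK// gt_eqF// mulr_gt0.
have Elg e : 0 < e -> exists g, E e g /\ sqn (l - g) <= e.
  move=> e0; have FE : F (E e) by exists e.
  by have [g [Eg lg]] := filter_ex (filterI FE (Fl _ e0)); exists g.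
exists l; have lw : mask Q l = mask Q w.
  apply/eqP; rewrite -subr_eq0; apply/eqP/sqn_eq0/eqP.
  rewrite eq_le sqn_ge0 andbT; apply/ler_addgt0Pr => e e0; rewrite add0r.
  have [g [[<- _] lg]] := Elg _ e0.
  by apply: le_trans lg; rewrite -(linB (@lin_mask _ _ _)) mask_sqn_le.
have c'0 : 0 <= Num.max c' 0 by rewrite le_max lexx orbT.
have lm : sqn (N l) <= m.
  have m0 : 0 <= m by apply: lb_le_inf.
  (* The cross term of |x + y|^2 is bounded by d |x|^2 + |y|^2 / d with |y|^2 of order d^2; [K]
     collects the coefficients of [d] that result. *)
  pose K := m + 2 + 2 * Num.max c' 0.
  have K0 : 0 < K by rewrite /K; lra.
  apply/ler_addgt0Pr => e e0; pose d := Num.min 1 (e / K).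
  have d0 : 0 < d by rewrite lt_min ltr01 divr_gt0.
  have d1 : d <= 1 by rewrite ge_min lexx.
  have dK : d * K <= e by rewrite -ler_pdivlMr// ge_min lexx orbT.
  have d20 : 0 < d ^+ 2 by rewrite exprn_gt0.
  have [g [[_ gm] lg]] := Elg _ d20.
  have Nlg : sqn (N (l - g)) <= Num.max c' 0 * d ^+ 2.
    apply: le_trans (N_ub _) _; apply: (@le_trans _ _ (Num.max c' 0 * sqn (l - g))).
      by rewrite ler_wpM2r ?sqn_ge0// le_max lexx.
    by rewrite ler_wpM2l.
  have -> : l = g + (l - g) by rewrite addrC subrK.
  rewrite (linD linN) sqnD.
  set x := N g in gm *; set y := N (l - g) in Nlg *.
  have xy : 2 * dot x y <= d * sqn x + d^-1 * sqn y.
    have := sqn_ge0 (d *: x - y); rewrite sqnB sqnZ dotZl => h.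
    rewrite -(ler_pM2l d0) mulrDr (mulrA d d^-1) divff ?gt_eqF// mul1r; lra.
  have dy : d^-1 * sqn y <= Num.max c' 0 * d.
    by rewrite ler_pdivrMl// mulrCA -expr2.
  apply: le_trans (lerD (lerD (lexx _) xy) (lexx _)) _.
  have dx : d * sqn x <= d * (m + d ^+ 2) by rewrite ler_pM2l.
  have d2d : d ^+ 2 <= d by rewrite expr2 ger_pMl.
  have d3d : d * d ^+ 2 <= d by rewrite -exprS exprS ger_pMr// exprn_ile1// ltW.
  have cd : Num.max c' 0 * d ^+ 2 <= Num.max c' 0 * d by rewrite ler_wpM2l.
  rewrite /K in dK; nra.
split=> // u u0; apply: (@quad_ge0_lin0 (sqn (N u))); first exact: sqn_ge0.
move=> t; have : m <= sqn (N (l + t *: u)).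
  by apply: mle; rewrite maskD maskZ u0 scaler0 addr0.
rewrite (linD linN) (linZ linN) sqnD sqnZ dotZr; lra.
Qed.

Lemma projection_unique l l' : mask Q l = mask Q l' ->
  (forall u, mask Q u = 0 -> dot (N l) (N u) = 0) ->
  (forall u, mask Q u = 0 -> dot (N l') (N u) = 0) -> l = l'.
Proof.
move=> ll h h'; have d0 : mask Q (l - l') = 0 by rewrite (linB (@lin_mask _ _ _)) ll subrr.
apply/eqP; rewrite -subr_eq0; apply/eqP/sqn_eq0/eqP; rewrite eq_le sqn_ge0 andbT.
apply: le_trans (N_lb _) _; rewrite {1}/sqn (linB linN) dotBl -!(linB linN).
by rewrite h// h'// subrr mulr0.
Qed.

End Projection.

Local Open Scope complex_scope.

(** * Complexification and unitarizability *)

Section L2Complex.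
Variables (R : realType) (K : choiceType).

(** Complex functions on [K] as real functions on [K * bool], with real parts at [false] and
    imaginary parts at [true]; [mulI] is multiplication by i. All real lemmas thus apply to the same
    vectors. *)
Definition l2C : Type := l2 R (K * bool)%type.
HB.instance Definition _ := GRing.Zmodule.on l2C.

Definition swapb (x : K * bool) := (x.1, ~~ x.2).
Lemma swapb_inj : injective swapb.
Proof. by move=> [k b] [k' b'] [-> /(can_inj negbK) ->]. Qed.

Definition mulI := locked (fun f : l2 R (K * bool)%type =>
  mask snd (pull swapb_inj f) - mask (negb \o snd) (pull swapb_inj f)).

Lemma mulIE f k b : mulI f (k, b) = if b then f (k, false) else - f (k, true).
Proof. by rewrite /mulI -lock l2B !maskE; case: b; rewrite /= pullE /swapb/= ?subr0 ?sub0r. Qed.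

Lemma lin_mulI : lin mulI.
Proof.
rewrite /mulI -lock; apply: linBB; first exact: lin_comp (@lin_mask _ _ _) (lin_pull _).
exact: lin_comp (@lin_mask _ _ _) (lin_pull _).
Qed.

Lemma mulIK f : mulI (mulI f) = - f.
Proof. by apply: l2P => -[k []]; rewrite !mulIE l2N. Qed.

Lemma dot_mulI f g : dot (mulI f) g = - dot f (mulI g).
Proof.
have isom h : sqn (mulI h) = sqn h.
  rewrite -(@sqn_pull _ _ _ _ swapb_inj swapb (fun x => _) h) => [|[k b]]; last first.
    by rewrite /swapb/= negbK.
  apply/eqP; rewrite eq_le; apply/andP; split; apply: sqn_le => F.
    apply: le_trans (sum_le_sqn _ F); apply: ler_sum => -[k b] _.
    by rewrite mulIE pullE /swapb; case: b => //=; rewrite sqrrN.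
  apply: le_trans (sum_le_sqn _ F); apply: ler_sum => -[k b] _.
  by rewrite mulIE pullE /swapb; case: b => //=; rewrite sqrrN.
by rewrite -(lin_isom_dot lin_mulI isom f) mulIK dotNr opprK.
Qed.

Definition scaleC (z : R[i]) (f : l2C) : l2C :=
  complex.Re z *: (f : l2 R (K * bool)%type) + complex.Im z *: mulI f.

Lemma scaleCA a b f : scaleC a (scaleC b f) = scaleC (a * b) f.
Proof.
apply: l2P => -[k c]; rewrite /scaleC.
rewrite (linD lin_mulI) !(linZ lin_mulI) mulIK.
by rewrite !(l2D, l2Z, l2N); case: a => a a'; case: b => b b' /=; ring.
Qed.
Lemma scaleC1 : left_id 1 scaleC.
Proof. by move=> f; rewrite /scaleC/= scale1r scale0r addr0. Qed.
Lemma scaleCDr : right_distributive scaleC +%R.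
Proof. by move=> a f g; rewrite /scaleC (linD lin_mulI) !scalerDr addrACA. Qed.
Lemma scaleCDl f : {morph scaleC^~ f : a b / a + b}.
Proof. by move=> [a a'] [b b']; rewrite /scaleC/= !scalerDl addrACA. Qed.

HB.instance Definition _ := GRing.Zmodule_isLmodule.Build R[i] l2C
  scaleCA scaleC1 scaleCDr scaleCDl.

Lemma sqn_scaleC (z : R[i]) (f : l2C) :
  sqn (z *: f : l2C) = (complex.Re z ^+ 2 + complex.Im z ^+ 2) * sqn (f : l2 R (K * bool)%type).
Proof.
have fI : dot f (mulI f) = 0.
  by have := dot_mulI f f; rewrite dotC; lra.
rewrite [_ *: _]/(scaleC z f) /scaleC sqnD !sqnZ dotZl dotZr fI.
by rewrite {2}/sqn dot_mulI mulIK dotNr opprK -/(sqn _); ring.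
Qed.

Definition normC (f : l2C) : R[i] := (nrm (f : l2 R (K * bool)%type))%:C.

Lemma normCD f g : normC (f + g) <= normC f + normC g.
Proof. by rewrite /normC -rmorphD/= lecR nrmD. Qed.
Lemma normCZ (z : R[i]) f : normC (z *: f) = `|z| * normC f.
Proof.
rewrite /normC normc_def -rmorphM/= /nrm sqn_scaleC sqrtrM//.
by rewrite addr_ge0 ?sqr_ge0.
Qed.
Lemma normC_eq0 f : normC f = 0 -> f = 0.
Proof. by move=> /(congr1 (@complex.Re R))/= /nrm_eq0. Qed.

HB.instance Definition _ := Lmodule_isNormed.Build R[i] l2C normCD normCZ normC_eq0.

Lemma l2C_normE (f : l2C) : `|f| = (nrm (f : l2 R (K * bool)%type))%:C.
Proof. by []. Qed.

HB.instance Definition _ := isPointed.Build l2C 0.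

Lemma l2C_complete (F : set_system l2C) : ProperFilter F -> cauchy F -> cvg F.
Proof.
move=> FF /cauchyP cF.
have [l Fl] : exists l : l2 R (K * bool)%type,
    forall e, 0 < e -> F [set g : l2C | sqn (l - g : l2 R (K * bool)%type) <= e].
  apply: l2_complete => e e0.
  have [|f Ff] := cF (Num.sqrt e)%:C; first by rewrite ltcR sqrtr_gt0.
  exists f; apply: filterS Ff => g; rewrite -ball_normE /= l2C_normE ltcR.
  by move=> /ltW; rewrite nrm_le_sqn ?sqrtr_ge0// sqr_sqrtr ?(ltW e0).
apply/cvg_ex; exists (l : l2C); apply/cvgrPdist_le => e e0.
have eE : e = (complex.Re e)%:C.
  by move: e0; case: e => a b; rewrite ltcE/= => /andP[/eqP -> _].
have e0' : 0 < complex.Re e by rewrite eE ltcR in e0.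
apply: filterS (Fl _ (exprn_gt0 2 e0')) => g /= lg.
by rewrite l2C_normE eE lecR nrm_le_sqn// ltW.
Qed.

HB.instance Definition _ := Uniform_isComplete.Build l2C l2C_complete.

Definition dotC_ (f g : l2C) : R[i] :=
  (dot (f : l2 R (K * bool)%type) g) +i* (dot (f : l2 R (K * bool)%type) (mulI g)).

Lemma dotC_additive_l g : zmod_morphism (dotC_^~ g).
Proof. by move=> f f'; rewrite /dotC_ !dotBl. Qed.
Lemma dotC_additive_r f : zmod_morphism (dotC_ f).
Proof. by move=> g g'; rewrite /dotC_ (linB lin_mulI) !dotBr. Qed.
Lemma dotC_scalable_l g : scalable_for *%R (dotC_^~ g).
Proof.
move=> [a b] f; rewrite /dotC_ [_ *: _]/(scaleC _ f) /scaleC /= !dotDl !dotZl.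
by rewrite !dot_mulI mulIK dotNr; apply/eqP; rewrite eq_complex /=; apply/andP; split;
  apply/eqP; ring.
Qed.
Lemma dotC_scalable_r f : scalable_for (Num.conj \; *%R) (dotC_ f).
Proof.
move=> [a b] g; rewrite /dotC_ [_ *: _]/(scaleC _ g) /scaleC /=.
rewrite (linD lin_mulI) !(linZ lin_mulI) mulIK !dotDr !dotZr dotNr.
rewrite -[Num.conj _]/(a -i* b).
by apply/eqP; rewrite eq_complex /=; apply/andP; split; apply/eqP; ring.
Qed.
HB.instance Definition _ := isBilinear.Build R[i] l2C l2C R[i] *%R (Num.conj \; *%R) dotC_
  dotC_additive_l dotC_additive_r dotC_scalable_l dotC_scalable_r.
Lemma dotC_hermitian f g : dotC_ f g = (-1) ^+ false * Num.conj (dotC_ g f).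
Proof.
rewrite expr0 mul1r /dotC_ -[RHS]/(dot g f -i* dot g (mulI f)) dotC.
by rewrite (dotC f) dot_mulI.
Qed.
HB.instance Definition _ :=
  isHermitianSesquilinear.Build R[i] l2C false Num.conj dotC_ dotC_hermitian.
Lemma dotC_gt0 (f : l2C) : f != 0 -> 0 < dotC_ f f.
Proof.
move=> f0; have fI : dot f (mulI f) = 0 by have := dot_mulI f f; rewrite dotC; lra.
rewrite /dotC_ fI ltcE /= eqxx/= -/(sqn _) lt_neqAle sqn_ge0 andbT eq_sym.
by apply: contra_neq f0 => /sqn_eq0.
Qed.
HB.instance Definition _ := isDotProduct.Build R[i] l2C dotC_ dotC_gt0.

Lemma dotC_norm (f : l2C) : dotC_ f f = `|f| ^+ 2.
Proof.
rewrite /dotC_ l2C_normE -rmorphXn/= nrm_sqr; congr (_ +i* _).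
by have := dot_mulI f f; rewrite dotC; lra.
Qed.

HB.instance Definition _ := NormedModule_isHilbert.Build R l2C dotC_norm.

End L2Complex.

Local Open Scope complex_scope.

(** * Splitting square summable functions along fibres *)

Section Fibers.
Variables (R : realType) (K I J : choiceType).
Variables (e : K -> I -> J) (p : J -> K) (q : J -> I).
Hypothesis pe : forall k i, p (e k i) = k.
Hypothesis qe : forall k i, q (e k i) = i.
Hypothesis epq : forall j, e (p j) (q j) = j.

Lemma fib_inj k : injective (e k).
Proof. by move=> i i' /(congr1 q); rewrite !qe. Qed.

Definition fib k : l2 R J -> l2 R I := pull (@fib_inj k).

Lemma fibE k f i : fib k f i = f (e k i). Proof. by []. Qed.

Lemma lin_fib k : lin (fib k). Proof. exact: lin_pull. Qed.

Lemma fib_ext f g : (forall k, fib k f = fib k g) -> f = g.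
Proof.
move=> fg; apply: l2P => j; rewrite -(epq j).
by have := congr1 (fun h : l2 R I => h (q j)) (fg (p j)).
Qed.

Lemma sqn_fib k f : sqn (fib k f) = sqn (mask (fun j => p j == k) f).
Proof.
apply/eqP; rewrite eq_le; apply/andP; split.
  apply: (@le_trans _ _ (sqn (fib k (mask (fun j => p j == k) f)))); last exact: sqn_pull_le.
  by rewrite le_eqVlt; apply/orP; left; apply/eqP; congr sqn; apply: l2P => i;
    rewrite -[RHS]/(if p (e k i) == k then f (e k i) else 0) pe eqxx.
apply: sqn_le => F; apply: le_trans (sum_le_sqn _ [fset q j | j in F & p j == k]%fset).
rewrite [leLHS](_ : _ =
    \sum_(j <- F | p j == k) mask (fun j => p j == k) f j ^+ 2); last first.
  rewrite [RHS]big_mkcond; apply: eq_bigr => j _.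
  by case: ifP => // jk; rewrite maskE jk expr0n.
rewrite -big_filter [leLHS](_ : _ =
    \sum_(i <- [seq q j | j <- F & p j == k]) fib k f i ^+ 2); last first.
  rewrite big_map [LHS]big_seq [RHS]big_seq; apply: eq_bigr => j.
  by rewrite mem_filter => /andP[/eqP jk _]; rewrite maskE jk eqxx fibE -jk epq.
rewrite le_eqVlt; apply/orP; left; apply/eqP.
apply/perm_big/uniq_perm.
- rewrite map_inj_in_uniq ?filter_uniq// => j j'.
  rewrite !mem_filter => /andP[/eqP jk _] /andP[/eqP j'k _] jj'.
  by rewrite -(epq j) -(epq j') jj' jk j'k.
- exact: fset_uniq.
- move=> i; apply/mapP/imfsetP => /= -[j].
    by rewrite mem_filter => /andP[jk jF] ->; exists j => //; rewrite !inE jF.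
  by rewrite !inE => /andP[jF jk] ->; exists j => //; rewrite mem_filter jk.
Qed.

Lemma sum_sqn_fib_seq (r : seq K) f : uniq r ->
  \sum_(k <- r) sqn (fib k f) = sqn (mask (fun j => p j \in r) f).
Proof.
elim: r => [_|k r ih /= /andP[kr ur]].
  rewrite big_nil; apply/esym; rewrite [X in sqn X](_ : _ = 0) ?sqn0//.
  exact: l2P.
rewrite big_cons ih// sqn_fib [RHS](mask_sqn (fun j => p j == k)).
congr (_ + _); congr sqn; apply: l2P => j; rewrite ?l2B !maskE inE;
  case: eqP => //= jk; rewrite ?subr0// subrr.
by rewrite jk (negbTE kr).
Qed.

Lemma sum_sqn_fib_le (S : {fset K}) f : \sum_(k <- S) sqn (fib k f) <= sqn f.
Proof. by rewrite sum_sqn_fib_seq ?fset_uniq// mask_sqn_le. Qed.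

Lemma assemble_subproof (g : K -> l2 R I) M :
    (forall S : {fset K}, \sum_(k <- S) sqn (g k) <= M) ->
  forall F : {fset J}, \sum_(j <- F) (g (p j) (q j)) ^+ 2 <= M.
Proof.
move=> gM F; apply: le_trans (gM [fset p j | j in F]%fset).
rewrite [leLHS](_ : _ = \sum_(k <- [fset p j | j in F]%fset)
    \sum_(j <- F | p j == k) g k (q j) ^+ 2); last first.
  rewrite (partition_big_imfset _ p).
  apply: eq_bigr => k _; rewrite -big_filter -[RHS]big_filter.
  rewrite [LHS]big_seq [RHS]big_seq; apply: eq_bigr => j.
  by rewrite mem_filter => /andP[/eqP ->].
apply: ler_sum => k _; apply: le_trans (sum_le_sqn _ [fset q j | j in F & p j == k]%fset).
rewrite -big_filter -(big_map q xpredT (fun i => g k i ^+ 2)).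
rewrite le_eqVlt; apply/orP; left; apply/eqP/perm_big/uniq_perm.
- rewrite map_inj_in_uniq ?filter_uniq// => j j'.
  rewrite !mem_filter => /andP[/eqP jk _] /andP[/eqP j'k _] jj'.
  by rewrite -(epq j) -(epq j') jj' jk j'k.
- exact: fset_uniq.
- move=> i; apply/mapP/imfsetP => /= -[j].
    by rewrite mem_filter => /andP[jk jF] ->; exists j => //; rewrite !inE jF.
  by rewrite !inE => /andP[jF jk] ->; exists j => //; rewrite mem_filter jk.
Qed.

Lemma assemble (g : K -> l2 R I) M :
    (forall S : {fset K}, \sum_(k <- S) sqn (g k) <= M) ->
  exists2 f, forall k, fib k f = g k & sqn f <= M.
Proof.
move=> gM; exists (l2_of (assemble_subproof gM)).
  by move=> k; apply: l2P => i; rewrite fibE /= pe qe.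
by apply: sqn_le => F; exact: assemble_subproof.
Qed.
End Fibers.

Local Open Scope complex_scope.

(** * Derivations of a unitarizable group are inner *)

Section Inner.
Variables (R : realType) (B : groupType) (I : choiceType).
Variables (lam D : B -> l2 R I -> l2 R I) (M : R).
Hypothesis lin_lam : forall t, lin (lam t).
Hypothesis lin_D : forall t, lin (D t).
Hypothesis sqn_lam : forall t f, sqn (lam t f) = sqn f.
Hypothesis lam1 : forall f, lam 1%g f = f.
Hypothesis lamM : forall s t f, lam (s * t)%g f = lam s (lam t f).
Hypothesis sqn_D : forall t f, sqn (D t f) <= M * sqn f.
Hypothesis D_M : forall s t f, D (s * t)%g f = D s (lam t f) + lam s (D t f).

(** The first Boolean is the entry of a column vector with two entries, [false] being the invariant
    one, and the second tells real from imaginary parts. [J] is nested so that [l2 R J] is the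
    carrier of [l2C R (bool * I)]. *)
Let K : choiceType := (bool * bool)%type.
Let J : choiceType := ((bool * I) * bool)%type.
Let e (k : K) (i : I) : J := ((k.1, i), k.2).
Let p (j : J) : K := (j.1.1, j.2).
Let q (j : J) : I := j.1.2.
Let pe k i : p (e k i) = k. Proof. by case: k. Qed.
Let qe k i : q (e k i) = i. Proof. by []. Qed.
Let epq j : e (p j) (q j) = j. Proof. by case: j => -[]. Qed.
Let fb (k : K) : l2 R J -> l2 R I := @fib R K I J e q qe k.

Let ks : seq K := [:: (false, false); (false, true); (true, false); (true, true)].
Let sqn_fb f : sqn f = \sum_(k <- ks) sqn (fb k f).
Proof.
rewrite (sum_sqn_fib_seq pe qe epq)//; congr sqn; apply: l2P => j.
by rewrite maskE; case: j => -[[] i] [].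
Qed.

Let asm (g : K -> l2 R I) : {f | forall k, fb k f = g k}.
Proof.
apply: cid; have [|f fg _] := assemble pe qe epq (g := g)
    (M := \sum_(k <- [fset k in ks]%fset) sqn (g k)).
  move=> S; apply: ler_sum_fset; last by move=> k; exact: sqn_ge0.
  by apply/fsubsetP => -[[] []] _; rewrite !inE.
by exists f.
Qed.

Let pack g := projT1 (asm g).
Let fb_pack k g : fb k (pack g) = g k.
Proof. exact: projT2 (asm g) k. Qed.
Let fb_ext f g : (forall k, fb k f = fb k g) -> f = g.
Proof. exact: (fib_ext epq). Qed.
Let lin_fb k : lin (fb k). Proof. exact: lin_fib. Qed.

Let rep (t : B) (F : l2 R J) : l2 R J := pack (fun k =>
  if k.1 then lam t (fb k F) else lam t (fb k F) + D t (fb (true, k.2) F)).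

Let lin_rep t : lin (rep t).
Proof.
move=> a f g; apply: fb_ext => -[b c]; rewrite lin_fb !fb_pack /=.
case: b; first by rewrite lin_fb lin_lam.
by rewrite !lin_fb lin_lam lin_D addrACA -scalerDr.
Qed.

Let rep1_ F : rep 1%g F = F.
Proof.
have D1 f : D 1%g f = 0.
  have := D_M 1%g 1%g f; rewrite mulg1 !lam1 => /eqP.
  by rewrite -subr_eq subrr eq_sym => /eqP.
by apply: fb_ext => -[b c]; rewrite fb_pack /=; case: b; rewrite !lam1 ?D1 ?addr0.
Qed.

Let repM_ s t F : rep (s * t)%g F = rep s (rep t F).
Proof.
apply: fb_ext => -[b c]; rewrite !fb_pack /=; case: b; first by rewrite lamM.
by rewrite lamM D_M (linD (lin_lam s)) -!addrA; congr (_ + _); rewrite addrC.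
Qed.

Let C0 : R := 2 + 2 * Num.max M 0 + 1.
Let sqn_rep t F : sqn (rep t F) <= C0 * sqn F.
Proof.
have DM f : sqn (D t f) <= Num.max M 0 * sqn f.
  apply: le_trans (sqn_D t f) _; rewrite ler_wpM2r ?sqn_ge0//.
  by rewrite le_max lexx.
have M0 : 0 <= Num.max M 0 by rewrite le_max lexx orbT.
rewrite !sqn_fb /ks !big_cons !big_nil !fb_pack /= !sqn_lam.
have h1 := sqnD_le (lam t (fb (false, false) F)) (D t (fb (true, false) F)).
have h2 := sqnD_le (lam t (fb (false, true) F)) (D t (fb (true, true) F)).
rewrite !sqn_lam in h1 h2.
have h3 := DM (fb (true, false) F); have h4 := DM (fb (true, true) F).
have := sqn_ge0 (fb (false, false) F); have := sqn_ge0 (fb (false, true) F).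
have := sqn_ge0 (fb (true, false) F); have := sqn_ge0 (fb (true, true) F).
rewrite /C0; nra.
Qed.

Let fb_mulI b c F : fb (b, c) (mulI F) =
  if c then fb (b, false) F else - fb (b, true) F.
Proof.
apply: l2P => i; rewrite -[LHS]/(mulI F ((b, i), c)) mulIE.
by case: c.
Qed.

Let rep_mulI t F : rep t (mulI F) = mulI (rep t F).
Proof.
apply: fb_ext => -[b c]; rewrite fb_mulI !fb_pack /= !fb_mulI.
by case: b; case: c; rewrite /= ?(linN (lin_lam t)) ?(linN (lin_D t)) ?opprD.
Qed.

Let H : hilbertType R := l2C R (bool * I)%type.

Lemma l2C_scale_real (K' : choiceType) (a : R) (f : l2C R K') :
  a%:C *: f = (a *: (f : l2 R _)) :> l2 R _.
Proof. by rewrite [LHS]/(scaleC _ f) /scaleC /= scale0r addr0. Qed.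

Lemma bounded_operator_l2C (K' : choiceType) (A : l2C R K' -> l2C R K') : bounded_operator A ->
  lin (A : l2 R (K' * bool)%type -> l2 R (K' * bool)%type) /\
  exists2 c, 0 < c & forall f : l2 R (K' * bool)%type, sqn (A f : l2 R _) <= c * sqn f.
Proof.
move=> [linA An]; split.
  by move=> a f g; have := linA a%:C f g; rewrite !l2C_scale_real.
have A0 : (0 <= opnorm A)%E.
  apply: ereal_sup_ge; exists (complex.Re `|A 0|)%:E.
    by exists 0 => //=; rewrite normr0 ler01.
  by rewrite lee_fin l2C_normE /= nrm_ge0.
have [M' An'] : exists M', opnorm A = M'%:E by case: (opnorm A) A0 An => [r| |]//; exists r.
have M'0 : 0 <= M' by rewrite -lee_fin -An'.
have /(opnorm_le linA M'0) AM : (opnorm A <= M'%:E)%E by rewrite An'.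
(* The added 1 keeps the constant positive for the zero operator. *)
exists (M' ^+ 2 + 1); first by rewrite ltr_wpDl// sqr_ge0.
move=> f; have := AM f; rewrite !l2C_normE -rmorphM /= lecR => h.
rewrite -!nrm_sqr; apply: (@le_trans _ _ ((M' * nrm f) ^+ 2)).
  by rewrite ler_pXn2r ?nnegrE ?mulr_ge0 ?nrm_ge0.
by rewrite exprMn ler_wpM2r ?sqr_ge0// lerDl.
Qed.

Lemma lin_eq_sqn_dot (J1 J2 J3 : choiceType) (A : l2 R J1 -> l2 R J2) (A' : l2 R J1 -> l2 R J3) :
  lin A -> lin A' -> (forall f, sqn (A f) = sqn (A' f)) ->
  forall f g, dot (A f) (A g) = dot (A' f) (A' g).
Proof.
move=> lA lA' h f g; have := h (f + g); rewrite !(linD lA) !(linD lA') !sqnD !h; lra.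
Qed.

(** The map [N], inverse to the similarity, gives the invariant scalar product <N F, N G>. Let [l f]
    be the vector with quotient entry f that is orthogonal, for this product, to the invariant
    subspace. By uniqueness [l] is linear and [l (lam t f) = rep t (l f)], and the upper entry of
    this equation reads T (lam t f) = lam t (T f) + D t f. *)
Lemma unitarizable_inner : unitarizable R B ->
  exists (T : l2 R I -> l2 R I) (C : R), [/\ lin T, 0 <= C,
    forall f, sqn (T f) <= C * sqn f &
    forall t f, D t f = T (lam t f) - lam t (T f)].
Proof.
have linC t : linear (rep t : H -> H).
  move=> z f g; rewrite -[LHS]/(rep t (scaleC z f + g)) -[RHS]/(scaleC z (rep t f) + rep t g) /scaleC.
  by rewrite (linD (lin_rep t)) (linD (lin_rep t)) !(linZ (lin_rep t)) rep_mulI.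
have opn t : (opnorm (rep t : H -> H) <= (Num.sqrt C0)%:E)%E.
  apply/(opnorm_le (linC t) (sqrtr_ge0 C0)) => f; rewrite !l2C_normE -rmorphM/= lecR nrm_le_sqn ?mulr_ge0 ?sqrtr_ge0 ?nrm_ge0//.
  rewrite exprMn nrm_sqr sqr_sqrtr ?sqn_rep// /C0 addr_ge0// addr_ge0// mulr_ge0//.
  by rewrite le_max lexx orbT.
move=> /(_ H rep)[].
- split; first by move=> t; split; [exact: linC|exact: le_lt_trans (opn t) (ltry _)].
  + by apply/funext => F; rewrite rep1_.
  + by move=> s t; apply/funext => F; rewrite repM_.
- apply: le_lt_trans (ltry (Num.sqrt C0)); apply: ge_ereal_sup => _ [t _ <-].
  exact: opn.
move=> S [N [bS bN SN NS [_ uni]]].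
have [linS [cS cS0 Sb]] := bounded_operator_l2C bS.
have [linN [cN cN0 Nb]] := bounded_operator_l2C bN.
have lb (f : l2 R J) : sqn f <= cS * sqn (N f : l2 R J).
  by rewrite -{1}(NS f); exact: Sb.
have inv t (F : l2 R J) : sqn (N (rep t F) : l2 R J) = sqn (N F : l2 R J).
  have [_ /(_ (N F) (N F)) + _] := uni t; rewrite /= NS.
  rewrite !hdotE !l2C_normE -!rmorphXn/= !nrm_sqr.
  by move=> /(congr1 (@complex.Re R)).
have inv_dot t (F G : l2 R J) :
    dot (N (rep t F) : l2 R J) (N (rep t G) : l2 R J) = dot (N F : l2 R J) (N G : l2 R J).
  apply: (lin_eq_sqn_dot (A := (N : l2 R J -> l2 R J) \o rep t) (A' := N : l2 R J -> l2 R J)).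
  - exact: lin_comp linN (lin_rep t).
  - exact: linN.
  - exact: inv.
pose Q (j : J) := (p j).1.
have maskQ F G : mask Q F = mask Q G <-> forall c, fb (true, c) F = fb (true, c) G.
  split=> [h c|h].
    apply: l2P => i; have := congr1 (fun f : l2 R J => f ((true, i), c)) h.
    by rewrite !maskE.
  apply: l2P => -[[b i] c]; rewrite !maskE /Q /=; case: b => //.
  by have := congr1 (fun f : l2 R I => f i) (h c).
(* The quotient entry is real, and only the real part of the upper entry of [l f] is kept below: the
   operator sought acts on a real space. *)
pose w f := pack (fun k => if k == (true, false) then f else 0).
pose l f := projT1 (cid (projection_exists linN cS0 lb Nb Q (w f))).
have lw f : mask Q (l f) = mask Q (w f) by rewrite /l; case: cid => /= ? [].
have lo f u : mask Q u = 0 -> dot (N (l f) : l2 R J) (N u : l2 R J) = 0.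
  by rewrite /l; case: cid => /= ? [] _; apply.
have lu f F : mask Q F = mask Q (w f) ->
    (forall u, mask Q u = 0 -> dot (N F : l2 R J) (N u : l2 R J) = 0) -> F = l f.
  move=> Fw Fo; apply: (projection_unique linN lb (Q := Q)) => //.
    by rewrite Fw lw.
  exact: lo.
have lin_l : lin l.
  move=> a f g; apply/esym/lu.
    apply/maskQ => c; rewrite lin_fb fb_pack.
    have /maskQ/(_ c) -> := lw f; have /maskQ/(_ c) -> := lw g.
    by rewrite !fb_pack; case: ifP; rewrite ?scaler0 ?addr0.
  move=> u u0; rewrite linN dotDl dotZl !lo// mulr0 addr0//.
exists (fun f => fb (false, false) (l f)), (cS * cN); split.
- by move=> a f g; rewrite lin_l lin_fb.
- by rewrite mulr_ge0 ?ltW.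
- move=> f; apply: (@le_trans _ _ (sqn (l f))); first exact: sqn_pull_le.
  apply: le_trans (lb _) _; rewrite -mulrA ler_pM2l//.
  apply: (@le_trans _ _ (sqn (N (w f) : l2 R J))).
    have -> : w f = l f + (w f - l f) by rewrite addrC subrK.
    rewrite (linD linN) sqnD lo ?mulr0 ?addr0 ?lerDl ?sqn_ge0//.
    by rewrite (linB (@lin_mask _ _ _)) lw subrr.
  apply: le_trans (Nb _) _; rewrite ler_pM2l//.
  by rewrite sqn_fb /ks !big_cons big_nil !fb_pack /= !sqn0; lra.
- move=> t f; have -> : l (lam t f) = rep t (l f).
    apply/esym/lu.
      apply/maskQ => c; rewrite !fb_pack /=; have /maskQ/(_ c) -> := lw f.
      by rewrite fb_pack; case: ifP => // _; rewrite (lin0 (lin_lam t)).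
    move=> u u0; have -> : u = rep t (rep t^-1%g u) by rewrite -repM_ mulgV rep1_.
    rewrite inv_dot lo//; have : mask Q u = mask Q 0 by rewrite u0 (lin0 (@lin_mask _ _ _)).
    move=> /maskQ h; rewrite -(lin0 (@lin_mask R J Q)); apply/maskQ => c.
    by rewrite fb_pack /= h (lin0 (lin_fb _)) (lin0 (lin_lam _)).
  rewrite fb_pack /=; have /maskQ/(_ false) -> := lw f.
  by rewrite fb_pack eqxx addrAC subrr add0r.
Qed.

End Inner.

Lemma bounded_funW (R : realType) (T : Type) (f : T -> R) :
  bounded_fun f -> exists M, 0 <= M /\ forall x, `|f x| <= M.
Proof.
move=> [M [_ fM]]; exists (`|M| + 1); split; first by rewrite addr_ge0.
by move=> x; apply: (fM (`|M| + 1)) => //; rewrite ltr_pwDr// ler_norm.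
Qed.

(** * Kesten's theorem *)

Section LeftAction.
Variables (R : realType) (G : groupType).

Definition lact (g : G) : l2 R G -> l2 R G := pull (@mulgI G g^-1%g).

Lemma lactE g f x : lact g f x = f (g^-1 * x)%g. Proof. by []. Qed.
Lemma lin_lact g : lin (lact g). Proof. exact: lin_pull. Qed.
Lemma sqn_lact g f : sqn (lact g f) = sqn f.
Proof. by apply: (@sqn_pull _ _ _ _ _ (fun x => g * x)%g) => x; rewrite mulKg. Qed.
Lemma dot_lact g f h : dot (lact g f) (lact g h) = dot f h.
Proof. exact: lin_isom_dot (lin_lact g) (sqn_lact g) f h. Qed.
Lemma lact1 f : lact 1%g f = f.
Proof. by apply: l2P => x; rewrite lactE invg1 mul1g. Qed.
Lemma lactM g h f : lact (g * h)%g f = lact g (lact h f).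
Proof. by apply: l2P => x; rewrite !lactE invgM mulgA. Qed.
Lemma lact_delta g x : lact g (delta R x) = delta R (g * x)%g.
Proof.
apply: l2P => y; rewrite lactE !deltaE; congr ((nat_of_bool _)%:R).
by apply/eqP/eqP => [<-|->]; rewrite ?mulVKg ?mulKg.
Qed.
Lemma lactV_sqn g f : sqn (lact g^-1%g f - f) = sqn (lact g f - f).
Proof.
rewrite -(sqn_lact g) (linB (lin_lact g)) -lactM mulgV lact1 sqnBC//.
Qed.

End LeftAction.

Section Mean.
Variables (R : realType) (G : groupType).
Implicit Types (f : G -> R) (xi : l2 R G).

Definition wmean xi f : R :=
  lim ((fun F : {fset G} => \sum_(g <- F) f g * xi g ^+ 2) @ @fset_ultra G).

Lemma wmean_fin_le xi f M (F : {fset G}) : (forall x, `|f x| <= M) ->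
  `|\sum_(g <- F) f g * xi g ^+ 2| <= M * sqn xi.
Proof.
move=> fM; apply: le_trans (ler_norm_sum _ _ _) _.
apply: (@le_trans _ _ (M * \sum_(g <- F) xi g ^+ 2)).
  rewrite mulr_sumr; apply: ler_sum => g _.
  by rewrite normrM (ger0_norm (sqr_ge0 _)) ler_wpM2r ?sqr_ge0.
by rewrite ler_wpM2l ?sum_le_sqn// (le_trans _ (fM 1%g)).
Qed.

Lemma wmean_cvg xi f M : (forall x, `|f x| <= M) ->
  cvg ((fun F : {fset G} => \sum_(g <- F) f g * xi g ^+ 2) @ @fset_ultra G).
Proof. by move=> fM; apply: ulim_cvg => F; exact: (@wmean_fin_le xi f M F fM). Qed.

Lemma wmeanE xi f l :
  (fun F : {fset G} => \sum_(g <- F) f g * xi g ^+ 2) @ @fset_ultra G --> l ->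
  wmean xi f = l.
Proof. by move=> h; apply/cvg_lim. Qed.

Lemma wmean_le xi f M : (forall x, `|f x| <= M) -> `|wmean xi f| <= M * sqn xi.
Proof.
move=> fM; have c := wmean_cvg (xi := xi) fM.
rewrite ler_norml; apply/andP; split.
  apply: limr_ge => //; apply: nearW => F.
  by have := @wmean_fin_le xi f M F fM; rewrite ler_norml => /andP[].
apply: limr_le => //; apply: nearW => F.
by have := @wmean_fin_le xi f M F fM; rewrite ler_norml => /andP[].
Qed.

Lemma wmean_lin xi a f g M N :
  (forall x, `|f x| <= M) -> (forall x, `|g x| <= N) ->
  wmean xi (fun x => a * f x + g x) = a * wmean xi f + wmean xi g.
Proof.
move=> fM gN; apply: wmeanE.
under eq_fun do (under eq_bigr do rewrite mulrDl -mulrA; rewrite big_split/= -mulr_sumr).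
by apply: cvgD; [apply: cvgMr; exact: wmean_cvg fM|exact: wmean_cvg gN].
Qed.

Lemma wmean_ge0 xi f M : (forall x, `|f x| <= M) -> (forall x, 0 <= f x) ->
  0 <= wmean xi f.
Proof.
move=> fM f0; apply: limr_ge; first exact: wmean_cvg fM.
by apply: nearW => F; apply: sumr_ge0 => g _; rewrite mulr_ge0 ?sqr_ge0.
Qed.

Lemma wmean1 xi : wmean xi (fun=> 1) = sqn xi.
Proof.
rewrite /wmean /sqn /dot.
by under eq_fun do under eq_bigr do rewrite mul1r expr2.
Qed.

(** The ultrafilter [fset_ultra] is not known to be invariant under translation, so the limit cannot
    be reindexed. For f >= 0, however, [wmean xi f] is the squared norm of the vector sqrt(f) xi,
    and [lact g] is isometric. *)
Lemma wmean_lact_ge0 g xi f M : (forall x, `|f x| <= M) -> (forall x, 0 <= f x) ->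
  wmean (lact g xi) (fun x => f (g^-1 * x)%g) = wmean xi f.
Proof.
move=> fM f0.
have wsq (eta : l2 R G) (h : G -> R) : (forall x, `|h x| <= M) -> (forall x, 0 <= h x) ->
    exists2 z : l2 R G, (forall x, z x = Num.sqrt (h x) * eta x) & wmean eta h = sqn z.
  move=> hM h0.
  have zM (F : {fset G}) : \sum_(x <- F) (Num.sqrt (h x) * eta x) ^+ 2 <= M * sqn eta.
    under eq_bigr do rewrite exprMn sqr_sqrtr ?h0//.
    exact: le_trans (ler_norm _) (@wmean_fin_le eta h M F hM).
  exists (l2_of zM) => //; rewrite /wmean /sqn /dot.
  have -> // : (fun F : {fset G} => \sum_(g <- F) h g * eta g ^+ 2) =
      (fun F : {fset G} => \sum_(i <- F) l2_of zM i * l2_of zM i).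
  apply/funext => F; apply: eq_bigr => x _.
  by rewrite -expr2 [RHS]exprMn sqr_sqrtr.
have [z zE ->] := wsq xi f fM f0.
have [|//|z' z'E ->] := wsq (lact g xi) (fun x => f (g^-1 * x)%g); first by move=> x.
by rewrite -(sqn_lact g z); congr sqn; apply: l2P => x; rewrite z'E [RHS]lactE zE [in LHS]lactE.
Qed.

Lemma wmean_lact g xi f M : (forall x, `|f x| <= M) ->
  wmean (lact g xi) (fun x => f (g^-1 * x)%g) = wmean xi f.
Proof.
move=> fM; have M0 : 0 <= M by rewrite (le_trans _ (fM 1%g)).
(* Adding [M] makes the function nonnegative; the factor 1 gives it the shape of [wmean_lin]. *)
pose h x := 1 * f x + M.
have hM x : `|h x| <= M + M.
  by rewrite /h mul1r (le_trans (ler_normD _ _))// lerD// ger0_norm.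
have h0 x : 0 <= h x.
  by rewrite /h mul1r -lerBlDr sub0r; have := fM x; rewrite ler_norml => /andP[].
have cM (x : G) : `|M| <= M by rewrite ger0_norm.
have := wmean_lact_ge0 g xi hM h0.
rewrite (wmean_lin _ _ fM cM) (wmean_lin _ _ (fun x => fM (g^-1 * x)%g) cM) !mul1r.
have cc eta : wmean eta (fun=> M) = M * sqn eta.
  apply: wmeanE.
  under eq_fun do (rewrite -mulr_sumr; under eq_bigr do rewrite expr2).
  by apply: cvgMr; exact: dot_cvg.
by rewrite !cc sqn_lact => /addIr.
Qed.

(** Factor x^2 - y^2 = (x - y)(x + y) and apply the weighted mean inequality with weight [d]. As
    [sqn (xi + eta) <= 4], the constant is 1/2 + 2, rounded up to 3. *)
Lemma wmean_dist xi eta f M d : (forall x, `|f x| <= M) -> 0 < d ->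
  sqn xi <= 1 -> sqn eta <= 1 -> sqn (xi - eta) <= d ^+ 2 ->
  `|wmean xi f - wmean eta f| <= 3 * M * d.
Proof.
move=> fM d0 xi1 eta1 xe; have M0 : 0 <= M by rewrite (le_trans _ (fM 1%g)).
have bnd (F : {fset G}) :
    `|\sum_(g <- F) f g * xi g ^+ 2 - \sum_(g <- F) f g * eta g ^+ 2| <= 3 * M * d.
  rewrite -sumrB; apply: le_trans (ler_norm_sum _ _ _) _.
  apply: (@le_trans _ _ (\sum_(g <- F) M * (d^-1 * (xi - eta) g ^+ 2 / 2 +
      d * (xi + eta) g ^+ 2 / 2))).
    apply: ler_sum => g _; rewrite -mulrBr normrM ler_pM//.
    rewrite l2B l2D; set x := xi g; set y := eta g.
    have : 0 <= d^-1 * (`|x - y| - d * `|x + y|) ^+ 2.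
      by rewrite mulr_ge0 ?sqr_ge0// invr_ge0 ltW.
    rewrite subr_sqr normrM -(real_normK (num_real (x - y))) -(real_normK (num_real (x + y))).
    move: (`|x - y|) (`|x + y|) => a b.
    rewrite [X in 0 <= X -> _](_ : _ = d^-1 * a ^+ 2 + d * b ^+ 2 - 2 * a * b).
      lra.
    by field; rewrite gt_eqF.
  rewrite -mulr_sumr (mulrC 3) -mulrA ler_wpM2l// big_split/=.
  rewrite -!mulr_suml -!mulr_sumr.
  have h1 := le_trans (sum_le_sqn (xi - eta) F) xe.
  have h2 := sum_le_sqn (xi + eta) F.
  have h3 := sqnD_le xi eta.
  have : d^-1 * \sum_(i <- F) (xi - eta) i ^+ 2 <= d.
    by rewrite ler_pdivrMl// -expr2.
  have : d * \sum_(i <- F) (xi + eta) i ^+ 2 <= d * 4 by rewrite ler_pM2l//; lra.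
  lra.
have cv : (fun F : {fset G} => \sum_(g <- F) f g * xi g ^+ 2 -
    \sum_(g <- F) f g * eta g ^+ 2) @ @fset_ultra G --> wmean xi f - wmean eta f.
  by apply: cvgB; exact: wmean_cvg fM.
rewrite ler_norml; apply/andP; split; rewrite -(cvg_lim _ cv)//.
  apply: limr_ge; first by apply/cvg_ex; eexists; exact: cv.
  by apply: nearW => F; have := bnd F; rewrite ler_norml => /andP[].
apply: limr_le; first by apply/cvg_ex; eexists; exact: cv.
by apply: nearW => F; have := bnd F; rewrite ler_norml => /andP[].
Qed.

(** Contrapositive: for each finite set [L] of pairs (group element, precision) take a unit vector
    [xi L] almost fixed by these elements. The means with densities [xi L] squared are almost
    invariant, and their ultralimit is an invariant mean. *)
Lemma nonamenable_gap : ~ amenable R G ->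
  exists (S : seq G) (eps : R), 0 < eps /\
    forall xi, exists2 s, s \in S & eps * sqn xi <= sqn (lact s xi - xi).
Proof.
apply: contra_notP => /forallNP gap.
have ai (S : seq G) eps : 0 < eps -> exists xi : l2 R G, sqn xi = 1 /\
    forall s, s \in S -> sqn (lact s xi - xi) <= eps.
  (* The displacement by 1 is zero, so the failure of the gap at 1 shows that [xi] is nonzero and
     can be normalised. *)
  move=> e0; apply: contrapT => nxi; apply: (gap (1%g :: S)); exists eps; split=> // xi.
  apply: contrapT => /forall2NP nS.
  have lt s : s \in 1%g :: S -> sqn (lact s xi - xi) < eps * sqn xi.
    by move=> sS; have [//|/negP] := nS s; rewrite -ltNge.
  have xi0 : 0 < sqn xi.
    have := lt 1%g (mem_head _ _); rewrite lact1 subrr sqn0 pmulr_rgt0//.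
  apply: nxi; exists ((nrm xi)^-1 *: xi); rewrite sqnZ exprVn nrm_sqr mulVf ?gt_eqF//.
  split=> // s sS; rewrite (linZ (lin_lact s)) -scalerBr sqnZ exprVn nrm_sqr.
  by rewrite ler_pdivrMl// mulrC ltW// lt// inE sS orbT.
pose dl (L : {fset G * nat}) : R := (\max_(x <- L) x.2).+1%:R^-1.
have dl0 L : 0 < dl L by rewrite invr_gt0 ltr0n.
pose xi (L : {fset G * nat}) := projT1 (cid (ai [seq x.1 | x <- L] _ (exprn_gt0 2 (dl0 L)))).
have xi1 L : sqn (xi L) = 1 by rewrite /xi; case: cid => /= ? [].
have xiS L s n : (s, n) \in L -> sqn (lact s (xi L) - xi L) <= dl L ^+ 2.
  rewrite /xi; case: cid => /= z [_ h] sL; apply: h.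
  by apply/mapP; exists (s, n).
pose mu f := lim ((fun L => wmean (xi L) f) @ @fset_ultra (G * nat)%type).
have mu_cvg f M : (forall x, `|f x| <= M) ->
    cvg ((fun L => wmean (xi L) f) @ @fset_ultra (G * nat)%type).
  by move=> fM; apply: (@ulim_cvg _ _ _ _ _ M) => L; rewrite (le_trans (wmean_le _ fM))// xi1 mulr1.
exists mu; split.
- move=> a f g /bounded_funW[M [_ fM]] /bounded_funW[N [_ gN]].
  apply/cvg_lim => //; under eq_fun do rewrite (wmean_lin _ _ fM gN).
  by apply: cvgD; [apply: cvgMr; exact: mu_cvg fM|exact: mu_cvg gN].
- move=> f /bounded_funW[M [_ fM]] f0; apply: limr_ge; first exact: mu_cvg fM.
  by apply: nearW => L; exact: wmean_ge0 fM f0.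
- apply/cvg_lim => //; under eq_fun do rewrite wmean1 xi1.
  exact: cvg_cst.
- move=> g f /bounded_funW[M [M0 fM]].
  have fM' x : `|f (g^-1 * x)%g| <= M by exact: fM.
  apply/eqP; rewrite -subr_eq0 -normr_le0; apply/ler_addgt0Pr => e e0; rewrite add0r.
  have cv : (fun L => wmean (xi L) (fun x => f (g^-1 * x)%g) - wmean (xi L) f)
      @ @fset_ultra (G * nat)%type --> mu (fun x => f (g^-1 * x)%g) - mu f.
    by apply: cvgB; [exact: mu_cvg fM'|exact: mu_cvg fM].
  pose n := Num.truncn (3 * M / e).
  have near_le : \forall L \near @fset_ultra (G * nat)%type,
      `|wmean (xi L) (fun x => f (g^-1 * x)%g) - wmean (xi L) f| <= e.
    apply: filterS (fset_ultra_ge [fset (g, n)]%fset) => L /= /fsubsetP/(_ (g, n)).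
    rewrite inE eqxx => /(_ isT) gL; rewrite -(wmean_lact g (xi L) fM) distrC.
    apply: le_trans (wmean_dist fM' (dl0 L) _ _ (xiS _ _ _ gL)) _; rewrite ?sqn_lact ?xi1//.
    rewrite ler_pdivrMr ?ltr0n// [e * _]mulrC -ler_pdivrMr//.
    apply: (@le_trans _ _ n.+1%:R); first by rewrite ltW// truncnS_gt.
    by rewrite ler_nat ltnS; exact: (@leq_bigmax_seq _ _ _ (fun x => x.2) (g, n)).
  rewrite -(cvg_lim _ cv)// ler_norml; apply/andP; split.
    apply: limr_ge; first by apply/cvg_ex; eexists; exact: cv.
    by apply: filterS near_le => L; rewrite ler_norml => /andP[].
  apply: limr_le; first by apply/cvg_ex; eexists; exact: cv.
  by apply: filterS near_le => L; rewrite ler_norml => /andP[].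
Qed.

Definition lsum (S : seq G) (xi : l2 R G) : l2 R G := \sum_(s <- S) lact s xi.

(** Expanding the square, |sum_s s xi|^2 = b^2 |xi|^2 - (1/2) sum_(s,t) |t xi - s xi|^2, and the row
    s = 1 contains a displacement of at least [eps * sqn xi]. The inverses have the same gap because
    s and its inverse displace [xi] equally. *)
Lemma kesten : ~ amenable R G ->
  exists (S : seq G) (rho : R), [/\ (2 <= size S)%N, 0 < rho < 1,
    forall xi, nrm (lsum S xi) <= rho * (size S)%:R * nrm xi &
    forall xi, nrm (lsum [seq s^-1%g | s <- S] xi) <= rho * (size S)%:R * nrm xi].
Proof.
move=> /nonamenable_gap[S [eps [e0 gap]]].
(* The copies of 1 provide the row of displacements and make the size at least two. *)
pose S' := [:: 1%g, 1%g & S]; pose b : R := (size S')%:R.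
have b0 : 0 < b by rewrite ltr0n.
have main (s' : seq G) : size s' = size S ->
    (forall xi, exists2 s, s \in s' & eps * sqn xi <= sqn (lact s xi - xi)) ->
    forall xi, sqn (lsum [:: 1%g, 1%g & s'] xi) <= (b ^+ 2 - eps / 2) * sqn xi.
  move=> size_s gap' xi; set T := [:: 1%g, 1%g & s'].
  have dE s t : dot (lact s xi) (lact t xi) =
      sqn xi - 2^-1 * sqn (lact t xi - lact s xi).
    by rewrite sqnB !sqn_lact (dotC (lact t xi)); field.
  have -> : sqn (lsum T xi) = b ^+ 2 * sqn xi -
      2^-1 * \sum_(s <- T) \sum_(t <- T) sqn (lact t xi - lact s xi).
    rewrite {1}/sqn /lsum dot_suml.
    under eq_bigr do rewrite dot_sumr.
    under eq_bigr do (under eq_bigr do rewrite dE; rewrite sumrB big_const_seq count_predT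
      iter_addr_0 -mulr_sumr).
    rewrite sumrB big_const_seq count_predT iter_addr_0 -mulr_sumr.
    congr (_ - _); rewrite -[sqn xi *+ _]mulr_natr -[_ *+ _ in LHS]mulr_natr.
    by rewrite /b /T /= size_s; ring.
  rewrite mulrBl lerB//.
  rewrite (_ : eps / 2 * sqn xi = 2^-1 * (eps * sqn xi)); last by field.
  rewrite ler_pM2l ?invr_gt0//.
  have [s sS hs] := gap' xi; apply: le_trans hs _.
  rewrite big_cons ler_wpDr//.
    by rewrite sumr_ge0// => t _; rewrite sumr_ge0// => u _; exact: sqn_ge0.
  rewrite lact1 (big_rem s)/= ?lerDl; last by rewrite !inE sS !orbT.
  by rewrite sumr_ge0// => t _; exact: sqn_ge0.
(* The maximum with 1/2 keeps [rho] positive even if the argument of the root is not. *)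
pose rho := Num.max (2^-1) (Num.sqrt (1 - eps / (2 * b ^+ 2))).
have rho0 : 0 < rho by rewrite lt_max invr_gt0 ltr0n.
have rho1 : rho < 1.
  rewrite gt_max invf_lt1 ?ltr1n// -[ltRHS]sqrtr1 ltr_sqrt//=.
  by rewrite ltrBlDr ltrDl divr_gt0// mulr_gt0// exprn_gt0.
have fin (s' : seq G) : size s' = size S ->
    (forall xi, exists2 s, s \in s' & eps * sqn xi <= sqn (lact s xi - xi)) ->
    forall xi, nrm (lsum [:: 1%g, 1%g & s'] xi) <= rho * b * nrm xi.
  move=> size_s gap' xi.
  rewrite nrm_le_sqn ?mulr_ge0 ?nrm_ge0 ?(ltW b0) ?(ltW rho0)//.
  apply: le_trans (main _ size_s gap' xi) _.
  rewrite exprMn nrm_sqr ler_wpM2r ?sqn_ge0//.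
  have -> : b ^+ 2 - eps / 2 = (1 - eps / (2 * b ^+ 2)) * b ^+ 2.
    by field; rewrite gt_eqF.
  rewrite exprMn ler_wpM2r ?sqr_ge0//.
  have [h|h] := leP 0 (1 - eps / (2 * b ^+ 2)).
    rewrite -(sqr_sqrtr h) ler_pXn2r ?nnegrE ?sqrtr_ge0 ?(ltW rho0)//.
    by rewrite le_max lexx orbT.
  by rewrite (le_trans (ltW h))// sqr_ge0.
exists S', rho; split; rewrite ?rho0//; first exact: fin.
move=> xi; rewrite /= !invg1; apply: (fin [seq s^-1%g | s <- S]); first by rewrite size_map.
move=> z; have [s sS h] := gap z; exists s^-1%g; first by apply/mapP; exists s.
by rewrite lactV_sqn.
Qed.

End Mean.

(** * Products of letters and counting of words *)

Section KestenPower.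
Variables (R : realType) (G : groupType).

(** A list with repetitions: coinciding products stay distinct letters, so the size is exactly a
    power and sums over it are iterates of [lsum S]. *)
Fixpoint kpow (S : seq G) (k : nat) : seq G :=
  if k is k'.+1 then [seq (s * t)%g | s <- S, t <- kpow S k'] else [:: 1%g].

Lemma size_kpow S k : size (kpow S k) = (size S ^ k)%N.
Proof. by elim: k => //= k ih; rewrite size_allpairs ih expnS. Qed.

Lemma lsum_kpow S k (f : l2 R G) :
  lsum (kpow S k.+1) f = lsum S (lsum (kpow S k) f).
Proof.
rewrite /lsum big_allpairs_dep; apply: eq_bigr => s _.
by rewrite (lin_sum (lin_lact s)); apply: eq_bigr => t _; rewrite lactM.
Qed.

Lemma lsum_kpowV S k (f : l2 R G) :
  lsum [seq x^-1%g | x <- kpow S k.+1] f =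
  lsum [seq x^-1%g | x <- kpow S k] (lsum [seq x^-1%g | x <- S] f).
Proof.
rewrite /lsum !big_map big_allpairs_dep exchange_big; apply: eq_bigr => t _ /=.
rewrite (lin_sum (lin_lact _)); apply: eq_bigr => s _.
by rewrite invgM lactM.
Qed.

Lemma kesten_letters : ~ amenable R G ->
  exists (b : nat) (rho : R), [/\ (2 <= b)%N, 0 < rho < 1 & forall k,
    exists s : 'I_(b ^ k) -> G, forall f : l2 R G,
      nrm (\sum_i lact (s i) f) <= (rho * b%:R) ^+ k * nrm f /\
      nrm (\sum_i lact (s i)^-1%g f) <= (rho * b%:R) ^+ k * nrm f].
Proof.
move=> /kesten[S [rho [S2 /andP[rho0 rho1] SP SVP]]].
exists (size S), rho; split; rewrite ?rho0// => k.
have M0 : 0 <= rho * (size S)%:R by rewrite mulr_ge0 ?(ltW rho0).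
have P f : nrm (lsum (kpow S k) f) <= (rho * (size S)%:R) ^+ k * nrm f.
  elim: k => [|k ih]; first by rewrite /lsum big_seq1 lact1 mul1r.
  rewrite lsum_kpow; apply: le_trans (SP _) _.
  by rewrite exprS -[leRHS]mulrA ler_wpM2l.
have PV f : nrm (lsum [seq x^-1%g | x <- kpow S k] f) <= (rho * (size S)%:R) ^+ k * nrm f.
  elim: k f {P} => [|k ih] f; first by rewrite /lsum big_seq1 invg1 lact1 mul1r.
  rewrite lsum_kpowV; apply: le_trans (ih _) _.
  by rewrite exprSr -[leRHS]mulrA ler_wpM2l// exprn_ge0.
pose s (i : 'I_(size S ^ k)) := nth 1%g (kpow S k) i.
exists s => f; split.
  by have := P f; rewrite /lsum (big_nth 1%g) size_kpow big_mkord.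
have := PV f; rewrite /lsum big_map (big_nth 1%g) size_kpow big_mkord; exact.
Qed.

Section Words.
Variables (X : finType) (sx : X -> G).

Fixpoint words (m : nat) : seq (seq X) :=
  if m is m'.+1 then [seq x :: w | x <- enum X, w <- words m'] else [:: [::]].

Lemma mem_words m w : (w \in words m) = (size w == m).
Proof.
elim: m w => [|m ih] w; first by rewrite inE; case: w.
apply/allpairsP/eqP => [[[x v] /= [_]]|].
  by rewrite ih => /eqP <- ->.
case: w => // x w [wm]; exists (x, w); split => //=; first by rewrite mem_enum.
by rewrite ih wm.
Qed.

Definition wprod (w : seq X) : G := foldr (fun x g => sx x * g)%g 1%g w.

(** The count is the coordinate at g of the m-th power of the sum of the letters applied to the
    point mass at 1, hence at most the norm of that vector. *)
Lemma count_words (M : R) : 0 <= M ->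
    (forall f : l2 R G, nrm (\sum_x lact (sx x) f) <= M * nrm f) ->
  forall m g, (count (fun w => wprod w == g) (words m))%:R <= M ^+ m.
Proof.
move=> M0 AM m g.
pose A (f : l2 R G) := \sum_x lact (sx x) f.
have nv : nrm (iter m A (delta R 1%g)) <= M ^+ m.
  elim: m => [|m ih] /=; first by rewrite /nrm sqn_delta sqrtr1.
  by apply: le_trans (AM _) _; rewrite exprS ler_wpM2l.
have -> : (count (fun w => wprod w == g) (words m))%:R = iter m A (delta R 1%g) g :> R.
  elim: m g {nv} => [|m ih] g; first by rewrite /= addn0 eq_sym.
  rewrite /= {1}/A l2_sum count_flatten -map_comp sumnE big_map natr_sum.
  rewrite big_enum; apply: eq_bigr => x _; rewrite lactE -ih [LHS]/= count_map; congr (_%:R).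
  by apply: eq_count => w /=; rewrite (can2_eq (mulKg (sx x)) (mulVKg (sx x))).
apply: le_trans (ler_norm _) _; rewrite -(ler_pXn2r (ltn0Sn 1)) ?nnegrE ?exprn_ge0//.
rewrite real_normK ?num_real//; apply: le_trans (coord_le_sqn _ _) _.
by rewrite -nrm_sqr ler_pXn2r ?nnegrE ?nrm_ge0 ?exprn_ge0.
Qed.
End Words.

End KestenPower.

(** * Forests, codes and sparse sequences *)

Section Orientation.
Variables (V : eqType) (X : finType) (bar : X -> X) (step : V -> X -> V).
Hypothesis barK : involutive bar.
Hypothesis stepK : forall v x, step (step v x) (bar x) = v.
Implicit Types (v : V) (w : seq X).

Fixpoint trace v w : seq V :=
  if w is x :: w' then v :: trace (step v x) w' else [::].

Fixpoint along (Fe : V -> X -> bool) v w : bool :=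
  if w is x :: w' then Fe v x && along Fe (step v x) w' else true.

(* A simple closed walk. Of length two, it has to use two different edges. *)
Definition is_cycle (Fe : V -> X -> bool) v w : Prop :=
  [/\ (2 <= size w)%N, foldl step v w = v, uniq (trace v w), along Fe v w &
      forall x y, w = [:: x; y] -> y != bar x].

Lemma size_trace v w : size (trace v w) = size w.
Proof. by elim: w v => //= x w ih v; rewrite ih. Qed.

Let vs v w := rcons (trace v w) (foldl step v w).

Let trace_take v w i : (i <= size w)%N -> trace v (take i w) = take i (vs v w).
Proof.
elim: w v i => [|x w ih] v [|i] //=; rewrite ltnS => iw.
by rewrite /vs /= ih.
Qed.

Let along_take Fe v w i : along Fe v w -> along Fe v (take i w).
Proof.
elim: w v i => [|x w ih] v [|i] //= /andP[-> h]; exact: ih.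
Qed.

Let nth_vs v w i x0 : (i <= size w)%N -> nth x0 (vs v w) i = foldl step v (take i w).
Proof.
elim: w v i => [|x w ih] v [|i] //=; rewrite ltnS => iw.
by rewrite /vs /= -ih.
Qed.

Variable Fe : V -> X -> bool.
Hypothesis Fe_sym : forall v x, Fe (step v x) (bar x) = Fe v x.
Hypothesis noloop : forall v x, Fe v x -> step v x != v.

(** Without such a vertex, a path inside [L] can always be prolonged at its origin by an edge other
    than the one it starts with. If the new vertex lies on the path, a cycle is closed; otherwise
    simple paths outgrow [L]. *)
Lemma leaf_exists (L : seq V) : L != [::] ->
    (forall v w, is_cycle Fe v w -> ~~ all [in L] (trace v w)) ->
  exists2 v, v \in L & forall x y, Fe v x -> step v x \in L ->
    Fe v y -> step v y \in L -> x = y.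
Proof.
move=> L0 acyc; apply: contrapT => nleaf.
have ex v (z : X) : v \in L -> exists x, [/\ x != z, Fe v x & step v x \in L].
  move=> vL; apply: contrapT => nx; apply: nleaf; exists v => // x y Fx xL Fy yL.
  have eqz t : Fe v t -> step v t \in L -> t = z.
    by move=> Ft tL; apply/eqP/negPn/negP => tz; apply: nx; exists t.
  by rewrite (eqz x)// (eqz y).
have build l : exists v w, [/\ size w = l, uniq (vs v w), all [in L] (vs v w) & along Fe v w].
  elim: l => [|l [v [w [sw uw aw fw]]]].
    by case: L L0 {acyc nleaf ex} => // v L _; exists v, [::]; rewrite /vs /= mem_head.
  have vL : v \in L.
    by move/allP: aw; apply; rewrite /vs; case: (w) => [|y w'] /=; rewrite mem_head.
  have [x [xz Fx xL]] : exists x, [/\ (forall y w', w = y :: w' -> x != y), Fe v x & step v x \in L].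
    case: w {sw uw aw fw} => [|z w].
      have [z _] : exists z : X, True.
        apply: contrapT => nX; apply: nleaf; exists v => // x; by case: nX; exists x.
      by have [x [_ Fx xL]] := ex v z vL; exists x.
    by have [x [xz Fx xL]] := ex v z vL; exists x; split => // y w' [<- _].
  have [inv|ninv] := boolP (step v x \in vs v w); last first.
    exists (step v x), (bar x :: w); rewrite /= stepK Fe_sym Fx fw sw; split=> //.
      by move: ninv uw; rewrite /vs /= ?stepK => -> ->.
    by move: aw; rewrite /vs /= ?stepK xL.
  (* The new vertex is the [i]-th vertex of the path: the new edge, reversed, followed by the first
     [i] letters is the cycle. *)
  pose i := index (step v x) (vs v w).
  have iw : (i <= size w)%N.
    by rewrite -ltnS; move: inv; rewrite -index_mem /vs size_rcons size_trace.
  have vi : foldl step v (take i w) = step v x by rewrite -(nth_vs v v iw) nth_index.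
  have i0 : (0 < i)%N.
    by rewrite lt0n; apply/eqP => i0; have := noloop Fx; rewrite -vi i0 take0 eqxx.
  exfalso; have /acyc/negP : is_cycle Fe (step v x) (bar x :: take i w); last first.
    apply; rewrite /= stepK xL /= trace_take//.
    by apply/allP => y /mem_take; move/allP: aw; apply.
  split.
  - by rewrite /= size_takel.
  - by rewrite /= stepK.
  - rewrite /= stepK trace_take// take_uniq// andbT.
    by apply/negP => /index_ltn; rewrite ltnn.
  - by rewrite /= stepK Fe_sym Fx along_take.
  - move=> y z [<- tw]; rewrite barK eq_sym.
    have hw (s : seq X) j : take j s = [:: z] -> s = z :: behead s.
      by case: s j => [|c s] [|j] //= [->].
    exact: xz (hw _ _ tw).
have [v [w [sw uw aw _]]] := build (size L).
have : (size (vs v w) <= size L)%N by apply: uniq_leq_size => // y; move/allP: aw; apply.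
by rewrite /vs size_rcons size_trace sw ltnn.
Qed.

(** Induction removing a leaf: its only edge inside [L], if there is one, is directed away from it,
    and no other vertex changes its outgoing edge. *)
Lemma orientation (L : seq V) : uniq L ->
    (forall v w, is_cycle Fe v w -> ~~ all [in L] (trace v w)) ->
  exists out : V -> option X,
    (forall v x, out v = Some x -> [/\ v \in L, step v x \in L & Fe v x]) /\
    (forall v x, v \in L -> step v x \in L -> Fe v x ->
      (out v == Some x) (+) (out (step v x) == Some (bar x))).
Proof.
move: {2}(size L) (erefl (size L)) => l; elim: l L => [|l ih] L sL uL acyc.
  by case: L sL {uL acyc} => // _; exists (fun=> None).
have L0 : L != [::] by rewrite -size_eq0 sL.
have [v vL leaf] := leaf_exists L0 acyc.
have acyc' u w : is_cycle Fe u w -> ~~ all [in rem v L] (trace u w).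
  move=> /acyc; apply: contra => /allP h; apply/allP => y /h /=.
  by rewrite mem_rem_uniq// => /andP[].
have sr : size (rem v L) = l by rewrite size_rem// sL.
have [out [ op1 op2]] := ih (rem v L) sr (rem_uniq v uL) acyc'.
have remE u : (u \in rem v L) = (u != v) && (u \in L) by rewrite mem_rem_uniq.
have outv u x : out u = Some x -> u != v /\ step u x != v.
  by move=> /op1[]; rewrite !remE => /andP[-> _] /andP[-> _].
pose nb := [pick x | Fe v x & step v x \in L].
exists (fun u => if u == v then nb else out u); split.
  move=> u x; case: eqP => [->|_].
    by rewrite /nb; case: pickP => // y /andP[Fy yL] [<-].
  by move=> /op1[]; rewrite !remE => /andP[_ ->] /andP[_ ->] ->.
have nbx x : Fe v x -> step v x \in L -> nb = Some x.
  move=> Fx xL; rewrite /nb; case: pickP => [y /andP[Fy yL]|/(_ x)]; last by rewrite Fx xL.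
  by rewrite (leaf x y).
move=> u x uL' xL Fx; case: (eqVneq u v) => [uv|uv].
  rewrite uv in Fx xL *; rewrite (negbTE (noloop Fx)) (nbx x)// eqxx /=.
  by apply/negP => /eqP/outv[_]; rewrite stepK eqxx.
case: (eqVneq (step u x) v) => [sv|sv]; last by apply: op2; rewrite ?remE ?uv ?sv.
have -> : nb = Some (bar x).
  by apply: nbx; rewrite -sv ?Fe_sym ?stepK.
rewrite eqxx addbT; apply/negP => /eqP/outv[_]; by rewrite sv eqxx.
Qed.

End Orientation.

(** * Words with few agreements *)

Section Code.
Local Close Scope classical_set_scope.
Local Open Scope set_scope.
Variables (a r t : nat).
Implicit Types f g : {ffun 'I_a -> 'I_r}.

Lemma card_bigcup_le (I T : finType) (P : pred I) (F : I -> {set T}) :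
  (#|\bigcup_(i | P i) F i| <= \sum_(i | P i) #|F i|)%N.
Proof.
elim/big_rec2: _ => [|i n A _ ih]; first by rewrite cards0.
by apply: leq_trans (leq_card_setU _ _) _; rewrite leq_add2l.
Qed.

Definition agree f g := #|[set k | f k == g k]|.

Lemma card_agree_on f (S : {set 'I_a}) :
  #|[set g : {ffun 'I_a -> 'I_r} | S \subset [set k | g k == f k]]| = (r ^ (a - #|S|))%N.
Proof.
rewrite (_ : [set g | _] = [set g in family (fun k => if k \in S then pred1 (f k) else predT)]).
  rewrite cardsE card_family (_ : foldr _ _ _ = \prod_(k : 'I_a) (if k \in S then 1 else r)%N).
    rewrite (eq_bigr (fun k => if k \in ~: S then r else 1)%N) => [|k _]; last first.
      by rewrite inE if_neg.
    by rewrite -big_mkcond prod_nat_const cardsCs finset.setCK card_ord.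
  rewrite foldrE big_image /=; apply: eq_bigr => k _; case: ifP => _; rewrite ?card1//.
  by rewrite cardT size_enum_ord.
apply/setP => g; rewrite !inE; apply/fintype.subsetP/familyP => [h k|h k kS].
  by case: ifP => // /h; rewrite !inE.
by have := h k; rewrite kS !inE.
Qed.

(** Union bound over the sets of more than t positions: at most 2^a of them, each leaving at most
    r^(a-t-1) words. *)
Lemma card_agree_gt f : (2 <= r)%N ->
  (#|[set g : {ffun 'I_a -> 'I_r} | (t < agree g f)%N]| * r ^ t.+1 <= 2 ^ a * r ^ a)%N.
Proof.
move=> r2; have r0 : (0 < r)%N by exact: leq_trans r2.
have sub : [set g : {ffun 'I_a -> 'I_r} | (t < agree g f)%N] \subset
    \bigcup_(S : {set 'I_a} | (t < #|S|)%N)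
      [set g : {ffun 'I_a -> 'I_r} | S \subset [set k | g k == f k]].
  apply/fintype.subsetP => g; rewrite inE => tg; apply/bigcupP.
  by exists [set k | g k == f k] => //; rewrite inE.
apply: (@leq_trans ((\sum_(S : {set 'I_a} | (t < #|S|)%N) r ^ (a - #|S|)) * r ^ t.+1)%N).
  rewrite leq_mul2r; apply/orP; right; apply: leq_trans (subset_leq_card sub) _.
  apply: leq_trans (card_bigcup_le _ _) _.
  by apply: leq_sum => S _; rewrite card_agree_on.
rewrite big_distrl /=; apply: (@leq_trans (\sum_(S : {set 'I_a} | (t < #|S|)%N) r ^ a)%N).
  apply: leq_sum => S tS; rewrite -expnD leq_pexp2l//.
  have := max_card (mem S); rewrite card_ord; move: tS; move: #|S| => c; lia.
rewrite sum_nat_const leq_mul2r; apply/orP; right.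
apply: leq_trans (max_card _) _.
by rewrite -cardsT -powersetT card_powerset cardsT card_ord.
Qed.

(** The greedy argument of Gilbert and Varshamov: d words exclude at most d 2^a r^a / r^(t+1)
    others, which is less than r^a. *)
Lemma code_exists (d : nat) : (2 <= r)%N -> (d * 2 ^ a <= r ^ t)%N ->
  exists s : seq {ffun 'I_a -> 'I_r}, size s = d /\
    pairwise (fun g f => (agree g f <= t)%N) s.
Proof.
move=> r2; have r0 : (0 < r)%N by exact: leq_trans r2.
elim: d => [|d ih] hd; first by exists [::].
have [|s [sd ps]] := ih; first by apply: leq_trans hd; rewrite leq_mul2r leqnSn orbT.
suff [h hs] : exists h : {ffun 'I_a -> 'I_r}, all (fun f => (agree h f <= t)%N) s.
  by exists (h :: s); rewrite /= sd hs.
apply: contrapT => nh.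
have cov : [set: {ffun 'I_a -> 'I_r}] \subset
    \bigcup_(i < d) [set g : {ffun 'I_a -> 'I_r} | (t < agree g (nth g s i))%N].
  apply/fintype.subsetP => g _; apply: contrapT => ng; apply: nh; exists g.
  apply/allP => f fs; rewrite leqNgt; apply/negP => tf; apply: ng.
  have fi : (index f s < d)%N by rewrite -sd index_mem.
  by apply/bigcupP; exists (Ordinal fi) => //; rewrite inE /= nth_index.
have : (r ^ a * r ^ t.+1 <= d * (2 ^ a * r ^ a))%N.
  have -> : (r ^ a = #|[set: {ffun 'I_a -> 'I_r}]|)%N by rewrite cardsT card_ffun !card_ord.
  apply: (@leq_trans ((\sum_(i < d)
      #|[set g : {ffun 'I_a -> 'I_r} | (t < agree g (nth g s i))%N]|) * r ^ t.+1)%N).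
    rewrite leq_mul2r; apply/orP; right; apply: leq_trans (subset_leq_card cov) _.
    exact: card_bigcup_le.
  rewrite big_distrl /= -[d in leqRHS]card_ord -sum_nat_const.
  apply: leq_sum => i _; rewrite cardsT card_ffun !card_ord.
  have is_ : (i < size s)%N by rewrite sd.
  case: s sd ps nh cov is_ => // f0 s0 sd ps nh cov is_.
  rewrite (_ : [set g | _] = [set g | (t < agree g (nth f0 (f0 :: s0) i))%N]).
    exact: card_agree_gt.
  by apply/setP => g; rewrite !inE (set_nth_default f0).
rewrite expnS mulnCA (mulnC (r ^ a)%N) !mulnA leq_pmul2r ?expn_gt0 ?r0//.
rewrite leqNgt => /negP; apply.
apply: leq_ltn_trans (leq_trans (leq_mul (leqnSn d) (leqnn _)) hd) _.
by rewrite mulnC -{1}(muln1 (r ^ t)%N) ltn_pmul2l// expn_gt0 r0.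
Qed.

End Code.

(** * Sparse sequences in an infinite group *)

Section Sparse.
Variables (G : groupType) (H : seq G).
Hypothesis G_inf : forall s : seq G, exists g, g \notin s.

Definition sparse_avoid (us : seq G) : seq G :=
  [seq (x.1 * x.2)%g | x <- [seq (p, h') | p <-
    [seq (x.1 * x.2)%g | x <- [seq (p, u) | p <-
      [seq (x.1 * x.2^-1)%g | x <- [seq (p, u) | p <-
        [seq (x.1 * x.2)%g | x <- [seq (u, h) | u <- us, h <- H]], u <- us]], u <- us]], h' <- H]].

(** Greedy choice, each step excluding finitely many products. The excluded shape says that an
    element u_j h u_i^-1, which moves the coset of u_i to that of u_j, does not move an earlier
    coset to that of u_m. *)
Lemma sparse_exists : exists u : nat -> G, forall m i j k h h',
  (i < m)%N -> (j < m)%N -> (k < m)%N -> h \in H -> h' \in H ->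
  u m != (u j * h * (u i)^-1 * u k * h')%g.
Proof.
pose next us := projT1 (cid (G_inf (sparse_avoid us))).
have nextP us : next us \notin sparse_avoid us by rewrite /next; case: cid.
pose us := fix us m := if m is m'.+1 then rcons (us m') (next (us m')) else [::].
exists (fun m => next (us m)) => m i j k h h' im jm km hH h'H.
have mem i' m' : (i' < m')%N -> next (us i') \in us m'.
  elim: m' => // m' ih; rewrite ltnS leq_eqVlt => /orP[/eqP ->|/ih im'].
    by rewrite /= mem_rcons mem_head.
  by rewrite /= mem_rcons inE im' orbT.
apply/eqP => um; have /negP := nextP (us m); apply; rewrite um.
apply/mapP; eexists (_, h'); last reflexivity.
apply/allpairsP; eexists (_, h'); split => //=.
apply/mapP; eexists (_, _); last reflexivity.
apply/allpairsP; eexists (_, next (us k)); split; rewrite ?mem//=.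
apply/mapP; eexists (_, _); last reflexivity.
apply/allpairsP; eexists (_, next (us i)); split; rewrite ?mem//=.
apply/mapP; eexists (_, _); last reflexivity.
by apply/allpairsP; exists (next (us j), h); split; rewrite ?mem.
Qed.
End Sparse.

(** On a finite group the uniform average is an invariant mean; [undup] counts every element
    once. *)
Lemma nonamenable_infinite (R : realType) (G : groupType) : ~ amenable R G ->
  forall s : seq G, exists g, g \notin s.
Proof.
move=> nam s0; apply: contrapT => /forallNP all_s; apply: nam.
pose s := undup s0.
have sP g : g \in s by rewrite mem_undup; apply: contrapT => /negP; exact: all_s.
have n0 : (size s)%:R != 0 :> R.
  by rewrite pnatr_eq0 -lt0n; have := sP 1%g; case: (s).
exists (fun f => (size s)%:R^-1 * \sum_(g <- s) f g); split.
- by move=> a f g _ _; rewrite big_split/= -mulr_sumr mulrDr mulrCA.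
- by move=> f _ f0; rewrite mulr_ge0 ?invr_ge0// sumr_ge0.
- by rewrite big_const_seq count_predT iter_addr_0 mulVf.
- move=> g f _; congr (_ * _); rewrite -(big_map (fun x => (g^-1 * x)%g) xpredT f).
  apply/perm_big/uniq_perm; rewrite ?undup_uniq//.
    by rewrite map_inj_uniq ?undup_uniq//; exact: mulgI.
  by move=> x; rewrite sP; apply/mapP; exists (g * x)%g; rewrite ?mulKg.
Qed.

(** * Commuting projections and lamps *)

Section Spectral.
Variables (R : realType) (I V : choiceType).
Variable e : V -> l2 R I -> l2 R I.
Hypothesis lin_e : forall v, lin (e v).
Hypothesis e_idem : forall v f, e v (e v f) = e v f.
Hypothesis e_sym : forall v f g, dot (e v f) g = dot f (e v g).
Hypothesis e_comm : forall u v f, e u (e v f) = e v (e u f).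
Implicit Types (c : V -> bool) (K : seq V) (f g : l2 R I).

Definition upd c v b : V -> bool := fun u => if u == v then b else c u.

(* [F] applied to the joint spectrum of the projections [e v] for [v] in [K]: on a
   joint eigenvector, [F] is evaluated at the configuration of eigenvalues,
   extended by [false] outside of [K]. *)
Fixpoint op K (F : (V -> bool) -> R) f : l2 R I :=
  if K is v :: K' then
    op K' (fun c => F (upd c v true)) (e v f) +
    op K' (fun c => F (upd c v false)) (f - e v f)
  else F (fun=> false) *: f.

Fixpoint cfgs K : seq (V -> bool) :=
  if K is v :: K' then
    [seq upd c v true | c <- cfgs K'] ++ [seq upd c v false | c <- cfgs K']
  else [:: fun=> false].

(** The spectral projection onto the vectors on which [e v] acts as [c v] for all v in [K]. *)
Fixpoint zop K c f : l2 R I :=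
  if K is v :: K' then
    if c v then e v (zop K' c f) else zop K' c f - e v (zop K' c f)
  else f.

Definition restr K c : V -> bool := fun u => (u \in K) && c u.

Definition eigen K c f := forall v, v \in K -> e v f = (c v)%:R *: f.

Lemma lin_op K F : lin (op K F).
Proof.
elim: K F => [|v K ih] F a f g /=; first by rewrite scalerDr !scalerA mulrC.
rewrite lin_e ih.
rewrite (_ : a *: f + g - (a *: e v f + e v g) = a *: (f - e v f) + (g - e v g)).
  by rewrite ih scalerDr !addrA; congr (_ + _); rewrite -!addrA; congr (_ + _); rewrite addrC.
by rewrite scalerBr opprD addrACA.
Qed.

Lemma zop_sym K c f g : dot (zop K c f) g = dot f (zop K c g).
Proof.
have comm u K' h : e u (zop K' c h) = zop K' c (e u h).
  elim: K' => //= v K' ih; case: ifP => _; first by rewrite e_comm ih.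
  by rewrite (linB (lin_e u)) e_comm ih.
elim: K f g => //= v K ih f g; case: ifP => _; first by rewrite e_sym ih comm.
by rewrite dotBl e_sym !ih dotBr comm.
Qed.

Lemma zop_eigen K c f : eigen K c (zop K c f).
Proof.
elim: K => //= v K ih u; rewrite inE; case: eqVneq => [->|uv] /= uK.
  case: ifP => _; rewrite ?e_idem ?scale1r//.
  by rewrite (linB (lin_e v)) e_idem subrr scale0r.
case: ifP => _; first by rewrite e_comm ih// (linZ (lin_e v)).
by rewrite (linB (lin_e u)) e_comm ih// (linZ (lin_e v)) scalerBr.
Qed.

Lemma eigen_zop K c f : eigen K c f -> zop K c f = f.
Proof.
elim: K => //= v K ih h; rewrite ih; last by move=> u uK; apply: h; rewrite inE uK orbT.
by have := h v (mem_head _ _); case: ifP => _ ->; rewrite ?scale1r ?scale0r ?subr0.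
Qed.

Lemma op_eigen K c F f : eigen K c f -> op K F f = F (restr K c) *: f.
Proof.
elim: K F => [|v K ih] F h /=; first by rewrite /restr.
have hK : eigen K c f by move=> u uK; apply: h; rewrite inE uK orbT.
have updE b : c v = b -> upd (restr K c) v b = restr (v :: K) c.
  move=> cb; apply/funext => u; rewrite /upd /restr inE.
  by case: eqP => //= ->.
have := h v (mem_head _ _); case cv: (c v) => ->.
  by rewrite scale1r subrr (lin0 (lin_op _ _)) addr0 ih// updE.
by rewrite scale0r subr0 (lin0 (lin_op _ _)) add0r ih// updE.
Qed.

Lemma zop_upd K c v b f : v \notin K -> zop K (upd c v b) f = zop K c f.
Proof.
elim: K => //= u K ih; rewrite inE negb_or => /andP[vu vK].
by rewrite ih// /upd eq_sym (negbTE vu).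
Qed.

Lemma zop_sum K f : uniq K -> \sum_(c <- cfgs K) zop K c f = f.
Proof.
elim: K => [|v K ih /= /andP[vK uK]]; first by rewrite big_seq1.
rewrite big_cat /= !big_map -big_split -[RHS]ih//; apply: eq_bigr => c _ /=.
by rewrite /upd eqxx -/(upd _ _ _) -/(upd _ _ _) !zop_upd// addrC subrK.
Qed.

Lemma zop_sqn K f : uniq K -> \sum_(c <- cfgs K) sqn (zop K c f) = sqn f.
Proof.
elim: K => [|v K ih /= /andP[vK uK]]; first by rewrite big_seq1.
rewrite big_cat /= !big_map -big_split -[RHS]ih//; apply: eq_bigr => c _ /=.
rewrite /upd eqxx -/(upd _ _ _) -/(upd _ _ _) !zop_upd//.
by rewrite sqnB (dotC _ (e v _)) e_sym [sqn (e _ _)]e_sym e_idem -/(sqn _); ring.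
Qed.

(** Decompose f into joint eigenvectors for [K']; on each of them [op K F] is a scalar. Allowing
    [K'] larger than [K] is what makes operators over different lists of sites comparable. *)
Lemma op_sum K K' F f : uniq K' -> {subset K <= K'} ->
  op K F f = \sum_(c <- cfgs K') F (restr K c) *: zop K' c f.
Proof.
move=> uK' KK'; rewrite -{1}(zop_sum f uK') (lin_sum (lin_op K F)).
by apply: eq_bigr => c _; apply: op_eigen => v /KK'; exact: zop_eigen.
Qed.

Lemma dot_zop K c f g : dot (zop K c f) (zop K c g) = dot (zop K c f) g.
Proof. by rewrite -zop_sym eigen_zop//; exact: zop_eigen. Qed.

Lemma comm_op (A : l2 R I -> l2 R I) K F f : lin A -> (forall v g, A (e v g) = e v (A g)) ->
  A (op K F f) = op K F (A f).
Proof.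
move=> lA cA; elim: K F f => [|v K ih] F f /=; first by rewrite (linZ lA).
by rewrite (linD lA) !ih (linB lA) cA.
Qed.

Lemma comm_zop (A : l2 R I -> l2 R I) K c f : lin A -> (forall v g, A (e v g) = e v (A g)) ->
  A (zop K c f) = zop K c (A f).
Proof.
move=> lA cA; elim: K => //= v K ih; case: ifP => _; first by rewrite cA ih.
by rewrite (linB lA) cA ih.
Qed.

Lemma op_sym K F f g : uniq K -> dot (op K F f) g = dot f (op K F g).
Proof.
move=> uK; rewrite !(op_sum F _ uK (fun _ h => h)) dot_suml dot_sumr.
by apply: eq_bigr => c _; rewrite dotZl dotZr zop_sym.
Qed.

End Spectral.

Section RightAction.
Variables (R : realType) (G : groupType).

Definition ract (g : G) : l2 R G -> l2 R G := pull (@mulIg G g^-1%g).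

Lemma ractE g f x : ract g f x = f (x * g^-1)%g. Proof. by []. Qed.
Lemma lin_ract g : lin (ract g). Proof. exact: lin_pull. Qed.
Lemma sqn_ract g f : sqn (ract g f) = sqn f.
Proof. by apply: (@sqn_pull _ _ _ _ _ (fun x => x * g)%g) => x; rewrite mulgK. Qed.
Lemma ractM g h f : ract (g * h)%g f = ract h (ract g f).
Proof. by apply: l2P => x; rewrite !ractE invgM mulgA. Qed.
Lemma ract_lact (g h : G) (f : l2 R G) : ract g (lact h f) = lact h (ract g f).
Proof. by apply: l2P => x; rewrite [LHS]ractE [LHS]lactE [RHS]lactE [RHS]ractE mulgA. Qed.
Lemma ract_delta g : ract g (delta R 1%g) = delta R g.
Proof.
apply: l2P => y; rewrite ractE !deltaE; congr ((nat_of_bool _)%:R).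
by apply/eqP/eqP => [yg|->]; rewrite ?mulgV// -(mul1g g) -yg mulgVK.
Qed.
Lemma dot_lactV (g : G) (f h : l2 R G) : dot (lact g f) h = dot f (lact g^-1%g h).
Proof. by rewrite -(dot_lact g f) -lactM mulgV lact1. Qed.
End RightAction.

(* [lamp v] is the generator of the copy of Z/n at the site [v], and [ell w v]
   the lamp coordinate of [w] there; sites (tau, g) and (tau, g h) with [h] in
   [lsub tau] carry the same lamp. *)
Record lamp_group (B W G : groupType) := LampGroup {
  lphi : B -> W;
  lpi : W -> G;
  lcard : nat;
  lsub : bool -> seq G;
  lamp : bool * G -> B;
  ell : W -> bool * G -> 'Z_lcard;
  lphiM : {morph lphi : x y / (x * y)%g};
  lpiM : {morph lpi : x y / (x * y)%g};
  lpi_surj : forall g, exists b, lpi (lphi b) = g;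
  lcard_gt1 : (1 < lcard)%N;
  lamp_conj : forall b v, (lphi b * lphi (lamp v) =
    lphi (lamp (v.1, lpi (lphi b) * v.2)) * lphi b)%g;
  lamp_comm : forall u v, (lphi (lamp u) * lphi (lamp v) = lphi (lamp v) * lphi (lamp u))%g;
  lamp_exp : forall v, (lphi (lamp v) ^+ lcard = 1)%g;
  lamp_pi : forall v, lpi (lphi (lamp v)) = 1%g;
  ell1 : forall v, ell 1%g v = 0;
  ell_lamp : forall u w v, ell (lphi (lamp u) * w)%g v =
    ell w v + ((u.1 == v.1) && (u.2^-1 * v.2 \in lsub u.1)%g)%:R;
  lsub1 : forall t, 1%g \in lsub t;
  lsubV : forall t h, h \in lsub t -> (h^-1)%g \in lsub t;
  lsubM : forall t h k, h \in lsub t -> k \in lsub t -> (h * k)%g \in lsub t;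
  lsub_conj : forall u u' h h', h \in lsub false -> h' \in lsub true ->
    (u * h * u^-1 = u' * h' * u'^-1)%g -> h = 1%g
}.

Section Lamps.
Variables (R : realType) (B W G : groupType) (L : lamp_group B W G).
Local Notation n := (lcard L).
Local Notation phi := (lphi L).
Local Notation pi := (lpi L).
Local Notation site := (bool * G)%type.
Local Notation H2 := (l2 R W).

Lemma phi1 : phi 1%g = 1%g.
Proof. by apply: (mulgI (phi 1%g)); rewrite -lphiM !mulg1. Qed.
Lemma phiV b : phi b^-1%g = (phi b)^-1%g.
Proof. by apply: (mulIg (phi b)); rewrite -lphiM !mulVg phi1. Qed.
Lemma pi1 : pi 1%g = 1%g.
Proof. by apply: (mulgI (pi 1%g)); rewrite -lpiM !mulg1. Qed.
Lemma piV w : pi w^-1%g = (pi w)^-1%g.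
Proof. by apply: (mulIg (pi w)); rewrite -lpiM !mulVg pi1. Qed.

Definition lampw (v : site) : W := phi (lamp L v).

Lemma lampw_exp_conj b v i :
  (phi b * lampw v ^+ i = lampw (v.1, pi (phi b) * v.2) ^+ i * phi b)%g.
Proof.
elim: i => [|i ih]; first by rewrite !expg0 mulg1 mul1g.
by rewrite expgS mulgA lamp_conj -mulgA ih mulgA -expgS.
Qed.

Lemma lampw_exp_comm u v i j :
  (lampw u ^+ i * lampw v ^+ j = lampw v ^+ j * lampw u ^+ i)%g.
Proof. by apply: commuteX2; exact: lamp_comm. Qed.

Lemma pi_lampw v i : pi (lampw v ^+ i)%g = 1%g.
Proof.
elim: i => [|i ih]; first by rewrite expg0 pi1.
by rewrite expgS lpiM ih lamp_pi mulg1.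
Qed.

Definition same (u v : site) := (u.1 == v.1) && (u.2^-1 * v.2 \in lsub L u.1)%g.

Lemma same_refl u : same u u.
Proof. by rewrite /same eqxx mulVg lsub1. Qed.
Lemma same_sym u v : same u v = same v u.
Proof.
suff imp u' v' : same u' v' -> same v' u' by apply/idP/idP; exact: imp.
rewrite /same => /andP[/eqP <-] /lsubV; rewrite invgM invgK => ->.
by rewrite eqxx.
Qed.

Lemma ell_lampX u w v i : ell L (lampw u ^+ i * w)%g v = ell L w v + (same u v)%:R *+ i.
Proof.
elim: i => [|i ih]; first by rewrite expg0 mul1g mulr0n addr0.
by rewrite expgS -mulgA ell_lamp ih -addrA -mulrSr.
Qed.

(** The projection onto the vectors fixed by the copy of Z/n at [v]. The random variable of the
    percolation is its spectral value, equal to 1 with probability 1/n, and not the lamp coordinate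
    [ell]. *)
Definition lamp_proj v (f : H2) : H2 := n%:R^-1 *: \sum_(i < n) lact (lampw v ^+ i)%g f.

Let n0 : n%:R != 0 :> R.
Proof. by rewrite pnatr_eq0 -lt0n (ltn_trans _ (lcard_gt1 L)). Qed.

Lemma lin_lamp_proj v : lin (lamp_proj v).
Proof. by apply: linZZ; apply: linSS => i; exact: lin_lact. Qed.

Lemma lact_lamp_proj v i f : lact (lampw v ^+ i)%g (lamp_proj v f) = lamp_proj v f.
Proof.
elim: i => [|i ih]; first by rewrite expg0 lact1.
rewrite expgS lactM ih /lamp_proj (linZ (lin_lact _)) (lin_sum (lin_lact _)); congr (_ *: _).
have := lcard_gt1 L; case: n (lamp_exp L v) => // m xm _.
rewrite big_ord_recr [RHS]big_ord_recl /= -lactM expg0 -expgS xm addrC; congr (_ + _).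
by apply: eq_bigr => j _; rewrite -lactM -expgS.
Qed.

Lemma lamp_proj_idem v f : lamp_proj v (lamp_proj v f) = lamp_proj v f.
Proof.
rewrite {1}/lamp_proj (eq_bigr (fun=> lamp_proj v f)) => [|i _]; last exact: lact_lamp_proj.
by rewrite sumr_const card_ord -[X in _ *: X]scaler_nat scalerA mulVf ?scale1r.
Qed.

Lemma lamp_proj_sym v f g : dot (lamp_proj v f) g = dot f (lamp_proj v g).
Proof.
suff h f' g' : dot (lamp_proj v f') g' = dot (lamp_proj v f') (lamp_proj v g') by rewrite h dotC -h dotC.
rewrite -[lamp_proj v g']/(n%:R^-1 *: \sum_(i < n) lact (lampw v ^+ i)%g g') dotZr dot_sumr.
rewrite (eq_bigr (fun=> dot (lamp_proj v f') g')) => [|i _]; last by rewrite -{1}(lact_lamp_proj v i f') dot_lact.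
by rewrite sumr_const card_ord -[X in _ * X]mulr_natl mulrA mulVf ?mul1r.
Qed.

Lemma lamp_proj_comm u v f : lamp_proj u (lamp_proj v f) = lamp_proj v (lamp_proj u f).
Proof.
rewrite -[lamp_proj v f]/(n%:R^-1 *: \sum_(i < n) lact (lampw v ^+ i)%g f).
rewrite (linZ (lin_lamp_proj u)) (lin_sum (lin_lamp_proj u)); congr (_ *: _).
apply: eq_bigr => i _; rewrite /lamp_proj (linZ (lin_lact _)) (lin_sum (lin_lact _)).
by congr (_ *: _); apply: eq_bigr => j _; rewrite -!lactM lampw_exp_comm.
Qed.

Lemma lact_phi_lamp_proj b v f :
  lact (phi b) (lamp_proj v f) = lamp_proj (v.1, pi (phi b) * v.2)%g (lact (phi b) f).
Proof.
rewrite /lamp_proj (linZ (lin_lact _)) (lin_sum (lin_lact _)); congr (_ *: _).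
by apply: eq_bigr => i _; rewrite -!lactM lampw_exp_conj.
Qed.

Lemma ract_lamp_proj r v f : ract r (lamp_proj v f) = lamp_proj v (ract r f).
Proof.
rewrite /lamp_proj (linZ (lin_ract _)) (lin_sum (lin_ract _)); congr (_ *: _).
by apply: eq_bigr => i _; rewrite ract_lact.
Qed.

Definition fibre (g : G) : H2 -> H2 := mask (fun w => pi w == g).

Lemma lin_fibre g : lin (fibre g). Proof. exact: lin_mask. Qed.

Lemma lact_fibre w g f : lact w (fibre g f) = fibre (pi w * g)%g (lact w f).
Proof.
apply: l2P => x; rewrite lactE !maskE lactE lpiM piV.
by rewrite -[_ == g](inj_eq (mulgI (pi w))) mulVKg.
Qed.

Lemma ract_fibre r g f : ract r (fibre g f) = fibre (g * pi r)%g (ract r f).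
Proof.
apply: l2P => x; rewrite ractE !maskE ractE lpiM piV.
by rewrite -[_ == g](inj_eq (mulIg (pi r))) mulgVK.
Qed.

Lemma fibre_lamp_proj g v f : fibre g (lamp_proj v f) = lamp_proj v (fibre g f).
Proof.
rewrite /lamp_proj (linZ (lin_fibre _)) (lin_sum (lin_fibre _)); congr (_ *: _).
by apply: eq_bigr => i _; rewrite lact_fibre pi_lampw mul1g.
Qed.

Lemma fibre_fibre g h f : fibre g (fibre h f) = if g == h then fibre h f else 0.
Proof.
apply: l2P => x; rewrite !maskE; case: (eqVneq g h) => [->|gh].
  by rewrite maskE; case: (pi x == h).
by case: eqP => // xg; rewrite xg (negbTE gh).
Qed.

Lemma fibre_delta w : fibre (pi w) (delta R w) = delta R w.
Proof.
apply: l2P => x; rewrite maskE deltaE; case: (eqVneq x w) => [->|]; first by rewrite eqxx.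
by rewrite if_same.
Qed.

Local Notation d1 := (delta R (1 : W)%g).

Lemma lamp_trace (S : seq site) : pairwise (fun u v => ~~ same u v) S ->
  foldr lamp_proj d1 S 1%g = (n%:R ^+ size S)^-1.
Proof.
have supp (S' : seq site) w : foldr lamp_proj d1 S' w != 0 ->
    forall v, all (fun u => ~~ same u v) S' -> ell L w v = 0.
  elim: S' w => [|u S' ih] w.
    rewrite deltaE.
    by have [->|_] := eqVneq w 1%g; rewrite ?eqxx// => _ v _; rewrite ell1.
  rewrite -[foldr lamp_proj d1 (u :: S')]/(lamp_proj u (foldr lamp_proj d1 S')) l2Z l2_sum mulf_eq0 invr_eq0 (negbTE n0) /= => nz v /andP[uv Sv].
  have [i hi] : exists i : 'I_n, lact (lampw u ^+ i)%g (foldr lamp_proj d1 S') w != 0.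
    apply: contrapT => /forallNP h; move/negP: nz; apply; apply/eqP/big1 => i _.
    by apply/eqP/negPn/negP; exact: h.
  rewrite lactE in hi; have := ih _ hi v Sv.
  rewrite -{2}(mulVKg (lampw u ^+ i)%g w) ell_lampX (negbTE uv) mul0rn addr0 //.
elim: S => [_|u S ih]; first by rewrite deltaE eqxx expr0 invr1.
rewrite -[foldr lamp_proj d1 (u :: S)]/(lamp_proj u (foldr lamp_proj d1 S)) => /andP[uS pS]; rewrite l2Z l2_sum.
have n_gt0 : (0 < n)%N by rewrite (ltn_trans _ (lcard_gt1 L)).
rewrite (bigD1 (Ordinal n_gt0)) //.
rewrite -[lact (lampw u ^+ Ordinal n_gt0)%g _]/(lact (lampw u ^+ 0)%g _).
rewrite expg0 lact1 ih// big1.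
  by rewrite [_ (_ ^- _) 0]addr0 /= exprS invfM.
move=> i; rewrite andTb => i0; rewrite lactE mulg1; apply/eqP/negPn/negP => nz.
have : ell L (lampw u ^+ i)^-1%g u = 0.
  by apply: (supp _ _ nz u); apply: sub_all uS => v; rewrite same_sym.
move=> e0; have := ell_lampX u (lampw u ^+ i)^-1%g u i.
rewrite mulgV ell1 e0 same_refl add0r => /esym/eqP.
rewrite -(inj_eq val_inj) /= -[(1 *+ i)%R]/(i%:R : 'Z_n) val_Zp_nat ?lcard_gt1//.
rewrite modn_small// => /eqP i0'; move/eqP: i0; apply.
exact: val_inj.
Qed.

End Lamps.

(** * The group algebra and its trace *)

Section GroupAlgebra.
Variables (R : realType) (B W : groupType) (phi : B -> W).
Hypothesis phiM : {morph phi : x y / (x * y)%g}.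
Local Notation H2 := (l2 R W).

Definition alg_op (l : seq (R * B)) (f : H2) : H2 :=
  \sum_(x <- l) x.1 *: lact (phi x.2) f.

(** Operators in the image of the group algebra of [B], each paired with its adjoint: same
    coefficients, inverse group elements. *)
Definition alg (A A' : H2 -> H2) := exists l : seq (R * B),
  A =1 alg_op l /\ A' =1 alg_op [seq (x.1, x.2^-1%g) | x <- l].

Let phiV b : phi b^-1%g = (phi b)^-1%g.
Proof.
have p1 : phi 1%g = 1%g by apply: (mulgI (phi 1%g)); rewrite -phiM !mulg1.
by apply: (mulIg (phi b)); rewrite -phiM !mulVg p1.
Qed.

Lemma alg_lact b : alg (lact (phi b)) (lact (phi b)^-1%g).
Proof.
exists [:: (1, b)]; split=> f; rewrite /alg_op big_seq1 scale1r//=.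
by rewrite phiV.
Qed.

Lemma alg_zero : alg (fun=> 0) (fun=> 0).
Proof. by exists [::]; split=> f; rewrite /alg_op big_nil. Qed.

Lemma alg_add A A' C C' : alg A A' -> alg C C' ->
  alg (fun f => A f + C f) (fun f => A' f + C' f).
Proof.
move=> [l [Al A'l]] [m [Cm C'm]]; exists (l ++ m).
by split=> f; rewrite /alg_op ?map_cat big_cat/= ?Al ?A'l ?Cm ?C'm.
Qed.

Lemma alg_scale a A A' : alg A A' -> alg (fun f => a *: A f) (fun f => a *: A' f).
Proof.
move=> [l [Al A'l]]; exists [seq (a * x.1, x.2) | x <- l].
split=> f; rewrite ?Al ?A'l /alg_op ?big_map scaler_sumr;
  by apply: eq_bigr => x _; rewrite scalerA.
Qed.

Lemma alg_sum T (r : seq T) (A A' : T -> H2 -> H2) : (forall t, alg (A t) (A' t)) ->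
  alg (fun f => \sum_(t <- r) A t f) (fun f => \sum_(t <- r) A' t f).
Proof.
move=> h; elim: r => [|t r ih].
  have [l [h1 h2]] := alg_zero; exists l.
  by split=> f; rewrite big_nil -?h1 -?h2.
have [l [h1 h2]] := alg_add (h t) ih; exists l.
by split=> f; rewrite big_cons -?h1 -?h2.
Qed.

Lemma alg_comp A A' C C' : alg A A' -> alg C C' ->
  alg (fun f => A (C f)) (fun f => C' (A' f)).
Proof.
move=> [l [Al A'l]] [m [Cm C'm]].
exists [seq (x.1 * y.1, (x.2 * y.2)%g) | x <- l, y <- m]; split=> f.
  rewrite Al Cm /alg_op big_allpairs_dep; apply: eq_bigr => x _.
  rewrite (lin_sum (lin_lact _)) scaler_sumr; apply: eq_bigr => y _ /=.
  by rewrite (linZ (lin_lact _)) scalerA phiM lactM.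
rewrite A'l C'm /alg_op map_allpairs big_allpairs_dep !big_map exchange_big.
apply: eq_bigr => y _; rewrite (lin_sum (lin_lact _)) scaler_sumr.
apply: eq_bigr => x _ /=; rewrite (linZ (lin_lact _)) scalerA invgM phiM lactM.
by rewrite [y.1 * _]mulrC.
Qed.

Lemma alg_id : alg id id.
Proof.
have [l [h1 h2]] := alg_lact 1%g; exists l.
have p1 : phi 1%g = 1%g by apply: (mulgI (phi 1%g)); rewrite -phiM !mulg1.
by split=> f; [rewrite -h1|rewrite -h2]; rewrite p1 ?invg1 lact1.
Qed.

Lemma alg_sym A A' : alg A A' -> forall f g, dot (A f) g = dot f (A' g).
Proof.
move=> [l [Al A'l]] f g; rewrite Al A'l /alg_op dot_suml dot_sumr big_map.
by apply: eq_bigr => x _; rewrite dotZl dotZr dot_lactV phiV.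
Qed.

Lemma alg_commute A A' (E : H2 -> H2) : alg A A' -> lin E ->
  (forall b f, E (lact (phi b) f) = lact (phi b) (E f)) ->
  forall f, E (A f) = A (E f).
Proof.
move=> [l [Al _]] lE hE f; rewrite !Al /alg_op (lin_sum lE).
by apply: eq_bigr => x _; rewrite (linZ lE) hE.
Qed.

(** The trace property tau (A' A) = tau (A A') for the vector state tau at the point mass at 1. *)
Lemma alg_tracial A A' : alg A A' ->
  sqn (A (delta R 1%g)) = sqn (A' (delta R 1%g)).
Proof.
move=> [l [-> ->]]; rewrite /sqn /alg_op !dot_suml big_map; apply: eq_bigr => x _.
rewrite !dot_sumr big_map; apply: eq_bigr => y _ /=.
rewrite !dotZl !dotZr !lact_delta !mulg1 !dot_delta !deltaE !phiV.
by rewrite (inj_eq invg_inj).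
Qed.

End GroupAlgebra.

Lemma is_cycle_ext (V : eqType) (X : finType) (letter_bar : X -> X) (letter_step : V -> X -> V)
    (F F' : V -> X -> bool) v w :
  along letter_step F v w = along letter_step F' v w ->
  is_cycle letter_bar letter_step F v w -> is_cycle letter_bar letter_step F' v w.
Proof. by move=> e [h1 h2 h3 h4 h5]; split=> //; rewrite -e. Qed.

Lemma along_sub (V : eqType) (X : finType) (letter_step : V -> X -> V)
    (F F' : V -> X -> bool) v w : (forall v x, F v x -> F' v x) ->
  along letter_step F v w -> along letter_step F' v w.
Proof. by move=> h; elim: w v => //= x w ih v /andP[/h -> /ih]. Qed.

(** * The percolation and the hopping operators *)

Section Percolation.
Variables (B W G : groupType) (L : lamp_group B W G).
Variables (I : finType) (s : I -> G) (u : nat -> G) (t M : nat) (A : I -> seq nat).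
Local Notation site := (bool * G)%type.
Local Notation X := (I * bool)%type.
Implicit Types (c : site -> bool) (v g : G) (x : X) (w : seq X).

Definition letter_bar x : X := (x.1, ~~ x.2).
Definition sx x : G := if x.2 then (s x.1)^-1%g else s x.1.
Definition letter_step v x : G := (v * sx x)%g.

Lemma barK : involutive letter_bar. Proof. by case=> i b; rewrite /letter_bar /= negbK. Qed.
Lemma sx_bar x : sx (letter_bar x) = (sx x)^-1%g.
Proof. by case: x => i [] //=; rewrite /sx /= invgK. Qed.
Lemma stepK v x : letter_step (letter_step v x) (letter_bar x) = v.
Proof. by rewrite /letter_step sx_bar mulgK. Qed.

Definition shift v c : site -> bool := fun z => c (z.1, v * z.2)%g.

Lemma shiftM v g c : shift v (shift g c) = shift (g * v)%g c.
Proof. by apply/funext => -[b z]; rewrite /shift /= mulgA. Qed.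
Lemma shift1 c : shift 1%g c = c.
Proof. by apply/funext => -[b z]; rewrite /shift /= mul1g. Qed.

Definition hall : seq G := lsub L false ++ lsub L true.

(* The nontrivial translations whose window [u 0, ..., u M.-1] may meet the window
   at 1. *)
Definition overlap : seq G :=
  [seq g <- [seq (u p.1.1 * p.2 * (u p.1.2)^-1)%g |
     p <- [seq (q, h) | q <- [seq (j, i) | j <- iota 0 M, i <- iota 0 M], h <- hall]] | g != 1%g].

Definition marked c := all (fun j => c (false, u j) && c (true, u j)) (iota 0 t).
(** Two isolated vertices never differ by an element of [overlap], so no lamp is common to their
    windows. *)
Definition isolated c := marked c && all (fun g => ~~ marked (shift g c)) overlap.
Definition tail_on i c := all (fun j => c (false, u j)) (A i).
(** The rule for an edge leaving 1 along a positive letter; reversed edges and other vertices follow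
    by translation. The tail is read at the origin of the positive letter, in the [false] family
    alone. *)
Definition open_pos i c := [&& s i != 1%g, isolated c, isolated (shift (s i) c) & tail_on i c].
Definition open_letter x c := if x.2 then open_pos x.1 (shift (s x.1)^-1%g c) else open_pos x.1 c.
Definition open_edge c v x := open_letter x (shift v c).

Lemma open_edge_bar c v x : open_edge c (letter_step v x) (letter_bar x) = open_edge c v x.
Proof.
rewrite /open_edge /open_letter /letter_step /letter_bar /sx; case: x => i [] /=; first by rewrite shiftM.
by rewrite shiftM mulgK.
Qed.

Lemma open_edge_noloop c v x : open_edge c v x -> letter_step v x != v.
Proof.
have ne : s x.1 != 1%g -> letter_step v x != v.
  rewrite /letter_step /sx -{2}[v]mulg1 (inj_eq (mulgI v)).
  case: x.2 => // h; apply: contra h => /eqP h; apply/eqP; by apply: invg_inj; rewrite h invg1.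
by rewrite /open_edge /open_letter; case: x.2 => /and4P[/ne h _ _ _]; exact: h.
Qed.

Definition short_cycle n c v x := `[< exists w, (size w < n)%N /\
  is_cycle letter_bar letter_step (open_edge c) v (x :: w) >].

(* The edges that remain when those on an open cycle of length at most [n] are
   deleted. *)
Definition tree_edge n c v x := [&& open_edge c v x, ~~ short_cycle n c v x & ~~ short_cycle n c (letter_step v x) (letter_bar x)].

Lemma tree_edge_bar n c v x : tree_edge n c (letter_step v x) (letter_bar x) = tree_edge n c v x.
Proof. by rewrite /tree_edge open_edge_bar stepK barK [X in _ && X]andbC. Qed.

Lemma tree_edge_open n c v x : tree_edge n c v x -> open_edge c v x. Proof. by case/and3P. Qed.

(** A cycle inside [Lam] has at most [size Lam] edges. All of them being open, its first edge lies
    on a short open cycle and was deleted. *)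
Lemma tree_edge_acyclic n c v w (Lam : seq G) : (size Lam <= n)%N ->
  is_cycle letter_bar letter_step (tree_edge n c) v w -> ~~ all [in Lam] (trace letter_step v w).
Proof.
move=> Ln [h1 h2 h3 h4 h5]; apply/negP => /allP aL.
have sw : (size w <= size Lam)%N by rewrite -(size_trace letter_step v); apply: uniq_leq_size.
case: w h1 h2 h3 h4 h5 aL sw => // x w h1 h2 h3 /[dup] h4 /= /andP[Fx _] h5 aL sw.
have /and3P[_ /asboolPn + _] := Fx; apply; exists w; split.
  by apply: leq_trans Ln; exact: sw.
by split=> //; apply: along_sub h4 => v' x'; exact: tree_edge_open.
Qed.

Lemma along_shift g c v w :
  along letter_step (open_edge (shift g c)) v w = along letter_step (open_edge c) (g * v)%g w.
Proof.
elim: w v => //= x w ih v; rewrite ih /open_edge shiftM; congr (_ && along _ _ _ _).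
by rewrite /letter_step mulgA.
Qed.

Lemma trace_shift g v w : trace letter_step (g * v)%g w = [seq (g * z)%g | z <- trace letter_step v w].
Proof. by elim: w v => //= x w ih v; rewrite -ih /letter_step mulgA. Qed.

Lemma foldl_step v w : foldl letter_step v w = (v * wprod sx w)%g.
Proof. by elim: w v => /= [|x w ih] v; rewrite ?mulg1// ih /letter_step mulgA. Qed.

Lemma is_cycle_shift g c v w :
  is_cycle letter_bar letter_step (open_edge (shift g c)) v w <-> is_cycle letter_bar letter_step (open_edge c) (g * v)%g w.
Proof.
rewrite /is_cycle along_shift trace_shift !foldl_step map_inj_uniq; last exact: mulgI.
split=> -[h1 h2 h3 h4 h5]; split=> //; first by rewrite -mulgA h2.
by apply: (mulgI g); rewrite mulgA.
Qed.

Lemma short_cycle_shift n g c v x : short_cycle n (shift g c) v x = short_cycle n c (g * v)%g x.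
Proof.
apply: asbool_equiv_eq; split=> -[w [wn h]]; exists w; split=> //.
  exact/is_cycle_shift.
exact/(is_cycle_shift g c v).
Qed.

Lemma tree_edge_shift n g c v x : tree_edge n (shift g c) v x = tree_edge n c (g * v)%g x.
Proof. by rewrite /tree_edge !short_cycle_shift /open_edge shiftM /letter_step mulgA. Qed.

(** The sites that can influence [open_letter] at 1: the window places seen from 1, from its
    neighbours, and from their translates by [overlap]. *)
Definition base_sites : seq G :=
  [seq (p.1 * p.2)%g | p <- [seq (q, j) | q <-
     [seq (p.1 * p.2)%g | p <- [seq (q, g) | q <- 1%g :: [seq sx x | x <- enum {: X}],
        g <- 1%g :: overlap]], j <- [seq u j | j <- iota 0 M]]].

Lemma base_sitesP q g j : q \in 1%g :: [seq sx x | x <- enum {: X}] ->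
  g \in 1%g :: overlap -> (j < M)%N -> (q * g * u j)%g \in base_sites.
Proof.
move=> hq hg jM; rewrite /base_sites; apply/mapP; exists ((q * g)%g, u j) => //.
apply/allpairsP; exists ((q * g)%g, u j); split=> //; last by apply: map_f; rewrite mem_iota.
by apply/mapP; exists (q, g) => //; apply/allpairsP; exists (q, g).
Qed.

Hypothesis tM : (t <= M)%N.
Hypothesis AM : forall i j, j \in A i -> (j < M)%N.

Lemma mem_sx x : sx x \in 1%g :: [seq sx x | x <- enum {: X}].
Proof. by rewrite inE map_f ?orbT// mem_enum. Qed.

Lemma marked_local c c' : (forall j b, (j < t)%N -> c (b, u j) = c' (b, u j)) ->
  marked c = marked c'.
Proof.
move=> h; apply: eq_in_all => j; rewrite mem_iota /= => jt.
by rewrite !h.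
Qed.

Lemma isolated_local c c' : (forall g j b, g \in 1%g :: overlap -> (j < M)%N ->
  c (b, g * u j)%g = c' (b, g * u j)%g) -> isolated c = isolated c'.
Proof.
move=> h; rewrite /isolated (@marked_local c c') => [|j b jt]; last first.
  by have := h 1%g j b (mem_head _ _) (leq_trans jt tM); rewrite mul1g.
congr (_ && _); apply: eq_in_all => g gN; congr (~~ _); apply: marked_local => j b jt.
by apply: h; [rewrite inE gN orbT|exact: leq_trans jt tM].
Qed.

Lemma open_letter_local c c' x : (forall z b, z \in base_sites -> c (b, z) = c' (b, z)) ->
  open_letter x c = open_letter x c'.
Proof.
move=> h; have h' q g j b : q \in 1%g :: [seq sx x | x <- enum {: X}] ->
    g \in 1%g :: overlap -> (j < M)%N -> c (b, q * g * u j)%g = c' (b, q * g * u j)%g.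
  by move=> hq hg jM; apply: h; exact: base_sitesP.
have yq q : q \in 1%g :: [seq sx x | x <- enum {: X}] ->
    isolated (shift q c) = isolated (shift q c').
  move=> hq; apply: isolated_local => g j b hg jM; rewrite /shift /= !mulgA; exact: h'.
have tq q i : q \in 1%g :: [seq sx x | x <- enum {: X}] ->
    tail_on i (shift q c) = tail_on i (shift q c').
  move=> hq; apply: eq_in_all => j /AM jM; rewrite /shift /=.
  by have := h' q 1%g j false hq (mem_head _ _) jM; rewrite !mulg1.
have m1 : 1%g \in 1%g :: [seq sx x | x <- enum {: X}] := mem_head _ _.
have y1 := yq _ m1; rewrite !shift1 in y1.
have t1 i := tq _ i m1; rewrite !shift1 in t1.
rewrite /open_letter /open_pos; case: x => i [] /=.
  have mi := mem_sx (i, true); rewrite /sx /= in mi.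
  by rewrite !shiftM mulVg !shift1 (yq _ mi) (tq _ _ mi) y1.
have mi := mem_sx (i, false); rewrite /sx /= in mi.
by rewrite (yq _ mi) y1 t1.
Qed.

Definition agree_near c c' v m := forall w z b, (size w <= m)%N -> z \in base_sites ->
  c (b, v * wprod sx w * z)%g = c' (b, v * wprod sx w * z)%g.

Lemma agree_nearW c c' v m m' : (m' <= m)%N -> agree_near c c' v m -> agree_near c c' v m'.
Proof. by move=> mm h w z b wm; apply: h; exact: leq_trans wm mm. Qed.

Lemma agree_near_step c c' v m x : agree_near c c' v m.+1 -> agree_near c c' (letter_step v x) m.
Proof.
move=> h w z b wm zB; have := h (x :: w) z b wm zB.
by rewrite /= /letter_step !mulgA.
Qed.

Lemma open_edge_local c c' v m x : agree_near c c' v m -> open_edge c v x = open_edge c' v x.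
Proof.
move=> h; apply: open_letter_local => z b zB; rewrite /shift /=.
by have := h [::] z b isT zB; rewrite /= mulg1.
Qed.

Lemma along_local c c' v m w : agree_near c c' v m -> (size w <= m.+1)%N ->
  along letter_step (open_edge c) v w = along letter_step (open_edge c') v w.
Proof.
elim: w v m => //= x w ih v m h; rewrite ltnS => wm.
rewrite (open_edge_local _ h); congr (_ && _).
case: m h wm => [|m] h wm; first by case: w {ih} wm.
by apply: ih wm; exact: agree_near_step.
Qed.

Lemma short_cycle_local n c c' v x : agree_near c c' v n -> short_cycle n c v x = short_cycle n c' v x.
Proof.
move=> h; apply: asbool_equiv_eq; split=> -[w [wn hc]]; exists w; split=> //;
  move: hc; apply: is_cycle_ext; [|apply/esym]; apply: along_local h _;
  by rewrite /= ltnS ltnW.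
Qed.

(** Cycles of at most n edges starting at v are decided within n steps of v; those through the
    reversed edge start one step further, hence [n.+1]. *)
Lemma tree_edge_local n c c' v x : agree_near c c' v n.+1 -> tree_edge n c v x = tree_edge n c' v x.
Proof.
move=> h; rewrite /tree_edge (open_edge_local _ h) (short_cycle_local _ (agree_nearW (leqnSn n) h)).
by rewrite (short_cycle_local _ (agree_near_step _ h)).
Qed.

Definition near_sites (Lam : seq G) n : seq site :=
  undup [seq (p.2, (p.1.1 * p.1.2)%g) | p <- [seq (q, b) | q <- [seq (v, z) | v <- Lam,
     z <- [seq (wprod sx p.1 * p.2)%g | p <- [seq (w, z) | w <- flatten [seq words X m | m <- iota 0 n.+2],
        z <- base_sites]]], b <- [:: true; false]]].

Lemma near_sitesP Lam n v w z b : v \in Lam -> (size w <= n.+1)%N -> z \in base_sites ->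
  (b, v * wprod sx w * z)%g \in near_sites Lam n.
Proof.
move=> vL wn zB; rewrite mem_undup; apply/mapP.
exists ((v, (wprod sx w * z)%g), b); last by rewrite /= mulgA.
apply/allpairsP; exists ((v, (wprod sx w * z)%g), b); split=> //; last by case: b.
apply/allpairsP; exists (v, (wprod sx w * z)%g); split=> //.
apply/mapP; exists (w, z) => //; apply/allpairsP; exists (w, z); split=> //.
apply/flattenP; exists (words X (size w)); last by rewrite mem_words.
by apply: map_f; rewrite mem_iota.
Qed.

Lemma agree_near_restr Lam n c v : v \in Lam ->
  agree_near (restr (near_sites Lam n) c) c v n.+1.
Proof. by move=> vL w z b wn zB; rewrite /restr near_sitesP. Qed.

(* A cycle contained in [Lam] has length at most the size of [Lam]. *)
Definition cycle_cutoff (Lam : {fset G}) := (size Lam).+2.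
Definition sites_of (Lam : {fset G}) := near_sites Lam (cycle_cutoff Lam).

Lemma orientation_exists (Lam : {fset G}) c : exists orient : G -> option X,
    (forall v x, orient v = Some x -> [/\ v \in Lam, letter_step v x \in Lam & tree_edge (cycle_cutoff Lam) c v x]) /\
    (forall v x, v \in Lam -> letter_step v x \in Lam -> tree_edge (cycle_cutoff Lam) c v x ->
      (orient v == Some x) (+) (orient (letter_step v x) == Some (letter_bar x))).
Proof.
apply: (@orientation _ _ letter_bar letter_step barK stepK (tree_edge (cycle_cutoff Lam) c)).
- by move=> v x; exact: tree_edge_bar.
- by move=> v x /tree_edge_open; exact: open_edge_noloop.
- exact: fset_uniq.
- by move=> v w; apply: tree_edge_acyclic; rewrite /cycle_cutoff ltnW.
Qed.

Definition orient (Lam : {fset G}) c : G -> option X := projT1 (cid (orientation_exists Lam c)).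

Lemma orientP Lam c v x : orient Lam c v = Some x ->
  [/\ v \in Lam, letter_step v x \in Lam & tree_edge (cycle_cutoff Lam) c v x].
Proof. by rewrite /orient; case: cid => o /= [h _]; exact: h. Qed.

Lemma orient_addb Lam c v x : v \in Lam -> letter_step v x \in Lam ->
  tree_edge (cycle_cutoff Lam) c v x = (orient Lam c v == Some x) (+) (orient Lam c (letter_step v x) == Some (letter_bar x)).
Proof.
move=> vL xL; apply/idP/idP.
  by move=> h; rewrite /orient; case: cid => o /= [_]; apply.
case: eqP => [/orientP[]//|_] /=; case: eqP => // /orientP[_ _].
by rewrite tree_edge_bar.
Qed.

Lemma orient_excl Lam c v x :
  orient Lam c v = Some x -> orient Lam c (letter_step v x) <> Some (letter_bar x).
Proof.
move=> h h'; have [vL xL F] := orientP h.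
by have := orient_addb c vL xL; rewrite F h h' !eqxx.
Qed.

Lemma tree_edge_restr Lam c v x : v \in Lam ->
  tree_edge (cycle_cutoff Lam) (restr (sites_of Lam) c) v x = tree_edge (cycle_cutoff Lam) c v x.
Proof. by move=> vL; apply: tree_edge_local; exact: agree_near_restr. Qed.

End Percolation.

Section Widen.
Variables (R : realType) (I V : choiceType).
Variable e : V -> l2 R I -> l2 R I.
Hypothesis lin_e : forall v, lin (e v).
Hypothesis e_idem : forall v f, e v (e v f) = e v f.
Hypothesis e_sym : forall v f g, dot (e v f) g = dot f (e v g).
Hypothesis e_comm : forall u v f, e u (e v f) = e v (e u f).

Lemma op_widen (K K' : seq V) F f : uniq K' -> {subset K <= K'} ->
  op e K F f = op e K' (fun c => F (restr K c)) f.
Proof.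
move=> uK' KK'; rewrite !(op_sum lin_e e_idem e_comm (K' := K'))//.
apply: eq_bigr => c _; congr (F _ *: _); apply/funext => v; rewrite /restr.
by have [/KK' ->|//] := boolP (v \in K).
Qed.

Lemma op_linF (K : seq V) F F' (a : R) f : uniq K ->
  op e K (fun c => a * (F c - F' c)) f = a *: (op e K F f - op e K F' f).
Proof.
move=> uK; rewrite !(op_sum lin_e e_idem e_comm (K' := K))// -sumrB scaler_sumr.
by apply: eq_bigr => c _; rewrite -scalerBl scalerA.
Qed.

Lemma op0 (K : seq V) F : op e K F 0 = 0.
Proof. exact: (lin0 (lin_op lin_e _ _)). Qed.
End Widen.

Lemma dot_scaling (R : realType) (I J : choiceType) (T : l2 R I -> l2 R J) (a : R) f g :
  0 <= a -> lin T -> (forall f' g', nrm f' = 1 -> nrm g' = 1 -> `|dot (T f') g'| <= a) ->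
  (nrm f = 0 -> T f = 0) ->
  `|dot (T f) g| <= a * nrm f * nrm g.
Proof.
move=> a0 lT h h0.
have [f0|f0] := eqVneq (nrm f) 0; first by rewrite h0// dot0l normr0 f0 mulr0 mul0r.
have [g0|g0] := eqVneq (nrm g) 0; first by rewrite (nrm_eq0 g0) dot0r normr0 nrm0 mulr0.
have n1 (K : choiceType) (z : l2 R K) : nrm z != 0 -> nrm ((nrm z)^-1 *: z) = 1.
  by move=> z0; rewrite nrmZ ger0_norm ?invr_ge0 ?nrm_ge0// mulVf.
have := h _ _ (n1 _ _ f0) (n1 _ _ g0).
rewrite (linZ lT) dotZl dotZr mulrA normrM [X in X * _ <= _]ger0_norm; last first.
  by rewrite mulr_ge0 ?invr_ge0 ?nrm_ge0.
by rewrite -invfM ler_pdivrMl ?mulr_gt0 ?lt0r ?f0 ?g0 ?nrm_ge0// => /le_trans; apply; lra.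
Qed.

(** * Hopping operators on finite sets *)

Section Truncated.
Variables (R : realType) (B W G : groupType) (L : lamp_group B W G).
Variables (I : finType) (sg : I -> B) (u : nat -> G) (t M : nat) (A : I -> seq nat).
Local Notation phi := (lphi L).
Local Notation pi := (lpi L).
Local Notation site := (bool * G)%type.
Local Notation X := (I * bool)%type.
Local Notation H2 := (l2 R W).
Implicit Types (c : site -> bool) (v g : G) (x : X) (Lam Phi : {fset G}).

Definition letter (i : I) : G := pi (phi (sg i)).
Definition letter_lift x : W := if x.2 then (phi (sg x.1))^-1%g else phi (sg x.1).
Local Notation s := letter.
Local Notation step := (letter_step s).
Local Notation bar := (@letter_bar I).

Lemma pi_letter_lift x : pi (letter_lift x) = sx s x.
Proof. by rewrite /letter_lift /sx; case: x.2 => //; rewrite piV. Qed.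

Local Notation le := (@lamp_proj R B W G L).
Local Notation fibre := (@fibre R B W G L).
Local Notation op := (op le).
Local Notation zop := (zop le).
Local Notation sites := (sites_of L s u M).
Local Notation out := (orient L s u t M A).

(** For each letter x, the fibre over v moves to the fibre over [v * sx x], with weight [F x v]
    evaluated on the lamps. The moves are right translations, which commute with left ones and
    therefore with the lamp projections. *)
Definition hop K (F : X -> G -> (site -> bool) -> R) (S : seq G) f : H2 :=
  \sum_x \sum_(v <- S) ract (letter_lift x) (op K (F x v) (fibre v f)).

Lemma lin_hop K F S : lin (hop K F S).
Proof.
apply: linSS => x; apply: linSS => v.
apply: (lin_comp (lin_ract _)); apply: (lin_comp (lin_op (@lin_lamp_proj _ _ _ _ _) _ _)).
exact: lin_fibre.
Qed.

Lemma fibre_op K F v f : fibre v (op K F f) = op K F (fibre v f).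
Proof. by apply: comm_op; [exact: lin_fibre|move=> *; rewrite fibre_lamp_proj]. Qed.

Lemma ract_zop K c r f : ract r (zop K c f) = zop K c (ract r f).
Proof. by apply: comm_zop; [exact: lin_ract|move=> *; rewrite ract_lamp_proj]. Qed.

Lemma ract_op K F r f : ract r (op K F f) = op K F (ract r f).
Proof. by apply: comm_op; [exact: lin_ract|move=> *; rewrite ract_lamp_proj]. Qed.

Lemma fibre_dot v f h : dot (fibre v f) h = dot (fibre v f) (fibre v h).
Proof. by rewrite /fibre mask_dot2. Qed.

Lemma sum_sqn_fibre (S : seq G) f : uniq S -> \sum_(v <- S) sqn (fibre v f) <= sqn f.
Proof.
move=> uS; suff -> : \sum_(v <- S) sqn (fibre v f) = sqn (mask (fun y => pi y \in S) f).
  exact: mask_sqn_le.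
elim: S uS => [_|v S ih /= /andP[vS uS]].
  rewrite big_nil (_ : mask _ f = 0) ?sqn0//.
  by apply: l2P => y; rewrite maskE.
rewrite big_cons ih// (mask_sqn (fun w => pi w == v) (mask (fun y => pi y \in v :: S) f)).
congr (_ + _); congr sqn; apply: l2P => y; rewrite ?l2B !maskE inE.
  by case: eqP.
by case: eqP => [->|_] /=; rewrite ?(negbTE vS) ?subrr ?subr0.
Qed.

Lemma sum_zop_fibre K (S : seq G) f : uniq K -> uniq S ->
  \sum_(c <- cfgs K) \sum_(v <- S) sqn (zop K c (fibre v f)) <= sqn f.
Proof.
move=> uK uS; rewrite exchange_big /=.
apply: le_trans (sum_sqn_fibre f uS); apply: ler_sum => v _.
by rewrite zop_sqn//; [exact: lamp_proj_idem|exact: lamp_proj_sym].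
Qed.

Lemma sum_step (S : seq G) (z : G -> X -> R) v : uniq S ->
  \sum_(v' <- S) \sum_x (step v' x == v)%:R * z v' x =
  \sum_x (step v x \in S)%:R * z (step v x) (bar x).
Proof.
move=> uS; rewrite exchange_big /= (reindex_inj (inv_inj (@barK I))) /=.
apply: eq_bigr => x _; elim: S uS => [_|v' S ih /= /andP[vS uS]].
  by rewrite big_nil in_nil mul0r.
rewrite big_cons ih// inE.
have -> : (step v' (bar x) == v) = (step v x == v').
  apply/eqP/eqP => <-; last exact: stepK.
  by rewrite -{2}[x]barK stepK.
by case: eqP => [->|_] /=; rewrite ?(negbTE vS) ?mul0r ?addr0 ?add0r.
Qed.

(* Schur's test in each joint spectral subspace of the lamp projections. *)
Lemma hop_schur K F S (a : R) f h : uniq K -> uniq S -> 0 <= a ->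
  (forall v c, v \in S -> \sum_x `|F x v c| <= a) ->
  (forall v c, \sum_x (step v x \in S)%:R * `|F (bar x) (step v x) c| <= a) ->
  `|dot (hop K F S f) h| <= a * nrm f * nrm h.
Proof.
move=> uK uS a0 r1 r2; apply: (dot_scaling (T := hop K F S) h a0 (lin_hop _ _ _)); last first.
  by move=> /nrm_eq0 ->; exact: (lin0 (lin_hop _ _ _)).
move=> {f h} f h f1 h1.
have sf : sqn f = 1 by rewrite -nrm_sqr f1 expr1n.
have sh : sqn h = 1 by rewrite -nrm_sqr h1 expr1n.
have dotE' x v : dot (ract (letter_lift x) (op K (F x v) (fibre v f))) h =
    \sum_(c <- cfgs K) F x v (restr K c) *
      dot (ract (letter_lift x) (zop K c (fibre v f))) (zop K c (fibre (step v x) h)).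
  have E (z : H2) : ract (letter_lift x) (fibre v z) = fibre (step v x) (ract (letter_lift x) z) by rewrite ract_fibre pi_letter_lift.
  rewrite -fibre_op E fibre_dot -E fibre_op.
  rewrite (op_sum (@lin_lamp_proj _ _ _ _ _) (@lamp_proj_idem _ _ _ _ _) (@lamp_proj_comm _ _ _ _ _) _ _ uK (fun _ h => h)).
  rewrite (lin_sum (lin_ract _)) dot_suml; apply: eq_bigr => c _.
  rewrite (linZ (lin_ract _)) dotZl; congr (_ * _).
  by rewrite ract_zop (dot_zop (@lin_lamp_proj _ _ _ _ _) (@lamp_proj_idem _ _ _ _ _) (@lamp_proj_sym _ _ _ _ _) (@lamp_proj_comm _ _ _ _ _)).
rewrite /hop dot_suml; under eq_bigr do rewrite dot_suml.
under eq_bigr do under eq_bigr do rewrite dotE'.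
pose U := undup [seq step v x | v <- S, x <- enum {: X}].
have uU : uniq U by exact: undup_uniq.
pose af c v := sqn (zop K c (fibre v f)); pose ah c v := sqn (zop K c (fibre v h)).
have -> : \sum_x \sum_(v <- S) \sum_(c <- cfgs K) F x v (restr K c) *
      dot (ract (letter_lift x) (zop K c (fibre v f))) (zop K c (fibre (step v x) h)) =
    \sum_(c <- cfgs K) \sum_(v <- S) \sum_x F x v (restr K c) *
      dot (ract (letter_lift x) (zop K c (fibre v f))) (zop K c (fibre (step v x) h)).
  rewrite exchange_big /= [RHS]exchange_big /=; apply: eq_bigr => v _.
  by rewrite exchange_big.
apply: (@le_trans _ _ (\sum_(c <- cfgs K) \sum_(v <- S) \sum_x
    `|F x v (restr K c)| * ((af c v + ah c (step v x)) / 2))).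
  apply: le_trans (ler_norm_sum _ _ _) _; apply: ler_sum => c _.
  apply: le_trans (ler_norm_sum _ _ _) _; apply: ler_sum => v _.
  apply: le_trans (ler_norm_sum _ _ _) _; apply: ler_sum => x _.
  rewrite normrM ler_wpM2l//; apply: le_trans (dot_le _ _) _.
  rewrite {1}/nrm sqn_ract -/(nrm _) /af /ah -!nrm_sqr.
  set a1 := nrm _; set a2 := nrm _; have := sqr_ge0 (a1 - a2); nra.
have E1 : \sum_(c <- cfgs K) \sum_(v <- S) \sum_x `|F x v (restr K c)| * af c v <= a.
  rewrite -[a]mulr1 -sf; apply: le_trans (ler_wpM2l a0 (sum_zop_fibre f uK uS)).
  rewrite mulr_sumr; apply: ler_sum => c _; rewrite mulr_sumr.
  rewrite big_seq [leRHS]big_seq; apply: ler_sum => v vS.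
  by rewrite -mulr_suml ler_wpM2r ?sqn_ge0// r1.
have E2 : \sum_(c <- cfgs K) \sum_(v <- S) \sum_x `|F x v (restr K c)| * ah c (step v x) <= a.
  rewrite -[a]mulr1 -sh; apply: le_trans (ler_wpM2l a0 (sum_zop_fibre h uK uU)).
  rewrite mulr_sumr; apply: ler_sum => c _; rewrite mulr_sumr.
  have -> : \sum_(v <- S) \sum_x `|F x v (restr K c)| * ah c (step v x) =
      \sum_(v <- U) \sum_(v' <- S) \sum_x (step v' x == v)%:R * (`|F x v' (restr K c)| * ah c v).
    rewrite [RHS]exchange_big /= big_seq [RHS]big_seq; apply: eq_bigr => v' vS.
    rewrite [RHS]exchange_big /=; apply: eq_bigr => x _.
    rewrite (bigD1_seq (step v' x))//=; last first.
      by rewrite mem_undup; apply/allpairsP; exists (v', x); rewrite mem_enum.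
    rewrite eqxx mul1r big1 ?addr0// => v; rewrite eq_sym => /negbTE ->.
    by rewrite mul0r.
  apply: ler_sum => v _; rewrite (sum_step (fun v' x => `|F x v' (restr K c)| * ah c v))//.
  under eq_bigr do rewrite mulrA.
  by rewrite -mulr_suml ler_wpM2r ?sqn_ge0// r2.
rewrite (_ : \sum_(c <- _) _ = (\sum_(c <- cfgs K) \sum_(v <- S) \sum_x `|F x v (restr K c)| * af c v +
  \sum_(c <- cfgs K) \sum_(v <- S) \sum_x `|F x v (restr K c)| * ah c (step v x)) / 2); first by lra.
rewrite -big_split mulr_suml; apply: eq_bigr => c _.
rewrite -big_split mulr_suml; apply: eq_bigr => v _.
rewrite -big_split mulr_suml; apply: eq_bigr => x _ /=.
by rewrite -mulrDr mulrA.
Qed.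

Lemma hop_restrict K F (S S' : seq G) f : uniq S -> uniq S' -> {subset S' <= S} ->
  (forall v, v \notin S' -> fibre v f = 0) -> hop K F S f = hop K F S' f.
Proof.
move=> uS uS' S'S f0; apply: eq_bigr => x _.
rewrite (bigID [in S']) /= [X in _ + X]big1 ?addr0 => [|v vS']; last first.
  by rewrite f0// op0 ?(lin0 (lin_ract _))//; exact: lin_lamp_proj.
rewrite -big_filter; apply: perm_big; apply: uniq_perm; rewrite ?filter_uniq// => v.
by rewrite mem_filter andb_idr// => /S'S.
Qed.

Lemma hop_widen K K' F S f : uniq K' -> {subset K <= K'} ->
  hop K F S f = hop K' (fun x v c => F x v (restr K c)) S f.
Proof.
move=> uK' KK'; apply: eq_bigr => x _; apply: eq_bigr => v _.
by rewrite (op_widen (@lin_lamp_proj _ _ _ _ _) (@lamp_proj_idem _ _ _ _ _) (@lamp_proj_comm _ _ _ _ _) (F x v) _ uK' KK').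
Qed.

Definition translate g (K : seq site) : seq site := [seq (z.1, (g * z.2)%g) | z <- K].

Lemma lact_op b K F f : lact (phi b) (op K F f) =
  op (translate (pi (phi b)) K) (fun c => F (shift (pi (phi b)) c)) (lact (phi b) f).
Proof.
elim: K F f => [|z K ih] F f /=; first by rewrite (linZ (lin_lact _)).
have updE e : (fun c => F (shift (pi (phi b)) (upd c (z.1, pi (phi b) * z.2)%g e))) =
    (fun c => F (upd (shift (pi (phi b)) c) z e)).
  apply/funext => c; congr (F _); apply/funext => y; rewrite /shift /upd.
  congr (if _ then _ else _); case: y z {ih} => y1 y2 [z1 z2] /=.
  by rewrite !xpair_eqE (inj_eq (mulgI _)).
by rewrite (linD (lin_lact _)) !ih !updE (linB (lin_lact _)) !lact_phi_lamp_proj.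
Qed.

Lemma lact_hop b K F S f : lact (phi b) (hop K F S f) =
  hop (translate (pi (phi b)) K)
    (fun x v c => F x ((pi (phi b))^-1 * v)%g (shift (pi (phi b)) c))
    [seq (pi (phi b) * v)%g | v <- S] (lact (phi b) f).
Proof.
rewrite (lin_sum (lin_lact _)); apply: eq_bigr => x _.
rewrite (lin_sum (lin_lact _)) big_map; apply: eq_bigr => v _.
by rewrite -ract_lact lact_op lact_fibre mulKg.
Qed.

(** A vector h living over [Phi] only sees the steps that end in [Phi]; the two kernels need to be
    compared there alone. *)
Lemma dot_hopB K F F' S (Phi : seq G) f h : uniq K ->
  (forall v, v \notin Phi -> fibre v h = 0) ->
  dot (hop K F S f - hop K F' S f) h =
  dot (hop K (fun x v c => (step v x \in Phi)%:R * (F x v c - F' x v c)) S f) h.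
Proof.
move=> uK h0; rewrite /hop -sumrB !dot_suml; apply: eq_bigr => x _.
rewrite -sumrB !dot_suml; apply: eq_bigr => v _.
rewrite (op_linF (@lin_lamp_proj _ _ _ _ _) (@lamp_proj_idem _ _ _ _ _) (@lamp_proj_comm _ _ _ _ _))//.
rewrite (linZ (lin_ract _)) (linB (lin_ract _)) dotZl.
have [xP|xP] := boolP (step v x \in Phi); first by rewrite mul1r.
have z0 F1 : dot (ract (letter_lift x) (op K F1 (fibre v f))) h = 0.
  have E (z : H2) : ract (letter_lift x) (fibre v z) = fibre (step v x) (ract (letter_lift x) z).
    by rewrite ract_fibre pi_letter_lift.
  by rewrite -fibre_op E fibre_dot h0// dot0r.
by rewrite mul0r dotBl !z0 subrr.
Qed.

Definition truncated_hop Lam : H2 -> H2 :=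
  hop (sites Lam) (fun x v c => (out Lam c v == Some x)%:R) Lam.

Hypothesis tM : (t <= M)%N.
Hypothesis AM : forall i j, j \in A i -> (j < M)%N.

Lemma lin_truncated_hop Lam : lin (truncated_hop Lam). Proof. exact: lin_hop. Qed.

Lemma sum_orient (o : option X) : \sum_x `|(o == Some x)%:R : R| <= 1.
Proof.
case: o => [y|]; last by rewrite big1// => x _; rewrite normr0.
rewrite (bigD1 y)//= eqxx normr1 big1 ?addr0// => x xy.
by rewrite (inj_eq Some_inj) eq_sym (negbTE xy) normr0.
Qed.

Lemma uniq_sites Lam : uniq (sites Lam). Proof. exact: undup_uniq. Qed.

(** Crude, each vertex receiving at most one term per letter, but uniform in [Lam], which is what an
    operator limit asks for. *)
Lemma truncated_hop_bounded Lam f h : `|dot (truncated_hop Lam f) h| <= (1 + #|{: X}|%:R) * nrm f * nrm h.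
Proof.
apply: hop_schur; rewrite ?uniq_sites ?fset_uniq ?addr_ge0//.
  by move=> v c _; apply: le_trans (sum_orient _) _; rewrite lerDl.
move=> v c; apply: (@le_trans _ _ #|{: X}|%:R); last by rewrite lerDr.
have -> : #|{: X}|%:R = \sum_(x : X) (1 : R) by rewrite sumr_const.
by apply: ler_sum => x _; rewrite normr_nat -natrM mulnb lern1 leq_b1.
Qed.

(** Over the vertex 1 only the single edge leaving 1 acts, for each lamp configuration, so rows and
    columns of the kernel both have sum at most 1. *)
Lemma truncated_hop_fibre1 Lam f h : 1%g \in Lam -> fibre 1%g f = f ->
  `|dot (truncated_hop Lam f) h| <= nrm f * nrm h.
Proof.
move=> L1 f1; rewrite -[nrm f]mul1r.
rewrite /truncated_hop (@hop_restrict _ _ _ [:: 1%g]) ?fset_uniq//; last first.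
- by move=> v; rewrite inE -f1 fibre_fibre => /negbTE ->.
- by move=> v; rewrite inE => /eqP ->.
apply: hop_schur; rewrite ?uniq_sites//; first by move=> v c _; exact: sum_orient.
move=> v c; rewrite (reindex_inj (inv_inj (@barK I))) /=.
apply: le_trans (sum_orient (out Lam c 1%g)); apply: ler_sum => x _.
by rewrite barK inE; case: eqP => [->|_]; rewrite ?mul1r// mul0r.
Qed.

(** The conjugate operator follows the translated orientation [a']. By equivariance of [tree_edge],
    and as the cut-off is the same, both [a] and [a'] orient the same edges inside [Phi]: each of
    them plus its reversal is the indicator of [tree_edge]. Hence the column sums of a - a' are row
    sums as well, and Schur's test gives 2. *)
Lemma truncated_hop_commutator b Lam (Phi : seq G) f h : uniq Phi ->
  {subset Phi <= Lam} -> (forall v, v \in Phi -> ((pi (phi b))^-1 * v)%g \in Lam) ->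
  (forall v, v \notin Phi -> fibre v f = 0) -> (forall v, v \notin Phi -> fibre v h = 0) ->
  `|dot (truncated_hop Lam f - lact (phi b) (truncated_hop Lam (lact (phi b)^-1%g f))) h| <= 2 * nrm f * nrm h.
Proof.
move=> uP PL PgL f0 h0; set g := pi (phi b); set K := sites Lam.
have uK : uniq K := uniq_sites Lam.
rewrite /truncated_hop lact_hop -lactM mulgV lact1 -/g -/K.
rewrite (@hop_restrict _ _ Lam Phi) ?fset_uniq//.
rewrite (@hop_restrict _ _ (map _ _) Phi) //; last first.
- by move=> v vP; apply/mapP; exists (g^-1 * v)%g; rewrite ?PgL// mulVKg.
- by rewrite map_inj_uniq ?fset_uniq//; exact: mulgI.
set K' := undup (K ++ translate g K).
have uK' : uniq K' by exact: undup_uniq.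
rewrite (@hop_widen K K')//; last by move=> z zK; rewrite mem_undup mem_cat zK.
rewrite (@hop_widen (translate g K) K')//; last by move=> z zK; rewrite mem_undup mem_cat zK orbT.
rewrite (@dot_hopB _ _ _ _ Phi)//.
have shr c : shift g (restr (translate g K) c) = restr K (shift g c).
  apply/funext => -[z1 z2]; rewrite /shift /restr /=; congr (_ && _).
  apply/mapP/idP => [[[y1 y2] yK /= [-> /mulgI ->]]//|zK].
  by exists (z1, z2).
pose a x v c : R := (out Lam (restr K c) v == Some x)%:R.
pose a' x v c : R := (out Lam (restr K (shift g c)) (g^-1 * v)%g == Some x)%:R.
have aE x v c : v \in Lam -> step v x \in Lam ->
    a x v c + a (bar x) (step v x) c = (tree_edge L s u t M A (cycle_cutoff Lam) c v x)%:R.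
  move=> vL xL; rewrite /a -(tree_edge_restr L s u tM AM c x vL) (orient_addb L u t M A (restr K c) vL xL).
  have [Eo|Eo] := eqVneq (out Lam (restr K c) v) (Some x).
    by move/eqP/negbTE: (orient_excl Eo) => ->; rewrite addr0.
  by rewrite add0r.
have stepg v x : step (g^-1 * v)%g x = (g^-1 * step v x)%g by rewrite /letter_step mulgA.
have a'E x v c : v \in Phi -> step v x \in Phi ->
    a' x v c + a' (bar x) (step v x) c = (tree_edge L s u t M A (cycle_cutoff Lam) c v x)%:R.
  move=> vP xP; move: (aE x (g^-1 * v)%g (shift g c) (PgL _ vP)).
  by rewrite stepg tree_edge_shift mulVKg; apply; exact: PgL.
apply: hop_schur => //.
  move=> v c vP; apply: (@le_trans _ _ (\sum_x (`|a x v c| + `|a' x v c|))).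
    apply: ler_sum => x _; rewrite normrM shr -[_ - _]/(a x v c - a' x v c).
    apply: le_trans (ler_normB _ _); rewrite -[leRHS]mul1r ler_wpM2r//.
    by rewrite normr_nat lern1 leq_b1.
  by rewrite big_split; apply: lerD; exact: sum_orient.
move=> v c; apply: (@le_trans _ _ (\sum_x (`|a x v c| + `|a' x v c|))).
  apply: ler_sum => x _; rewrite normrM shr.
  rewrite -[_ - _]/(a (bar x) (step v x) c - a' (bar x) (step v x) c) stepK.
  have [xP|_] := boolP (step v x \in Phi); last by rewrite mul0r addr_ge0.
  have [vP|_] := boolP (v \in Phi); last by rewrite normr0 mul0r mulr0 addr_ge0.
  have e : a (bar x) (step v x) c - a' (bar x) (step v x) c = a' x v c - a x v c.
    move: (aE x v c (PL _ vP) (PL _ xP)) (a'E x v c vP xP); lra.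
  by rewrite e !mul1r normr1 mul1r [leRHS]addrC; exact: ler_normB.
by rewrite big_split; apply: lerD; exact: sum_orient.
Qed.

End Truncated.

(** * Bounded forms and weak limits of operators *)

Section Riesz.
Variables (R : realType) (I : choiceType).
Implicit Types f g h : l2 R I.

Lemma delta_sum (a : I -> R) (F : {fset I}) i :
  (\sum_(j <- F) a j *: delta R j) i = if i \in F then a i else 0.
Proof.
rewrite l2_sum; have [iF|iF] := boolP (i \in F).
  rewrite (bigD1_seq i) ?fset_uniq// l2Z deltaE eqxx mulr1 big1 => [|j ji]; first exact: addr0.
  by rewrite l2Z deltaE eq_sym (negbTE ji) mulr0.
rewrite big_seq big1// => j jF; rewrite l2Z deltaE; case: eqP => [ij|_]; last by rewrite mulr0.
by rewrite ij jF in iF.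
Qed.

Lemma mask_fset (F : {fset I}) f : mask [in F] f = \sum_(i <- F) f i *: delta R i.
Proof. by apply: l2P => i; rewrite delta_sum. Qed.

Lemma dot_inj f g : (forall h, dot f h = dot g h) -> f = g.
Proof. by move=> h; apply: l2P => i; rewrite -!dot_delta -!(dotC _ (delta R i)) h dotC. Qed.

Lemma nrm_mask_le (P : pred I) f : nrm (mask P f) <= nrm f.
Proof. by rewrite nrm_le_sqn ?nrm_ge0// nrm_sqr mask_sqn_le. Qed.

Lemma trunc_approx_nrm f e : 0 < e -> exists F : {fset I}, nrm (f - mask [in F] f) <= e.
Proof.
move=> e0; have [F hF] := trunc_approx f (exprn_gt0 2 e0); exists F.
by rewrite nrm_le_sqn // ltW.
Qed.

(** The coordinates of g are the values of [l] at point masses. Testing [l] on their restriction to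
    a finite set bounds the sum of their squares by C^2; finitely supported vectors then determine
    [l]. *)
Lemma riesz (l : l2 R I -> R) (C : R) : 0 <= C ->
    (forall a f g, l (a *: f + g) = a * l f + l g) ->
    (forall h, `|l h| <= C * nrm h) -> exists g, forall h, dot g h = l h.
Proof.
move=> C0 ll lC; pose g0 i := l (delta R i).
have l0 : l 0 = 0.
  have h := lC 0; rewrite nrm0 mulr0 normr_le0 in h; exact/eqP.
have lsum (F : {fset I}) (a : I -> R) : l (\sum_(j <- F) a j *: delta R j) = \sum_(j <- F) a j * g0 j.
  elim/big_rec2: _ => [//|i y x _ <-]; exact: ll.
have bd (F : {fset I}) : \sum_(i <- F) g0 i ^+ 2 <= C ^+ 2.
  set S := \sum_(i <- F) _; set f := \sum_(j <- F) g0 j *: delta R j.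
  have lf : l f = S by rewrite lsum; apply: eq_bigr => i _; rewrite expr2.
  have sf : sqn f = S.
    rewrite /sqn (@dot_fin _ _ _ _ F) => [|i iF]; last by rewrite delta_sum (negbTE iF).
    by rewrite /S big_seq [RHS]big_seq; apply: eq_bigr => i iF; rewrite delta_sum iF expr2.
  have S0 : 0 <= S by rewrite -sf sqn_ge0.
  have := lC f; rewrite lf ger0_norm// => SC.
  have [->|Sn] := eqVneq S 0; first exact: sqr_ge0.
  have Sp : 0 < S by rewrite lt0r Sn.
  rewrite -(ler_pM2l Sp) -expr2; apply: le_trans (lerXn2r 2 _ _ SC) _; rewrite ?nnegrE ?mulr_ge0 ?nrm_ge0//.
  by rewrite exprMn nrm_sqr sf mulrC.
exists (l2_of bd) => h; apply/eqP; rewrite -subr_eq0 -normr_le0.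
apply/ler_addgt0Pr => e e0; rewrite add0r.
set g := l2_of bd.
have K0 : 0 < nrm g + C + 1 by rewrite ltr_wpDl// addr_ge0// nrm_ge0.
have [F hF] := trunc_approx_nrm h (divr_gt0 e0 K0).
set h' := mask [in F] h in hF.
have e1 : dot g h' = l h'.
  rewrite /h' mask_fset lsum dot_sumr; apply: eq_bigr => i _.
  by rewrite dotZr dotC dot_delta.
have e2 : l h = l (h - h') + l h'.
  by have := ll 1 (h - h') h'; rewrite scale1r mul1r subrK.
have -> : dot g h - l h = dot g (h - h') - l (h - h') by rewrite dotBr e2 e1; ring.
apply: le_trans (ler_normB _ _) _; apply: le_trans (lerD (dot_le _ _) (lC _)) _.
rewrite -mulrDl; apply: le_trans (ler_wpM2l _ hF) _; first by rewrite addr_ge0 ?nrm_ge0.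
rewrite mulrA ler_pdivrMr// mulrC ler_wpM2l ?ltW//; lra.
Qed.

Lemma form_operator (b : l2 R I -> l2 R I -> R) (C : R) : 0 <= C ->
    (forall a f g h, b (a *: f + g) h = a * b f h + b g h) ->
    (forall a f g h, b h (a *: f + g) = a * b h f + b h g) ->
    (forall f h, `|b f h| <= C * nrm f * nrm h) ->
  exists2 T : l2 R I -> l2 R I, lin T & forall f h, dot (T f) h = b f h.
Proof.
move=> C0 bl br bC.
have ex f : exists g, forall h, dot g h = b f h.
  by apply: (@riesz (b f) (C * nrm f)) => //; rewrite mulr_ge0 ?nrm_ge0.
exists (fun f => projT1 (cid (ex f))) => [a f g|f]; last by case: cid.
apply: dot_inj => h; case: cid => /= z ->; rewrite bl dotDl dotZl.
by case: (cid (ex f)) => /= ? ->; case: cid => /= ? ->.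
Qed.

Lemma nrm_dot_le (C : R) f : 0 <= C -> (forall h, `|dot f h| <= C * nrm h) -> nrm f <= C.
Proof.
move=> C0 h; have := h f; rewrite -/(sqn f) ger0_norm ?sqn_ge0// -nrm_sqr => fC.
have [->//|n0] := eqVneq (nrm f) 0.
have np : 0 < nrm f by rewrite lt0r n0 nrm_ge0.
by rewrite -(ler_pM2r np) -expr2.
Qed.

(** A rough a priori bound [C] allows a sharp bound, known for finitely supported vectors only, to
    pass to all vectors. Commutators of truncations are controlled only on finite supports. *)
Lemma dense_bound (T : l2 R I -> l2 R I) (C a : R) : lin T -> 0 <= C -> 0 <= a ->
    (forall f, nrm (T f) <= C * nrm f) ->
    (forall (F F' : {fset I}) f h, `|dot (T (mask [in F] f)) (mask [in F'] h)| <=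
        a * nrm (mask [in F] f) * nrm (mask [in F'] h)) ->
  forall f, nrm (T f) <= a * nrm f.
Proof.
move=> lT C0 a0 TC hT f; apply: nrm_dot_le => [|h]; first by rewrite mulr_ge0 ?nrm_ge0.
apply/ler_addgt0Pr => e e0.
have K0 : 0 < C * (nrm f + nrm h) + 1 by rewrite ltr_wpDl// mulr_ge0// addr_ge0// nrm_ge0.
have [F hF] := trunc_approx_nrm f (divr_gt0 e0 K0).
have [F' hF'] := trunc_approx_nrm h (divr_gt0 e0 K0).
set d := e / _ in hF hF'.
set f' := mask _ f in hF; set h' := mask _ h in hF'.
have -> : dot (T f) h = dot (T f') h' + (dot (T (f - f')) h + dot (T f') (h - h')).
  by rewrite (linB lT) dotBl dotBr; ring.
apply: le_trans (ler_normD _ _) _; apply: lerD.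
  apply: le_trans (hT F F' f h) _; rewrite -!mulrA ler_wpM2l//.
  by rewrite ler_pM ?nrm_ge0 ?nrm_mask_le.
apply: le_trans (ler_normD _ _) _.
apply: le_trans (lerD (dot_le _ _) (dot_le _ _)) _.
have b1 : nrm (T (f - f')) * nrm h <= C * d * nrm h.
  by rewrite ler_wpM2r ?nrm_ge0//; apply: le_trans (TC _) _; rewrite ler_wpM2l.
have b2 : nrm (T f') * nrm (h - h') <= C * nrm f * d.
  rewrite ler_pM ?nrm_ge0//; apply: le_trans (TC _) _; rewrite ler_wpM2l//; exact: nrm_mask_le.
apply: le_trans (lerD b1 b2) _.
have -> : C * d * nrm h + C * nrm f * d = C * (nrm f + nrm h) * d by ring.
rewrite /d mulrA ler_pdivrMr// mulrC ler_wpM2l ?ltW//; lra.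
Qed.

End Riesz.

Section OperatorLimit.
Variables (R : realType) (I : choiceType) (J : Type) (U : set_system J).
Hypothesis UU : UltraFilter U.
Variables (A : J -> l2 R I -> l2 R I) (C : R).
Hypothesis C0 : 0 <= C.
Hypothesis linA : forall j, lin (A j).
Hypothesis AC : forall j f h, `|dot (A j f) h| <= C * nrm f * nrm h.

Let cv f h : cvg ((fun j => dot (A j f) h) @ U).
Proof. by apply: (@ulim_cvg _ _ _ _ _ (C * nrm f * nrm h)) => j; exact: AC. Qed.

Lemma operator_limit : exists T : l2 R I -> l2 R I,
  [/\ lin T, forall f, nrm (T f) <= C * nrm f &
      forall f h, (fun j => dot (A j f) h) @ U --> dot (T f) h].
Proof.
pose b f h := lim ((fun j => dot (A j f) h) @ U).
have bC f h : `|b f h| <= C * nrm f * nrm h.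
  rewrite ler_norml; apply/andP; split.
    apply: limr_ge; first exact: cv.
    by apply: nearW => j; have := AC j f h; rewrite ler_norml => /andP[].
  apply: limr_le; first exact: cv.
  by apply: nearW => j; have := AC j f h; rewrite ler_norml => /andP[].
have [||T lT TE] := @form_operator R I b C C0 _ _ bC.
- move=> a f g h; apply/cvg_lim => //.
  under eq_fun do rewrite linA dotDl dotZl.
  by apply: cvgD; [apply: cvgMr; exact: cv|exact: cv].
- move=> a f g h; apply/cvg_lim => //.
  under eq_fun do rewrite dotDr dotZr.
  by apply: cvgD; [apply: cvgMr; exact: cv|exact: cv].
exists T; split=> // [f|f h]; last by rewrite TE; exact: cv.
by apply: nrm_dot_le => [|h]; rewrite ?TE// mulr_ge0 ?nrm_ge0.
Qed.

End OperatorLimit.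

Section LimitBounds.
Variables (R : realType) (J : Type) (U : set_system J).
Hypothesis UU : ProperFilter U.

Lemma cvg_ge_ev (u : J -> R) (l a : R) : u @ U --> l -> U [set j | a <= u j] -> a <= l.
Proof.
move=> ul ua; rewrite -(cvg_lim _ ul)//; apply: limr_ge => //.
by apply/cvg_ex; exists l.
Qed.

Lemma cvg_norm_le_ev (u : J -> R) (l a : R) : u @ U --> l -> U [set j | `|u j| <= a] -> `|l| <= a.
Proof.
move=> ul ua; rewrite ler_norml; apply/andP; split.
  by apply: cvg_ge_ev ul _; apply: filterS ua => j /=; rewrite ler_norml => /andP[].
rewrite -(cvg_lim _ ul)//; apply: limr_le; first by apply/cvg_ex; exists l.
by apply: filterS ua => j /=; rewrite ler_norml => /andP[].
Qed.
End LimitBounds.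

Section LimitOperator.
Variables (R : realType) (B W G : groupType) (L : lamp_group B W G).
Variables (I : finType) (sg : I -> B) (u : nat -> G) (t M : nat) (A : I -> seq nat).
Local Notation phi := (lphi L).
Local Notation pi := (lpi L).
Local Notation X := (I * bool)%type.
Local Notation H2 := (l2 R W).
Local Notation fibre := (@fibre R B W G L).
Local Notation TL := (@truncated_hop R B W G L I sg u t M A).

Hypothesis tM : (t <= M)%N.
Hypothesis AM : forall i j, j \in A i -> (j < M)%N.

Lemma hopping_operator : exists T : H2 -> H2,
  [/\ lin T, forall f, fibre 1%g f = f -> nrm (T f) <= nrm f,
      forall b f, nrm (T (lact (phi b) f) - lact (phi b) (T f)) <= 2 * nrm f &
      forall f h, (fun Lam => dot (TL Lam f) h) @ @fset_ultra G --> dot (T f) h].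
Proof.
have X0 : 0 <= 1 + #|{: X}|%:R :> R by rewrite addr_ge0.
have [T [lT TC Tcv]] := operator_limit fset_ultraP X0 (@lin_truncated_hop R B W G L I sg u t M A)
  (@truncated_hop_bounded R B W G L I sg u t M A).
exists T; split=> //.
  move=> f f1; apply: nrm_dot_le => [|h]; first exact: nrm_ge0.
  apply: cvg_norm_le_ev (Tcv f h) _.
  apply: filterS (fset_ultra_ge [fset 1%g]%fset) => Lam /= sL.
  by apply: truncated_hop_fibre1 => //; apply: (fsubsetP sL); rewrite inE.
move=> b f; have [f' fE] : exists f', f = lact (phi b)^-1%g f'.
  by exists (lact (phi b) f); rewrite -lactM mulVg lact1.
rewrite fE -lactM mulgV lact1.
have -> : nrm (lact (phi b)^-1%g f') = nrm f' by rewrite /nrm sqn_lact.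
pose E g := T g - lact (phi b) (T (lact (phi b)^-1%g g)).
have lE : lin E.
  apply: linBB => //; apply: (lin_comp (lin_lact _)); apply: (lin_comp lT); exact: lin_lact.
apply: (dense_bound (T := E) (C := 2 * (1 + #|{: X}|%:R)) lE) => //.
  move=> g; rewrite /E; apply: le_trans (nrmB _ _) _.
  have -> : nrm (lact (phi b) (T (lact (phi b)^-1%g g))) = nrm (T (lact (phi b)^-1%g g)).
    by rewrite /nrm sqn_lact.
  apply: le_trans (lerD (TC _) (TC _)) _.
  have -> : nrm (lact (phi b)^-1%g g) = nrm g by rewrite /nrm sqn_lact.
  by rewrite le_eqVlt; apply/orP; left; apply/eqP; ring.
move=> F F' g h; set g' := mask _ g; set h' := mask _ h.
pose Phi := [fset pi w | w in (F `|` F')%fset]%fset.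
have supp (F0 : {fset W}) (z : H2) v : (F0 `<=` F `|` F')%fset -> v \notin Phi ->
    fibre v (mask [in F0] z) = 0.
  move=> F0F vP; apply: l2P => w; rewrite !maskE.
  case: eqP => // wv; case: ifP => // wF; move/negP: vP; case.
  by rewrite -wv; apply: in_imfset; exact: (fsubsetP F0F).
(* Truncations beyond [Lam0] contain [Phi] and its translate, as [truncated_hop_commutator]
   requires. *)
pose Lam0 := (Phi `|` [fset (pi (phi b))^-1 * v | v in Phi])%fset%g.
have c1 : (fun Lam => dot (TL Lam g' - lact (phi b) (TL Lam (lact (phi b)^-1%g g'))) h')
    @ @fset_ultra G --> dot (E g') h'.
  rewrite /E dotBl dot_lactV; under eq_fun do rewrite dotBl dot_lactV.
  by apply: cvgB; exact: Tcv.
apply: cvg_norm_le_ev c1 _.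
apply: filterS (fset_ultra_ge Lam0) => Lam /= sL.
apply: (@truncated_hop_commutator R B W G L I sg u t M A tM AM b Lam Phi).
- exact: fset_uniq.
- by move=> v vP; apply: (fsubsetP sL); rewrite inE vP.
- by move=> v vP; apply: (fsubsetP sL); rewrite inE in_imfset ?orbT.
- by move=> v vP; apply: supp => //; exact: fsubsetUl.
- by move=> v vP; apply: supp => //; exact: fsubsetUr.
Qed.

End LimitOperator.

Section OpMul.
Variables (R : realType) (I V : choiceType).
Variable e : V -> l2 R I -> l2 R I.
Hypothesis lin_e : forall v, lin (e v).
Hypothesis e_idem : forall v f, e v (e v f) = e v f.
Hypothesis e_sym : forall v f g, dot (e v f) g = dot f (e v g).
Hypothesis e_comm : forall u v f, e u (e v f) = e v (e u f).

Lemma op_op (K : seq V) F F' f : uniq K ->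
  op e K F (op e K F' f) = op e K (fun c => F c * F' c) f.
Proof.
move=> uK; have S F1 := op_sum lin_e e_idem e_comm F1 f uK (fun _ h => h).
rewrite (S F') (S (fun c => F c * F' c)) (lin_sum (lin_op lin_e K F)).
apply: eq_bigr => c _; rewrite (linZ (lin_op lin_e K F)).
by rewrite (op_eigen lin_e F (@zop_eigen _ _ _ _ lin_e e_idem e_comm K c f)) scalerA mulrC.
Qed.

Lemma op_dot (K : seq V) F F' f g : uniq K ->
  dot (op e K F f) (op e K F' g) = dot (op e K (fun c => F c * F' c) f) g.
Proof.
move=> uK; rewrite -(op_sym lin_e e_idem e_sym e_comm)// op_op//.
by congr dot; congr op; apply/funext => c; rewrite mulrC.
Qed.

Lemma op_site (K : seq V) v F f : uniq K -> v \in K ->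
  op e K (fun c => (c v)%:R * F c) f = e v (op e K F f).
Proof.
move=> uK vK; rewrite !(op_sum lin_e e_idem e_comm (K' := K))//.
rewrite (lin_sum (lin_e v)); apply: eq_bigr => c _; rewrite (linZ (lin_e v)).
by rewrite (@zop_eigen _ _ _ _ lin_e e_idem e_comm K c f v vK) scalerA mulrC /restr vK.
Qed.

Lemma op_const (K : seq V) f : uniq K -> op e K (fun=> 1) f = f.
Proof.
move=> uK; rewrite (op_sum lin_e e_idem e_comm (K' := K))//.
by under eq_bigr do rewrite scale1r; exact: zop_sum.
Qed.

Lemma op_ext (K : seq V) F F' f : uniq K -> (forall c, F (restr K c) = F' (restr K c)) ->
  op e K F f = op e K F' f.
Proof.
move=> uK FF'; rewrite !(op_sum lin_e e_idem e_comm (K' := K))//.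
by apply: eq_bigr => c _; rewrite FF'.
Qed.

Lemma dot_op_mono (K : seq V) F F' f : uniq K ->
  (forall c, F (restr K c) <= F' (restr K c)) -> dot (op e K F f) f <= dot (op e K F' f) f.
Proof.
move=> uK FF'; rewrite !(op_sum lin_e e_idem e_comm (K' := K))// !dot_suml.
apply: ler_sum => c _; rewrite !dotZl -(dot_zop lin_e e_idem e_sym e_comm).
by rewrite ler_wpM2r ?sqn_ge0.
Qed.

Lemma op_lincomb (K : seq V) T (r : seq T) (F : T -> (V -> bool) -> R) f : uniq K ->
  op e K (fun c => \sum_(i <- r) F i c) f = \sum_(i <- r) op e K (F i) f.
Proof.
move=> uK; rewrite (op_sum lin_e e_idem e_comm (K' := K))//.
under eq_bigr do rewrite scaler_suml.
rewrite exchange_big; apply: eq_bigr => i _.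
by rewrite (op_sum lin_e e_idem e_comm (K' := K)).
Qed.
End OpMul.

(** * Expectations for the percolation *)

Section Expectation.
Variables (R : realType) (B W G : groupType) (L : lamp_group B W G).
Local Notation n := (lcard L).
Local Notation site := (bool * G)%type.
Local Notation H2 := (l2 R W).
Local Notation le := (@lamp_proj R B W G L).
Local Notation fibre := (@fibre R B W G L).
Local Notation d1 := (delta R (1 : W)%g).
Implicit Types (c : site -> bool) (K : seq site) (S : seq site).

Let hl := (@lin_lamp_proj R B W G L).
Let hi := (@lamp_proj_idem R B W G L).
Let hs := (@lamp_proj_sym R B W G L).
Let hc := (@lamp_proj_comm R B W G L).

Definition expect K (F : (site -> bool) -> R) : R := dot (op le K F d1) d1.

Lemma ract_dot r (f h : H2) : dot (ract r f) (ract r h) = dot f h.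
Proof. exact: (lin_isom_dot (lin_ract r) (sqn_ract r)). Qed.

(** Right translations commute with the lamp projections, so every point mass has the same joint
    spectral measure. *)
Lemma expect_delta K F (g : W) : dot (op le K F (delta R g)) (delta R g) = expect K F.
Proof.
rewrite -[in LHS](ract_delta R g) -(@comm_op _ _ _ le (@ract R W g)) ?ract_dot//; first exact: lin_ract.
by move=> v f; exact: ract_lamp_proj.
Qed.

Lemma expect_mono K F F' : uniq K -> (forall c, F (restr K c) <= F' (restr K c)) -> expect K F <= expect K F'.
Proof. by move=> uK h; apply: (dot_op_mono hl hi hs hc). Qed.

Lemma expect_sum K T (r : seq T) F : uniq K ->
  expect K (fun c => \sum_(i <- r) F i c) = \sum_(i <- r) expect K (F i).
Proof. by move=> uK; rewrite /expect (op_lincomb hl hi hc)// dot_suml. Qed.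

Lemma expectD K F F' : uniq K -> expect K (fun c => F c + F' c) = expect K F + expect K F'.
Proof.
move=> uK; have := @expect_sum K bool [:: true; false] (fun b => if b then F else F') uK.
rewrite !big_cons big_nil addr0 => <-; congr (expect K _); apply/funext => c.
by rewrite !big_cons big_nil addr0.
Qed.

Lemma expectB K F F' : uniq K -> expect K (fun c => F c - F' c) = expect K F - expect K F'.
Proof.
move=> uK; rewrite -[LHS](addrK (expect K F')) -expectD//; congr (expect K _ - _).
by apply/funext => c; rewrite subrK.
Qed.

Lemma expect_ge0 K F : uniq K -> (forall c, 0 <= F (restr K c)) -> 0 <= expect K F.
Proof.
move=> uK F0; have := @expect_sum K unit [::] (fun _ _ => 0) uK; rewrite [RHS]big_nil => e0.
by rewrite -e0; apply: expect_mono => // c; rewrite big_nil.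
Qed.

Lemma expect_widen K K' F : uniq K' -> {subset K <= K'} ->
  expect K F = expect K' (fun c => F (restr K c)).
Proof. by move=> uK' KK'; rewrite /expect (op_widen hl hi hc F d1 uK' KK'). Qed.

Lemma op_all K S f : uniq K -> {subset S <= K} ->
  op le K (fun c => (all c S)%:R) f = foldr le f S.
Proof.
move=> uK; elim: S => [_|v S ih SK]; first exact: (op_const hl hi hc).
rewrite [RHS]/= -ih; last by move=> z zS; apply: SK; rewrite inE zS orbT.
rewrite -(op_site hl hi hc)//; last by apply: SK; rewrite mem_head.
by congr op; apply/funext => c; rewrite /= -mulnb natrM.
Qed.

Lemma expect_all K S : uniq K -> {subset S <= K} -> pairwise (fun u v => ~~ same L u v) S ->
  expect K (fun c => (all c S)%:R) = (n%:R ^+ size S)^-1.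
Proof. by move=> uK SK pS; rewrite /expect op_all// dotC dot_delta lamp_trace. Qed.

(** Sites outside [K] are read as [false], so the probability can only drop when [K] misses some of
    [S]. *)
Lemma expect_all_le K S : uniq K -> pairwise (fun u v => ~~ same L u v) S ->
  expect K (fun c => (all c S)%:R) <= (n%:R ^+ size S)^-1.
Proof.
move=> uK pS; have [/allP SK|/allPn[z zS zK]] := boolP (all [in K] S).
  by rewrite expect_all.
apply: (@le_trans _ _ (expect K (fun=> 0))).
  apply: expect_mono => // c; rewrite lern0 eqb0; apply/allPn; exists z => //.
  by rewrite /restr (negbTE zK).
have -> : expect K (fun=> 0) = 0.
  have := @expectB K (fun=> 0) (fun=> 0) uK; rewrite [RHS]subrr => e0; rewrite -[RHS]e0.
  by congr expect; apply/funext => c; rewrite subrr.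
by rewrite invr_ge0 exprn_ge0.
Qed.

End Expectation.

(** * Pairing the hopping operator with the percolation *)

Section Pairing.
Variables (R : realType) (B W G : groupType) (L : lamp_group B W G).
Variables (I : finType) (sg : I -> B) (u : nat -> G) (t M : nat) (A : I -> seq nat).
Local Notation phi := (lphi L).
Local Notation pi := (lpi L).
Local Notation site := (bool * G)%type.
Local Notation X := (I * bool)%type.
Local Notation H2 := (l2 R W).
Local Notation le := (@lamp_proj R B W G L).
Local Notation fibre := (@fibre R B W G L).
Local Notation op := (op le).
Local Notation TL := (@truncated_hop R B W G L I sg u t M A).
Local Notation s := (letter L sg).
Local Notation xl := (letter_lift L sg).
Local Notation sites := (sites_of L s u M).
Local Notation out := (orient L s u t M A).
Local Notation FN := (tree_edge L s u t M A).
Local Notation step := (letter_step s).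
Local Notation bar := (@letter_bar I).
Local Notation ex := (@expect R B W G L).
Local Notation d1 := (delta R (1 : W)%g).
Implicit Types (c : site -> bool) (v g : G) (x : X) (Lam : {fset G}).

Hypothesis tM : (t <= M)%N.
Hypothesis AM : forall i j, j \in A i -> (j < M)%N.

Let hl := (@lin_lamp_proj R B W G L).
Let hi := (@lamp_proj_idem R B W G L).
Let hs := (@lamp_proj_sym R B W G L).
Let hc := (@lamp_proj_comm R B W G L).

Definition local_sites : seq site := sites [fset 1%g]%fset.
Definition isolated_ind c : R := (isolated L u t M c)%:R.
Definition open_ind j c : R := (open_pos L s u t M A j c)%:R.
Definition marked_vec : H2 := op local_sites isolated_ind d1.
(** The open neighbours of the vertex 1 along positive letters, each placed at the lift of its
    letter to [W]. *)
Definition open_vec : H2 := \sum_j op local_sites (open_ind j) (delta R (xl (j, false))).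

Lemma base_restr c z b : z \in base_sites L s u M -> restr local_sites c (b, z) = c (b, z).
Proof.
move=> zB; rewrite /restr.
have := @near_sitesP B W G L I s u M (enum_fset ([fset 1%g]%fset : {fset G})) (cycle_cutoff ([fset 1%g]%fset : {fset G}))
  1%g [::] z b (fset11 _) isT zB.
by rewrite /= !mul1g => ->.
Qed.

Lemma open_pos_restr j c : open_pos L s u t M A j (restr local_sites c) = open_pos L s u t M A j c.
Proof.
by apply: (open_letter_local tM AM (j, false)) => z b zB; exact: base_restr.
Qed.

Lemma isolated_restr c : isolated L u t M (restr local_sites c) = isolated L u t M c.
Proof.
apply: (isolated_local tM) => g j b gN jM; apply: base_restr.
by have := @base_sitesP B W G L I s u M 1%g g j (mem_head _ _) gN jM; rewrite mul1g.
Qed.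

Lemma open_pos_isolated j c : open_pos L s u t M A j c -> isolated L u t M c.
Proof. by case/and4P. Qed.

(** Distinct letters may represent the same group element. Parallel open edges form a cycle of
    length two, so no tree edge has a parallel open edge, and the cross terms of the pairing
    vanish. *)
Lemma two_cycle n c v x x' : (1 < n)%N -> open_edge L s u t M A c v x ->
  open_edge L s u t M A c v x' -> step v x = step v x' -> x != x' -> short_cycle L s u t M A n c v x.
Proof.
move=> n1 hx hx' e xx'; apply/asboolP; exists [:: bar x']; split=> //; split=> //=.
- by rewrite e stepK.
- by rewrite inE andbT eq_sym (open_edge_noloop hx).
- by rewrite hx e open_edge_bar hx'.
- by move=> y z [<- <-]; rewrite (inj_eq (inv_inj (@barK I))) eq_sym.
Qed.

Lemma pair_diag K F1 F2 (g : W) : uniq K ->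
  dot (op K F1 (delta R g)) (op K F2 (delta R g)) = ex K (fun c => F1 c * F2 c).
Proof. by move=> uK; rewrite (op_dot hl hi hs hc)// expect_delta. Qed.

Lemma pair_zero K F1 F2 (g g' : W) : uniq K ->
  (pi g = pi g' -> forall c, F1 (restr K c) * F2 (restr K c) = 0) ->
  dot (op K F1 (delta R g)) (op K F2 (delta R g')) = 0.
Proof.
move=> uK h; rewrite (op_dot hl hi hs hc)//.
have [e|ne] := eqVneq (pi g) (pi g').
  rewrite (op_ext hl hi hc (F' := fun=> 0 * (1 - 1)) (delta R g) uK); last first.
    by move=> c; rewrite h// mul0r.
  by rewrite (op_linF hl hi hc)// scale0r dot0l.
rewrite -(fibre_delta R L g') -(fibre_delta R L g) -fibre_op fibre_dot fibre_fibre.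
by rewrite (negbTE ne) dot0r.
Qed.

Lemma hop_delta K F F' (S : seq G) (g : W) : uniq K -> uniq S -> pi g \in S ->
  hop L sg K F S (op K F' (delta R g)) =
  \sum_x op K (fun c => F x (pi g) c * F' c) (delta R (g * xl x)%g).
Proof.
move=> uK uS gS; rewrite (@hop_restrict _ _ _ _ _ _ _ K F S [:: pi g])//; last first.
- by move=> v; rewrite inE => vg; rewrite fibre_op -(fibre_delta R L g) fibre_fibre (negbTE vg) op0//; exact: hl.
- by move=> v; rewrite inE => /eqP ->.
apply: eq_bigr => x _; rewrite big_seq1 fibre_op fibre_delta (op_op hl hi hc)//.
by rewrite ract_op -(ract_delta R g) -ractM ract_delta.
Qed.

(* An edge between 1 and [s j] is oriented by exactly one of its ends, and the two
   terms on the right count the two orientations. *)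
Lemma pairing Lam K : 1%g \in Lam -> (forall j, s j \in Lam) ->
  K = undup (local_sites ++ sites Lam) ->
  \sum_j ex K (fun c => (FN (cycle_cutoff Lam) c 1%g (j, false))%:R) <=
  dot (TL Lam marked_vec) open_vec + dot marked_vec (TL Lam open_vec).
Proof.
move=> L1 Ls KE; have uK : uniq K by rewrite KE; exact: undup_uniq.
have K0K : {subset local_sites <= K} by move=> z zK; rewrite KE mem_undup mem_cat zK.
have KLK : {subset sites Lam <= K} by move=> z zK; rewrite KE mem_undup mem_cat zK orbT.
pose Fo x v c : R := (out Lam (restr (sites Lam) c) v == Some x)%:R.
have vvE : marked_vec = op K isolated_ind d1.
  rewrite /marked_vec (op_widen hl hi hc isolated_ind d1 uK K0K); congr op.
  by apply/funext => c; rewrite /isolated_ind isolated_restr.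
have wwE : open_vec = \sum_j op K (open_ind j) (delta R (xl (j, false))).
  apply: eq_bigr => j _; rewrite (op_widen hl hi hc _ _ uK K0K); congr op.
  by apply/funext => c; rewrite /open_ind open_pos_restr.
have TLE f : TL Lam f = hop L sg K Fo Lam f.
  by rewrite /TL (@hop_widen _ _ _ _ _ _ _ (sites Lam) K).
have TLv : TL Lam marked_vec = \sum_x op K (fun c => Fo x 1%g c * isolated_ind c) (delta R (xl x)).
  rewrite TLE vvE hop_delta ?fset_uniq ?pi1//.
  by apply: eq_bigr => x _; rewrite mul1g.
have TLw : TL Lam open_vec = \sum_j \sum_x
    op K (fun c => Fo x (s j) c * open_ind j c) (delta R (xl (j, false) * xl x)%g).
  rewrite TLE wwE (lin_sum (@lin_hop _ _ _ _ _ _ _ _ _ _)); apply: eq_bigr => j _.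
  by rewrite hop_delta ?fset_uniq//; exact: Ls.
(* The [.+2] in [cycle_cutoff] makes cycles of length two count as short whatever the size of
   [Lam]. *)
have N1 : (1 < cycle_cutoff Lam)%N by [].
have oo c j : open_ind j c != 0 -> open_edge L s u t M A c 1%g (j, false).
  by rewrite /open_edge shift1 /open_letter /open_ind /=; case: open_pos; rewrite ?eqxx.
have FoP c x v : v \in Lam -> Fo x v c != 0 -> FN (cycle_cutoff Lam) c v x.
  move=> vL; rewrite /Fo pnatr_eq0 eqb0 negbK => /eqP /orientP[_ _].
  by rewrite (tree_edge_restr _ _ _ tM AM).
have sj j : step 1%g (j, false) = s j by rewrite /letter_step mul1g.
have D1 : dot (TL Lam marked_vec) open_vec = \sum_j ex K (fun c => (Fo (j, false) 1%g c * isolated_ind c) * open_ind j c).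
  rewrite TLv wwE dot_sumr; apply: eq_bigr => j _; rewrite dot_suml.
  rewrite (bigD1 (j, false)) // pair_diag// big1 => [|x xj]; first exact: addr0.
  apply: pair_zero => // e c; apply/eqP/negPn/negP; rewrite !mulf_eq0 !negb_or => /andP[/andP[Fx _] /oo Ox].
  have := FoP _ _ _ L1 Fx; case/and3P => [opx /negP nc _]; apply: nc.
  apply: two_cycle opx Ox _ xj => //.
  by rewrite sj /letter_step mul1g -pi_letter_lift e pi_letter_lift.
have D2 : dot marked_vec (TL Lam open_vec) = \sum_j ex K (fun c => isolated_ind c * (Fo (j, true) (s j) c * open_ind j c)).
  rewrite TLw vvE dot_sumr; apply: eq_bigr => j _; rewrite dot_sumr.
  rewrite (bigD1 (j, true)) //.
  have -> : (xl (j, false) * xl (j, true))%g = 1%g by rewrite /letter_lift mulgV.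
  rewrite pair_diag// big1 => [|x xj]; first exact: addr0.
  apply: pair_zero => // e c; apply/eqP/negPn/negP; rewrite !mulf_eq0 !negb_or => /andP[_ /andP[Fx /oo Ox]].
  have sx1 : step (s j) x = 1%g by rewrite /letter_step -(pi1 L) e lpiM !pi_letter_lift.
  have := FoP _ _ _ (Ls j) Fx; rewrite -tree_edge_bar sx1 => /and3P[opx /negP nc _]; apply: nc.
  apply: two_cycle opx Ox _ _ => //.
    by rewrite sj -sx1 stepK.
  by apply: contra xj => /eqP xe; rewrite -(barK x) xe.
rewrite D1 D2 -big_split; apply: ler_sum => j _ /=; rewrite -expectD//.
apply: expect_mono => // c; set c' := restr K c.
have := @orient_addb B W G L I s u t M A Lam (restr (sites Lam) c') 1%g (j, false) L1.
rewrite sj => /(_ (Ls j)).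
rewrite (tree_edge_restr _ _ _ tM AM)// => FE; case: (boolP (FN _ _ _ _)) FE => [|_ _]; last first.
  by rewrite addr_ge0 // ?mulr_ge0.
move=> /tree_edge_open; rewrite /open_edge shift1 /open_letter /= => oj.
rewrite /isolated_ind (open_pos_isolated oj) /open_ind oj !mulr1 mul1r /Fo -natrD => e.
rewrite ler_nat; move: e; rewrite -/(bar (j, false)).
by case: eqP => _; case: eqP.
Qed.

End Pairing.

(** A base belongs to at most two pairs, and two different tails share at most t places; so each
    pair adds at least a - t new places. *)
Lemma tails_size (G I : eqType) (A : I -> seq nat) (a t : nat) (Bs : seq (G * I)) :
  (forall i, uniq (A i)) -> (forall i, size (A i) = a) ->
  (forall i i', i != i' -> (count [in A i'] (A i) <= t)%N) ->
  uniq Bs -> (forall g, (count (fun p => p.1 == g) Bs <= 2)%N) ->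
  (size Bs * (a - t) <= size (undup [seq (p.1, j) | p <- Bs, j <- A p.2]))%N.
Proof.
move=> Au As Aa; elim: Bs => [//|[g i] Bs ih] /=/andP[gB uB] cB.
have ihB : (size Bs * (a - t) <= size (undup [seq (p.1, j) | p <- Bs, j <- A p.2]))%N.
  by apply: ih => // g'; apply: leq_trans (cB g'); rewrite leq_addl.
rewrite undup_cat size_cat mulSn leq_add//.
set Y := [seq (p.1, j) | p <- Bs, j <- A p.2].
have inj : injective (fun j : nat => (g, j)) by move=> j j' [].
rewrite undup_id ?map_inj_uniq// filter_map size_map.
rewrite size_filter; have := count_predC (fun j => (g, j) \in Y) (A i); rewrite As.
suff : (count (fun j => (g, j) \in Y) (A i) <= t)%N.
  by rewrite -[count (preim _ _) _]/(count (predC (fun j => (g, j) \in Y)) (A i)); lia.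
have cBs : (count (fun p : G * I => p.1 == g) Bs <= 1)%N by have := cB g; rewrite /= eqxx.
have [/hasP[[g' i'] pB /= /eqP gg]|/hasPn nB] := boolP (has (fun p : G * I => p.1 == g) Bs).
  subst g'; have ii : i != i' by apply: contra gB => /eqP ->.
  apply: leq_trans (Aa _ _ ii); apply: sub_count => j /=.
  move=> /allpairsPdep[[g2 i2] [j2 [p2B j2A [e1 e2]]]]; subst g2 j2.
  suff -> : i' = i2 by [].
  apply: contrapT => ne; move: cBs; rewrite leqNgt => /negP; apply.
  rewrite -size_filter; apply: (@uniq_leq_size _ [:: (g, i'); (g, i2)]).
    rewrite /= inE andbT; apply/eqP => -[]; exact: ne.
  by move=> z; rewrite !inE mem_filter => /orP[] /eqP -> /=; rewrite eqxx.
apply: leq_trans (leq0n _); rewrite leqn0 -leqn0 leqNgt -has_count; apply/hasPn => j _.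
by apply/allpairsPdep => -[[g2 i2] [j2 [p2B j2A [e1 e2]]]]; have := nB _ p2B; rewrite -e1 /= eqxx.
Qed.

(** * Probability estimates *)

Section CycleBases.
Variables (G : groupType) (I : finType) (s : I -> G).
Local Notation X := (I * bool)%type.
Local Notation step := (letter_step s).
Local Notation bar := (@letter_bar I).
Implicit Types (v g : G) (x : X) (w : seq X).

(** The tail of an edge sits at the origin of its positive letter, whichever way the edge is
    traversed. *)
Definition base v x : G := if x.2 then step v x else v.
Fixpoint bases v w : seq (G * I) :=
  if w is x :: w' then (base v x, x.1) :: bases (step v x) w' else [::].
Fixpoint heads v w : seq G :=
  if w is x :: w' then step v x :: heads (step v x) w' else [::].

Lemma size_bases v w : size (bases v w) = size w.
Proof. by elim: w v => //= x w ih v; rewrite ih. Qed.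
Lemma size_heads v w : size (heads v w) = size w.
Proof. by elim: w v => //= x w ih v; rewrite ih. Qed.

Lemma heads_trace v w : rcons (trace step v w) (foldl step v w) = v :: heads v w.
Proof. by elim: w v => //= x w ih v; rewrite ih. Qed.

Lemma nth_heads v w x0 g0 j : (j < size w)%N ->
  nth g0 (heads v w) j = step (nth g0 (trace step v w) j) (nth x0 w j).
Proof. by elim: w v j => //= x w ih v [|j] //= jw; rewrite ih. Qed.

Lemma nth_bases v w x0 p0 g0 j : (j < size w)%N -> nth p0 (bases v w) j =
  (base (nth g0 (trace step v w) j) (nth x0 w j), (nth x0 w j).1).
Proof. by elim: w v j => //= x w ih v [|j] //= jw; rewrite ih. Qed.

Lemma heads_rot v w : foldl step v w = v -> heads v w = rot 1 (trace step v w).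
Proof.
case: w => // x w vw; have := heads_trace v (x :: w); rewrite vw.
rewrite [trace _ _ _]/= rcons_cons => -[e].
by rewrite [LHS]/= -e [trace _ _ _]/= rot1_cons.
Qed.

Lemma count_bases v w g : (count (fun p => p.1 == g) (bases v w) <=
  count_mem g (trace step v w) + count_mem g (heads v w))%N.
Proof.
elim: w v => //= x w ih v; rewrite addnACA; apply: leq_add (ih _).
by rewrite /base; case: x.2; rewrite ?leq_addl// leq_addr.
Qed.

Variables (Fe : G -> X -> bool) (v : G) (w : seq X).
Hypothesis cw : is_cycle bar step Fe v w.

Let hw : heads v w = rot 1 (trace step v w).
Proof. by case: cw => _ vw _ _ _; exact: heads_rot. Qed.

Lemma uniq_heads : uniq (heads v w).
Proof. by rewrite hw rot_uniq; case: cw. Qed.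

Lemma count_bases2 g : (count (fun p => p.1 == g) (bases v w) <= 2)%N.
Proof.
apply: leq_trans (count_bases v w g) _.
rewrite !count_uniq_mem ?uniq_heads//; last by case: cw.
by rewrite -[2%N]/(1 + 1)%N leq_add// leq_b1.
Qed.

Lemma base_trace p : p \in bases v w -> p.1 \in trace step v w.
Proof.
move=> /(nthP (1%g, p.2))[j]; rewrite size_bases => jw <-.
have [x0 _] : exists x0 : X, True by case: (w) jw => // x0; exists x0.
rewrite (nth_bases v x0 _ 1%g)// /base; case: ifP => _; last by rewrite mem_nth// size_trace.
by rewrite -nth_heads// -(mem_rot 1) -hw mem_nth// size_heads.
Qed.

(** A repeated pair means that one edge is used twice. In the same direction this repeats a vertex;
    in opposite directions it forces length two with the second letter undoing the first, which
    [is_cycle] excludes. *)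
Lemma uniq_bases : uniq (bases v w).
Proof.
case: (cw) => w2 vw uT _ w2P.
case Ew : w w2 => [//|x0 w'] w2; rewrite -Ew in w2 *.
have {}w2 : (1 < size w)%N by exact: w2.
set T := trace step v w in uT; set Hd := heads v w.
have ntri j k : (j < size w)%N -> (k < size w)%N -> (nth x0 w j).2 = false ->
    (nth x0 w k).2 = true -> (nth x0 w j).1 = (nth x0 w k).1 ->
    nth 1%g T j = nth 1%g Hd k -> False.
  move=> jw kw bj bk e1 e2.
  have xb : nth x0 w k = bar (nth x0 w j).
    by move: bj bk e1; case: (nth x0 w j) => i b; case: (nth x0 w k) => i' b' /= -> -> ->.
  have e3 : nth 1%g Hd j = nth 1%g T k.
    by rewrite (nth_heads v x0)// e2 (nth_heads v x0)// -[nth x0 w j](@barK I) -xb stepK.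
  have nH i : (i < size w)%N ->
      nth 1%g Hd i = nth 1%g T (if (i.+1 < size w)%N then i.+1 else 0%N).
    move=> iw; have := congr1 (fun z => nth 1%g z i) (heads_trace v w).
    have := congr1 (fun z => nth 1%g z i.+1) (heads_trace v w).
    rewrite /= vw => <- _; rewrite nth_rcons size_trace.
    case: ltnP => // wi; have -> : i.+1 = size w by apply/eqP; rewrite eqn_leq iw.
    by rewrite eqxx /T; case: (w) w2.
  have inj i i' : (i < size w)%N -> (i' < size w)%N -> nth 1%g T i = nth 1%g T i' -> i = i'.
    by move=> iw iw' /eqP; rewrite nth_uniq ?size_trace// => /eqP.
  have w0 : (0 < size w)%N by exact: leq_trans w2.
  rewrite nH// in e2; rewrite nH// in e3.
  have bnd i : ((if (i.+1 < size w)%N then i.+1 else 0%N) < size w)%N by case: ifP.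
  have k1 := inj j _ jw (bnd k) e2; have j1 := inj _ k (bnd j) kw e3.
  have sz2 : size w = 2%N /\ ((j = 0 /\ k = 1) \/ (j = 1 /\ k = 0))%N.
    by move: k1 j1; case: (ltnP k.+1 (size w)) => h1; case: (ltnP j.+1 (size w)) => h2 /= k1 j1; lia.
  case: sz2 => sz jk; case E2 : w sz => [|y [|z [|]]] // _.
  have := w2P y z E2.
  move: xb; rewrite E2; case: jk => -[-> ->] /= ->; first by rewrite eqxx.
  by rewrite barK eqxx.
apply/(uniqP (1%g, x0.1)) => j k; rewrite !inE !size_bases => jw kw.
rewrite !(nth_bases v x0 _ 1%g)// => -[]; rewrite /base.
have injT : nth 1%g T j = nth 1%g T k -> j = k.
  by move=> /eqP; rewrite nth_uniq ?size_trace// => /eqP.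
have injH : nth 1%g Hd j = nth 1%g Hd k -> j = k.
  by move=> /eqP; rewrite nth_uniq ?size_heads ?uniq_heads// => /eqP.
case bj : (nth x0 w j).2; case bk : (nth x0 w k).2; rewrite -?nth_heads//.
- by move=> /injH.
- by move=> e1 e2; exfalso; apply: (ntri k j).
- by move=> e1 e2; exfalso; apply: (ntri j k).
- by move=> /injT.
Qed.

End CycleBases.

(** * Probability of a given open cycle *)

Section CycleProbability.
Variables (R : realType) (B W G : groupType) (L : lamp_group B W G).
Variables (I : finType) (s : I -> G) (u : nat -> G) (t M a : nat) (A : I -> seq nat).
Local Notation n := (lcard L).
Local Notation site := (bool * G)%type.
Local Notation X := (I * bool)%type.
Local Notation step := (letter_step s).
Local Notation bar := (@letter_bar I).
Local Notation ex := (@expect R B W G L).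
Local Notation opn_at := (open_edge L s u t M A).
Local Notation yev := (isolated L u t M).
Implicit Types (c : site -> bool) (v g : G) (x : X) (w : seq X).

Hypothesis sparse : forall m i j k h h', (i < m)%N -> (j < m)%N -> (k < m)%N ->
  h \in hall L -> h' \in hall L -> u m != (u j * h * (u i)^-1 * u k * h')%g.
Hypothesis tM : (t <= M)%N.
Hypothesis Au : forall i, uniq (A i).
Hypothesis As : forall i, size (A i) = a.
Hypothesis At : forall i j, j \in A i -> (t <= j)%N.
Hypothesis AM : forall i j, j \in A i -> (j < M)%N.
Hypothesis Aa : forall i i', i != i' -> (count [in A i'] (A i) <= t)%N.

Lemma sub_hall b h : h \in lsub L b -> h \in hall L.
Proof. by rewrite mem_cat; case: b => ->; rewrite ?orbT. Qed.

Lemma u_classes i j b : ((u i)^-1 * u j)%g \in lsub L b -> i = j.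
Proof.
have lt k l : (k < l)%N -> ((u k)^-1 * u l)%g \in lsub L b -> False.
  move=> kl h; have := sparse kl kl kl (sub_hall (lsub1 L b)) (sub_hall h).
  by rewrite mulg1 mulgV mul1g mulVKg eqxx.
move=> h; case: (ltngtP i j) => // ij; exfalso; first exact: lt ij h.
by apply: lt ij _; have := lsubV h; rewrite invgM invgK.
Qed.

Lemma overlapP v v' i j b : (i < M)%N -> (j < M)%N -> v != v' ->
  ((v * u i)^-1 * (v' * u j) \in lsub L b)%g -> (v^-1 * v' \in overlap L u M)%g.
Proof.
move=> iM jM vv' h; rewrite mem_filter; apply/andP; split.
  by apply: contra vv' => /eqP e; rewrite -[v']mul1g -(mulgV v) -mulgA e mulg1.
apply/mapP; exists ((i, j), ((v * u i)^-1 * (v' * u j))%g).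
  apply/allpairsP; exists ((i, j), ((v * u i)^-1 * (v' * u j))%g); split=> //; last exact: sub_hall h.
  by apply/allpairsP; exists (i, j); rewrite !mem_iota.
by rewrite /= invgM -!mulgA mulgV mulg1 mulVKg.
Qed.

Lemma open_edge_isolated c v x : opn_at c v x -> yev (shift v c).
Proof.
rewrite /open_edge /open_letter /open_pos; case: x => i [] /= /and4P[_ y1 y2 _] //.
by move: y2; rewrite shiftM mulVg shift1.
Qed.

Lemma along_isolated c v w g : along step (opn_at c) v w -> g \in trace step v w -> yev (shift g c).
Proof.
elim: w v => //= x w ih v /andP[ox al]; rewrite inE => /orP[/eqP ->|]; last exact: ih.
exact: open_edge_isolated ox.
Qed.

Lemma along_tail c v w p j : along step (opn_at c) v w -> p \in bases s v w -> j \in A p.2 ->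
  c (false, p.1 * u j)%g.
Proof.
elim: w v => //= x w ih v /andP[ox al]; rewrite inE => /orP[/eqP ->|pw]; last exact: ih al pw.
rewrite /base /= => jA; move: ox; rewrite /open_edge /open_letter /open_pos.
case: x jA {al} => i [] /= jA /and4P[_ _ _ /allP /(_ _ jA)]; rewrite /shift //=.
by rewrite mulgA.
Qed.

Lemma isolated_marked c v : yev (shift v c) ->
  (forall b j, (j < t)%N -> c (b, v * u j)%g) /\
  (forall g, g \in overlap L u M -> ~~ marked u t (shift (v * g)%g c)).
Proof.
case/andP => /allP mk /allP ov; split=> [b j jt|g gO].
  by have := mk j; rewrite mem_iota jt => /(_ isT) /andP[]; case: b.
by have := ov g gO; rewrite shiftM.
Qed.

Definition lamp_pos (z : bool * (G * nat)) : site := (z.1, z.2.1 * u z.2.2)%g.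

Lemma lamp_pos_same (S : seq G) z z' :
  (forall v v', v \in S -> v' \in S -> v != v' -> (v^-1 * v')%g \notin overlap L u M) ->
  z.2.1 \in S -> z'.2.1 \in S -> (z.2.2 < M)%N -> (z'.2.2 < M)%N -> z != z' ->
  ~~ same L (lamp_pos z) (lamp_pos z').
Proof.
case: z z' => b [v i] [b' [v' j]] /= nov vS v'S iM jM zz'.
apply/negP => /andP[/= /eqP ebb' h]; subst b'.
have [evv'|vv'] := eqVneq v v'.
  subst v'; move: h; rewrite invgM -mulgA mulKg => /u_classes eij.
  by rewrite eij eqxx in zz'.
by have := nov _ _ vS v'S vv'; rewrite (overlapP iM jM vv' h).
Qed.

Lemma expect_false K (F : (site -> bool) -> R) : uniq K -> (forall c, F (restr K c) = 0) -> ex K F = 0.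
Proof.
move=> uK F0; apply/eqP; rewrite eq_le expect_ge0 ?andbT//; last by move=> c; rewrite F0.
have : 0 <= ex K (fun c => 0 - F c) by apply: expect_ge0 => // c; rewrite F0 subr0.
rewrite expectB// => h.
have : 0 <= ex K (fun=> 0 : R) by apply: expect_ge0.
move: h; have -> : ex K (fun=> 0 : R) = 0; last by lra.
have := @expectB R B W G L K (fun=> 0) (fun=> 0) uK; rewrite [RHS]subrr => e0; rewrite -[RHS]e0.
by congr ex; apply/funext => c; rewrite subrr.
Qed.

(** An open cycle lights 2t marking lamps at each vertex and all tails along its edges. Isolation
    and sparsity make the lamps listed here distinct, and [tails_size] counts at least a - t tail
    lamps per edge. *)
Lemma cycle_probability K v w : uniq K ->
  ex K (fun c => `[< is_cycle bar step (opn_at c) v w >]%:R) <=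
  (n%:R ^+ ((2 * t + (a - t)) * size w))^-1.
Proof.
move=> uK; pose E c := is_cycle bar step (opn_at c) v w.
have n0 : 0 <= (n%:R ^+ ((2 * t + (a - t)) * size w))^-1 :> R by rewrite invr_ge0 exprn_ge0.
have [[c0 cw]|nE] := pselect (exists c, E c); last first.
  rewrite expect_false// => c; case: asboolP => // h; case: nE; exists (restr K c); exact: h.
set T := trace step v w.
(* If two vertices of the walk may share a lamp, they cannot both be isolated and the event is
   empty. *)
have [ov|nov] := pselect (exists v1 v2, [/\ v1 \in T, v2 \in T & (v1^-1 * v2)%g \in overlap L u M]).
  rewrite expect_false// => c; case: asboolP => // -[_ _ _ al _]; exfalso.
  case: ov => v1 [v2 [T1 T2 ov]].
  have [_ /(_ _ ov)] := isolated_marked (along_isolated al T1); rewrite mulVKg => /negP; apply.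
  by have /andP[] := along_isolated al T2.
have nov' v1 v2 : v1 \in T -> v2 \in T -> v1 != v2 -> (v1^-1 * v2)%g \notin overlap L u M.
  by move=> T1 T2 _; apply/negP => h; apply: nov; exists v1, v2.
pose Z1 := [seq (bj.1, (g, bj.2)) | g <- T, bj <- [seq (b, j) | b <- [:: true; false], j <- iota 0 t]].
pose D := undup [seq (p.1, j) | p <- bases s v w, j <- A p.2].
pose Z2 := [seq (false, d) | d <- D].
have DP d : d \in D -> exists2 p, p \in bases s v w & d.1 = p.1 /\ d.2 \in A p.2.
  by rewrite mem_undup => /allpairsPdep[p [j [pB jA ->]]]; exists p.
have Z1P z : z \in Z1 -> z.2.1 \in T /\ (z.2.2 < t)%N.
  move=> /allpairsP[[g [b j]] [gT /allpairsP[[b' j'] [_ /= jt e]] ->]] /=.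
  by move: jt; rewrite mem_iota; case: e => _ ->.
have ZP z : z \in Z1 ++ Z2 -> z.2.1 \in T /\ (z.2.2 < M)%N.
  rewrite mem_cat => /orP[/Z1P[h1 h2]|]; first by split=> //; exact: leq_trans h2 tM.
  move=> /mapP[d /DP[p pB [e jA]] ->] /=; split; last exact: AM jA.
  by rewrite e; apply: (base_trace cw).
have uT : uniq T by case: cw.
have uZ : uniq (Z1 ++ Z2).
  rewrite cat_uniq; apply/and3P; split.
  - apply: allpairs_uniq => //; last by move=> [g [b j]] [g' [b' j']] _ _ /= [-> -> ->].
    by apply: allpairs_uniq => //; [exact: iota_uniq|move=> [b j] [b' j'] _ _ /= [-> ->]].
  - apply/hasPn => _ /mapP[d /DP[p pB [_ jA]] ->]; apply/negP => /Z1P[_ /=].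
    by rewrite ltnNge (At jA).
  - by rewrite map_inj_uniq ?undup_uniq// => d d' [].
have sZ : ((2 * t + (a - t)) * size w <= size (Z1 ++ Z2))%N.
  rewrite size_cat size_map !size_allpairs size_iota /= size_trace mulnDl.
  rewrite [(2 * t * _)%N]mulnC leq_add2l.
  have := @tails_size G I A a t (bases s v w) Au As Aa (uniq_bases cw) (count_bases2 cw).
  by rewrite size_bases mulnC.
apply: (@le_trans _ _ (ex K (fun c => (all c (map lamp_pos (Z1 ++ Z2)))%:R))).
  apply: expect_mono => // c; case: asboolP => // -[_ _ _ al _].
  rewrite ler_nat lt0b all_map; apply/allP => z /=; rewrite mem_cat => /orP[].
    move=> /[dup] /Z1P[zT zt] _; rewrite /lamp_pos.
    by have [h _] := isolated_marked (along_isolated al zT); exact: h.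
  by move=> /mapP[d /DP[p pB [e jA]] ->]; rewrite /lamp_pos /= e; exact: along_tail al pB jA.
apply: le_trans (expect_all_le R uK _) _.
  rewrite pairwise_map; have : uniq (Z1 ++ Z2) by [].
  rewrite uniq_pairwise; apply: (@sub_in_pairwise _ [in Z1 ++ Z2]); last by apply/allP.
  move=> z z' /ZP[zT zM] /ZP[z'T z'M] /= zz'; exact: lamp_pos_same nov' zT z'T zM z'M zz'.
have n1 : 1 <= n%:R :> R by rewrite ler1n ltnW// lcard_gt1.
rewrite size_map lef_pV2 ?posrE ?exprn_gt0 ?(lt_le_trans ltr01)//.
exact: ler_weXn2l.
Qed.

End CycleProbability.

(** * Lower bound for the probability of an open edge *)

Section OpenLowerBound.
Variables (R : realType) (B W G : groupType) (L : lamp_group B W G).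
Variables (I : finType) (s : I -> G) (u : nat -> G) (t M a : nat) (A : I -> seq nat).
Local Notation n := (lcard L).
Local Notation site := (bool * G)%type.
Local Notation ex := (@expect R B W G L).
Local Notation overlap := (overlap L u M).
Implicit Types (c : site -> bool) (v g : G).

Hypothesis sparse : forall m i j k h h', (i < m)%N -> (j < m)%N -> (k < m)%N ->
  h \in hall L -> h' \in hall L -> u m != (u j * h * (u i)^-1 * u k * h')%g.
Hypothesis tM : (t <= M)%N.
Hypothesis Au : forall i, uniq (A i).
Hypothesis As : forall i, size (A i) = a.
Hypothesis At : forall i j, j \in A i -> (t <= j)%N.
Hypothesis AM : forall i j, j \in A i -> (j < M)%N.

(** The elements g for which g u_i and u_i can carry the same lamp for some i. Sparsity does not
    limit such coincidences. *)
Definition diagonal : seq G :=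
  [seq (u p.1 * p.2 * (u p.1)^-1)%g | p <- [seq (i, h) | i <- iota 0 M, h <- hall L]].

(** Letters for which the windows at the two ends of an edge may meet, or for which an overlapping
    translate of one window is a diagonal translate of the other. *)
Definition bad : seq G := 1%g :: overlap ++ [seq g^-1%g | g <- overlap] ++
  [seq (g * d)%g | g <- overlap, d <- diagonal] ++
  [seq (d * g^-1)%g | g <- overlap, d <- diagonal].

Lemma diagonalP i b h : (i < M)%N -> h \in lsub L b -> (u i * h * (u i)^-1)%g \in diagonal.
Proof.
move=> iM hh; apply/mapP; exists (i, h) => //; apply/allpairsP; exists (i, h).
by rewrite mem_iota; split=> //; exact: sub_hall hh.
Qed.

(** A coincidence determines g as u_j h u_i^-1. If a second one involved a larger index, the latter
    term of [u] would be a product of the excluded shape. *)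
Lemma same_max g b i j k l : i != j -> k != l ->
  ((g * u i)^-1 * u j \in lsub L b)%g -> ((g * u k)^-1 * u l \in lsub L b)%g ->
  maxn i j = maxn k l.
Proof.
have lt i' j' k' l' : i' != j' -> k' != l' -> ((g * u i')^-1 * u j' \in lsub L b)%g ->
    ((g * u k')^-1 * u l' \in lsub L b)%g -> (maxn i' j' < maxn k' l')%N -> False.
  move=> ij kl; set h := (_ * u j')%g; set h' := (_ * u l')%g => hb hb'.
  have gE : g = (u j' * h^-1 * (u i')^-1)%g.
    by rewrite /h !invgM !invgK !mulgA mulgV mul1g mulgK.
  have h'E : h' = ((g * u k')^-1 * u l')%g by [].
  clearbody h h'; have [hh hh'] := (sub_hall hb, sub_hall hb').
  have [vh vh'] := (sub_hall (lsubV hb), sub_hall (lsubV hb')).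
  rewrite gtn_max => /andP[i'm j'm]; case: (ltngtP k' l') kl => // kl _.
    rewrite (maxn_idPr (ltnW kl)) in i'm j'm.
    have /eqP := sparse i'm j'm kl vh hh'; apply.
    by rewrite -gE h'E invgM !mulgA mulgK mulgV mul1g.
  rewrite (maxn_idPl (ltnW kl)) in i'm j'm.
  have /eqP := sparse j'm i'm kl hh vh'; apply.
  have -> : (u i' * h * (u j')^-1 = g^-1)%g by rewrite gE !invgM !invgK !mulgA.
  by rewrite h'E !invgM !invgK !mulgA mulgK mulVg mul1g.
move=> ij kl h h'; case: (ltngtP (maxn i j) (maxn k l)) => // e; exfalso.
  exact: lt ij kl h h' e.
exact: lt kl ij h' h e.
Qed.

Definition collides b g i := has (fun j => (g * u i)^-1 * u j \in lsub L b)%g (iota 0 M).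

(** By [same_max] all coincidences have the same larger index m: either i = m, or j = m, and then i
    is determined by its coset. *)
Lemma collide_le b g : (forall i, (i < M)%N -> ((g * u i)^-1 * u i \notin lsub L b)%g) ->
  (count (collides b g) (iota 0 t) <= 2)%N.
Proof.
move=> nd; rewrite -size_filter; set S := [seq i <- _ | _].
have uS : uniq S by rewrite filter_uniq// iota_uniq.
have SP i : i \in S -> exists2 j, i != j & ((g * u i)^-1 * u j \in lsub L b)%g.
  rewrite mem_filter => /andP[/hasP[j _ h]]; rewrite mem_iota => /andP[_ it].
  exists j => //; apply/eqP => ij; subst j; have := nd i (leq_trans it tM).
  by rewrite h.
case ES : S => [|i1 [|i2 [|i3 S']]] //; exfalso.
have [i1S i2S i3S] : [/\ i1 \in S, i2 \in S & i3 \in S] by rewrite ES !inE !eqxx ?orbT.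
have [j1 n1 h1] := SP _ i1S; have [j2 n2 h2] := SP _ i2S; have [j3 n3 h3] := SP _ i3S.
have m12 := same_max n1 n2 h1 h2; have m13 := same_max n1 n3 h1 h3.
have := uS; rewrite ES /= !inE !negb_or => /andP[/and3P[i12 i13 _] /andP[/andP[i23 _] _]].
have col i i' j : ((g * u i)^-1 * u j \in lsub L b)%g -> ((g * u i')^-1 * u j \in lsub L b)%g ->
    i = i'.
  move=> h h'; apply: (u_classes sparse (b := b)).
  have := lsubM h (lsubV h'); rewrite !invgM !invgK !mulgA.
  by rewrite mulgK mulgVK.
have : j1 = j2 \/ j1 = j3 \/ j2 = j3.
  by move: n1 n2 n3 i12 i13 i23 m12 m13; clear; lia.
case=> [e|[e|e]]; subst.
- by rewrite (col _ _ _ h1 h2) eqxx in i12.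
- by rewrite (col _ _ _ h1 h3) eqxx in i13.
- by rewrite (col _ _ _ h2 h3) eqxx in i23.
Qed.

Variable i : I.
Hypothesis good : s i \notin bad.

Let nov v v' : v \in [:: 1%g; s i] -> v' \in [:: 1%g; s i] -> v != v' ->
  (v^-1 * v')%g \notin overlap.
Proof.
move: good; rewrite /bad inE !mem_cat !negb_or => /and5P[_ g1 g2 _ _].
rewrite !inE => /orP[] /eqP -> /orP[] /eqP ->; rewrite ?eqxx// => _.
  by rewrite invg1 mul1g.
rewrite mulg1; apply: contra g2 => h; apply/mapP; exists ((s i)^-1)%g => //.
by rewrite invgK.
Qed.

(** The lamps that an open edge from 1 to [s i] needs, apart from the isolation of its ends: both
    markings and the tail. *)
Definition core_pos : seq (bool * (G * nat)) :=
  [seq (bj.1, (g, bj.2)) | g <- [:: 1%g; s i],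
     bj <- [seq (b, j) | b <- [:: true; false], j <- iota 0 t]] ++
  [seq (false, (1%g, j)) | j <- A i].
Definition core : seq site := map (lamp_pos u) core_pos.

Lemma core_posP z : z \in core_pos -> z.2.1 \in [:: 1%g; s i] /\ (z.2.2 < M)%N.
Proof.
rewrite mem_cat => /orP[/allpairsP[[g [b j]] [gT /allpairsP[[b' j'] [_ jt e]] ->]]|/mapP[j jA ->]].
  split=> //; apply: leq_trans tM; move: jt; rewrite mem_iota.
  by case: e => _ -> /=.
by split; [rewrite mem_head|exact: AM jA].
Qed.

Lemma core_pairwise : pairwise (fun x y => ~~ same L x y) core.
Proof.
have s1 : s i != 1%g by move: good; rewrite inE negb_or => /andP[].
have uZ : uniq core_pos.
  rewrite cat_uniq; apply/and3P; split.
  - apply: allpairs_uniq; [by rewrite /= inE eq_sym s1| |by move=> [g [b j]] [g' [b' j']] _ _ [-> -> ->]].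
    by apply: allpairs_uniq => //; [exact: iota_uniq|move=> [b j] [b' j'] _ _ /= [-> ->]].
  - apply/hasPn => _ /mapP[j jA ->]; apply/negP => /allpairsP[[g [b j']] [_ /allpairsP[[b2 j2] [_ jt e]] /= [_ _ e2]]].
    case: e => _ e3; move: jt; rewrite /= mem_iota -e3 -e2 => /andP[_].
    by rewrite ltnNge (At jA).
  - by rewrite map_inj_uniq ?Au// => j j' [].
rewrite pairwise_map; move: uZ; rewrite uniq_pairwise.
apply: (@sub_in_pairwise _ [in core_pos]); last by apply/allP.
by move=> z z' /core_posP[zT zM] /core_posP[z'T z'M] zz'; exact: (lamp_pos_same sparse nov zT z'T zM z'M zz').
Qed.

Lemma size_core : size core = (4 * t + a)%N.
Proof.
rewrite size_map size_cat size_map As; congr (_ + _)%N.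
by rewrite !size_allpairs size_iota mulnA.
Qed.

(** The window at g meets each of the two windows of the edge, tail included, at most twice in
    family [b]; so at least t - 4 of its lamps are new. *)
Lemma marked_twice K g b : uniq K ->
  (forall v j, v \in [:: 1%g; s i] -> (j < M)%N -> ((v^-1 * g * u j)^-1 * u j \notin lsub L b)%g) ->
  ex K (fun c => (all c core && marked u t (shift g c))%:R) <= (n%:R ^+ (4 * t + a + (t - 4)))^-1.
Proof.
move=> uK nd.
pose J := [seq j <- iota 0 t | ~~ (collides b g j || collides b ((s i)^-1 * g)%g j)].
pose V := [seq (b, g * u j)%g | j <- J].
have sJ : (t - 4 <= size J)%N.
  have c1 : (count (collides b g) (iota 0 t) <= 2)%N.
    apply: collide_le => j jM; have := nd 1%g j (mem_head _ _) jM.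
    by rewrite invg1 mul1g.
  have c2 : (count (collides b ((s i)^-1 * g)%g) (iota 0 t) <= 2)%N.
    by apply: collide_le => j jM; apply: (nd (s i) j) => //; rewrite !inE eqxx orbT.
  have := count_predUI (collides b g) (collides b ((s i)^-1 * g)%g) (iota 0 t).
  have := count_predC (predU (collides b g) (collides b ((s i)^-1 * g)%g)) (iota 0 t).
  rewrite size_iota size_filter.
  rewrite -[count (predC _) _]/(count (fun j => ~~ (collides b g j || collides b ((s i)^-1 * g)%g j)) (iota 0 t)).
  by lia.
have uJ : uniq J by rewrite filter_uniq// iota_uniq.
have JP j : j \in J -> [/\ (j < t)%N, ~~ collides b g j & ~~ collides b ((s i)^-1 * g)%g j].
  by rewrite mem_filter negb_or mem_iota => /andP[/andP[-> ->] /andP[_ ->]].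
have pV : pairwise (fun x y => ~~ same L x y) (core ++ V).
  rewrite pairwise_cat core_pairwise /=; apply/andP; split.
    apply/allrelP => _ _ /mapP[[b' [v k]] zC ->] /mapP[j jJ ->].
    have [/= vT kM] := core_posP zC; have [_ n1 n2] := JP _ jJ.
    rewrite same_sym /same /lamp_pos /=; apply/negP => /andP[/eqP ebb' h]; subst b'.
    move: vT; rewrite !inE => /orP[/eqP e|/eqP e]; subst v.
      by case/hasP: n1; exists k; rewrite ?mem_iota//; move: h; rewrite mul1g.
    case/hasP: n2; exists k; rewrite ?mem_iota//; move: h.
    by rewrite !invgM !invgK !mulgA.
  rewrite pairwise_map; move: uJ; rewrite uniq_pairwise; apply: sub_pairwise => j j' /= jj'.
  rewrite /same eqxx /=; apply: contra jj' => h; apply/eqP.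
  apply: (u_classes sparse (b := b)); move: h.
  by rewrite invgM -mulgA mulKg.
apply: (@le_trans _ _ (ex K (fun c => (all c (core ++ V))%:R))).
  apply: expect_mono => // c; rewrite ler_nat all_cat.
  case: (all _ core) => //=; case mk: (marked _ _ _) => //; rewrite lt0b.
  apply/allP => _ /mapP[j /JP[jt _ _] ->].
  move/allP: mk => /(_ j); rewrite mem_iota jt => /(_ isT) /andP[].
  by case: (b).
apply: le_trans (expect_all_le R uK pV) _.
have n1 : 1 <= n%:R :> R by rewrite ler1n ltnW// lcard_gt1.
rewrite size_cat size_core size_map lef_pV2 ?posrE ?exprn_gt0 ?(lt_le_trans ltr01)//.
by rewrite ler_weXn2l// leq_add2l.
Qed.

Lemma diag_inv j g b : (j < M)%N -> ((g * u j)^-1 * u j \in lsub L b)%g ->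
  exists2 h, h \in lsub L b & (g = u j * h * (u j)^-1)%g.
Proof.
move=> jM h; exists ((g * u j)^-1 * u j)^-1%g; first exact: lsubV.
by rewrite !invgM !invgK !mulgA mulgV mul1g mulgK.
Qed.

Lemma bad_l g d : g \in overlap -> d \in diagonal -> s i != (g * d)%g.
Proof.
move=> gO dD; apply: contra good => /eqP ->; rewrite inE !mem_cat.
by apply/orP; right; apply/or4P; constructor 3; apply/allpairsP; exists (g, d).
Qed.

Lemma bad_r g d : g \in overlap -> d \in diagonal -> s i != (d * g^-1)%g.
Proof.
move=> gO dD; apply: contra good => /eqP ->; rewrite inE !mem_cat.
by apply/orP; right; apply/or4P; constructor 4; apply/allpairsP; exists (g, d).
Qed.

(** Diagonal coincidences in both families would make g conjugate into both subgroups, hence trivial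
    by [lsub_conj]. This is the purpose of having two families of lamps. *)
Lemma good_type g : g \in overlap -> exists b,
  forall j, (j < M)%N -> ((g * u j)^-1 * u j \notin lsub L b)%g.
Proof.
move=> gO; apply: contrapT => /forallNP h.
have dg b : exists j h, h \in lsub L b /\ (g = u j * h * (u j)^-1)%g.
  apply: contrapT => nd; apply: (h b) => j jM; apply/negP => hb; apply: nd.
  by have [h1 h1b gE] := diag_inv jM hb; exists j, h1.
have [j [h1 [h1b gE]]] := dg false; have [j' [h2 [h2b gE']]] := dg true.
have h11 := lsub_conj h1b h2b (etrans (esym gE) gE').
by move: gO; rewrite mem_filter gE h11 mulg1 mulgV eqxx.
Qed.

(** In the family given by [good_type], the translate has no diagonal coincidence with the window at
    its own end; with the window at the other end, one would make [s i] a bad letter. *)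
Lemma marked_overlap K g : uniq K -> g \in overlap ->
  ex K (fun c => (all c core && marked u t (shift g c))%:R) +
  ex K (fun c => (all c core && marked u t (shift (s i * g)%g c))%:R) <=
  2 * (n%:R ^+ (4 * t + a + (t - 4)))^-1.
Proof.
move=> uK gO; have [b nd] := good_type gO.
rewrite mulr_natl mulr2n; apply: lerD; apply: (marked_twice (b := b) uK) => v j.
  rewrite !inE => /orP[] /eqP -> jM; first by rewrite invg1 mul1g nd.
  apply/negP => hb; have [h hh e] := diag_inv jM hb.
  have := bad_l gO (diagonalP jM (lsubV hh)).
  rewrite -[X in X != _](mulgK ((s i)^-1 * g)%g) {2}e => /eqP; apply.
  by rewrite !invgM !invgK !mulgA mulgV mul1g.
rewrite !inE => /orP[] /eqP -> jM; last by rewrite mulKg nd.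
rewrite invg1 mul1g; apply/negP => hb; have [h hh e] := diag_inv jM hb.
by have := bad_r gO (diagonalP jM hh); rewrite -e mulgK eqxx.
Qed.

(** Union bound: when all lamps of [core] are lit, the edge is closed only if some overlapping
    translate of one of its two ends is marked too. *)
Lemma open_probability K : uniq K -> {subset core <= K} ->
  (n%:R ^+ (4 * t + a))^-1 - 2 * (size overlap)%:R * (n%:R ^+ (4 * t + a + (t - 4)))^-1
  <= ex K (fun c => (open_pos L s u t M A i c)%:R).
Proof.
move=> uK cK; rewrite -size_core -(expect_all R uK cK core_pairwise) size_core lerBlDr.
have -> : 2 * (size overlap)%:R * (n%:R ^+ (4 * t + a + (t - 4)))^-1 =
    \sum_(g <- overlap) 2 * (n%:R ^+ (4 * t + a + (t - 4)))^-1 :> R.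
  by rewrite big_const_seq count_predT iter_addr_0 -[RHS]mulr_natr; ring.
have hs : \sum_(g <- overlap) (ex K (fun c => (all c core && marked u t (shift g c))%:R) +
    ex K (fun c => (all c core && marked u t (shift (s i * g)%g c))%:R)) <=
    \sum_(g <- overlap) 2 * (n%:R ^+ (4 * t + a + (t - 4)))^-1.
  by rewrite big_seq [leRHS]big_seq; apply: ler_sum => g; exact: marked_overlap uK.
apply: le_trans (lerD (lexx _) hs).
rewrite big_split /=.
rewrite -(expect_sum L overlap (fun g c => (all c core && marked u t (shift g c))%:R) uK).
rewrite -(expect_sum L overlap (fun g c => (all c core && marked u t (shift (s i * g)%g c))%:R) uK).
rewrite -!expectD//; apply: expect_mono => // c; set c' := restr K c.
have [cc|_] := boolP (all c' core); last by rewrite !addr_ge0// sumr_ge0.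
have cm g b j : g \in [:: 1%g; s i] -> (j < t)%N -> c' (b, g * u j)%g.
  move=> gS jt; move/allP: cc => /(_ (b, g * u j)%g); apply.
  apply/mapP; exists (b, (g, j)) => //; rewrite mem_cat; apply/orP; left.
  apply/allpairsP; exists (g, (b, j)); split=> //.
  by apply/allpairsP; exists (b, j); rewrite mem_iota; split=> //; case: b.
have mk g : g \in [:: 1%g; s i] -> marked u t (shift g c').
  by move=> gS; apply/allP => j; rewrite mem_iota => /andP[_ jt]; rewrite /shift !cm.
have [Eo|no] := boolP (open_pos L s u t M A i c').
  by rewrite lerDl addr_ge0// sumr_ge0.
rewrite [X in _ <= X]add0r.
have ex_g (P : pred G) g : g \in overlap -> P g -> 1 <= \sum_(g0 <- overlap) (true && P g0)%:R :> R.
  move=> gO Pg; rewrite (big_rem g)//= Pg lerDl sumr_ge0 //.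
have mem1 : 1%g \in [:: 1%g; s i] by rewrite mem_head.
have mems : s i \in [:: 1%g; s i] by rewrite !inE eqxx orbT.
have m1 := mk _ mem1; rewrite shift1 in m1.
have s1 : s i != 1%g by move: good; rewrite inE negb_or => /andP[].
have tl : tail_on u A i c'.
  apply/allP => j jA; move/allP: cc => /(_ (false, u j)); apply.
  apply/mapP; exists (false, (1%g, j)); last by rewrite /lamp_pos mul1g.
  by rewrite mem_cat map_f ?orbT.
move: no; rewrite /open_pos s1 tl andbT /isolated m1 (mk _ mems) /= negb_and => /orP[] /allPn[g gO].
  rewrite negbK => mg; apply: le_trans (ex_g (fun g => marked u t (shift g c')) g gO mg) _.
  by rewrite lerDl sumr_ge0.
rewrite negbK shiftM => mg.
apply: le_trans (ex_g (fun g => marked u t (shift (s i * g)%g c')) g gO mg) _.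
by rewrite lerDr sumr_ge0.
Qed.

End OpenLowerBound.

Lemma geometric_le (R : realType) (x : R) m : 0 <= x <= 2^-1 -> \sum_(i < m) x ^+ i <= 2.
Proof.
move=> /andP[x0 x1]; have := subrX1 x m; set S := \sum_(i < m) _ => h.
have xm : 0 <= x ^+ m by exact: exprn_ge0.
have S0 : 0 <= S by apply: sumr_ge0 => i _; exact: exprn_ge0.
have : (1 - x) * S <= 1 by move: h xm; set y := x ^+ m; nra.
by nra.
Qed.

Lemma count_sum (R : realType) (T : Type) (P : pred T) (r : seq T) :
  (count P r)%:R = \sum_(x <- r) (P x)%:R :> R.
Proof. by elim: r => [|x r ih]; rewrite ?big_nil// big_cons /= natrD ih. Qed.

(** * Edges lost to cycles and parallel edges *)

Section Losses.
Variables (R : realType) (B W G : groupType) (L : lamp_group B W G).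
Variables (I : finType) (sg : I -> B) (u : nat -> G) (t M a : nat) (A : I -> seq nat).
Local Notation n := (lcard L).
Local Notation site := (bool * G)%type.
Local Notation X := (I * bool)%type.
Local Notation s := (letter L sg).
Local Notation step := (letter_step s).
Local Notation bar := (@letter_bar I).
Local Notation ex := (@expect R B W G L).
Local Notation opn_at := (open_edge L s u t M A).
Local Notation opn_i := (open_pos L s u t M A).
Local Notation FN := (tree_edge L s u t M A).
Local Notation cyc := (short_cycle L s u t M A).
Local Notation K0 := (local_sites L sg u M).
Implicit Types (c : site -> bool) (v g : G) (x : X) (w : seq X).

Hypothesis sparse : forall m i j k h h', (i < m)%N -> (j < m)%N -> (k < m)%N ->
  h \in hall L -> h' \in hall L -> u m != (u j * h * (u i)^-1 * u k * h')%g.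
Hypothesis tM : (t <= M)%N.
Hypothesis Au : forall i, uniq (A i).
Hypothesis As : forall i, size (A i) = a.
Hypothesis At : forall i j, j \in A i -> (t <= j)%N.
Hypothesis AM : forall i j, j \in A i -> (j < M)%N.
Hypothesis Aa : forall i i', i != i' -> (count [in A i'] (A i) <= t)%N.
Variable Mw : R.
Hypothesis Mw0 : 0 <= Mw.
Hypothesis MwP : forall f : l2 R G, nrm (\sum_x lact (sx s x) f) <= Mw * nrm f.

(** The cost of one edge of an open cycle. Closed words of length l number at most Mw^l, so
    [cycle_ratio] is the ratio of the geometric series bounding all cycles. *)
Definition decay : R := (n%:R ^+ (2 * t + (a - t)))^-1.
Definition cycle_ratio : R := Mw * decay.

Lemma decay_ge0 : 0 <= decay. Proof. by rewrite invr_ge0 exprn_ge0. Qed.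
Lemma eta_ge0 : 0 <= cycle_ratio. Proof. by rewrite mulr_ge0// decay_ge0. Qed.

Lemma cycle_closed c v w : is_cycle bar step (opn_at c) v w -> wprod (sx s) w = 1%g.
Proof.
case=> _ + _ _ _; rewrite foldl_step => vw.
by apply: (mulgI v); rewrite vw mulg1.
Qed.

Definition cprob K v w : R := ex K (fun c => `[< is_cycle bar step (opn_at c) v w >]%:R).

Lemma cprob_le K v w : uniq K ->
  cprob K v w <= (wprod (sx s) w == 1%g)%:R * (1 < size w)%N%:R * decay ^+ size w.
Proof.
move=> uK; have [|] := boolP ((wprod (sx s) w == 1%g) && (1 < size w)%N).
  move=> /andP[-> ->]; rewrite !mul1r /decay exprVn -exprM.
  exact: cycle_probability.
move=> nc; rewrite /cprob expect_false ?mulr_ge0 ?exprn_ge0 ?decay_ge0// => c.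
case: asboolP => // h; move: nc; rewrite (cycle_closed h) eqxx /=.
by case: h => ->.
Qed.

Lemma closed_words m : (\sum_(x : X) \sum_(w <- words X m) (wprod (sx s) (x :: w) == 1%g)%:R) <= Mw ^+ m.+1.
Proof.
apply: le_trans (count_words Mw0 MwP m.+1 1%g).
by rewrite count_sum /= big_allpairs_dep big_enum.
Qed.

Lemma short_cycle_le N c v x :
  (cyc N c v x)%:R <= \sum_(m < N) \sum_(w <- words X m)
     `[< is_cycle bar step (opn_at c) v (x :: w) >]%:R :> R.
Proof.
have [/asboolP[w [wN h]]|_] := boolP (cyc N c v x); last by rewrite !sumr_ge0 // => *; rewrite sumr_ge0.
rewrite (bigD1 (Ordinal wN)) //= (big_rem w) ?mem_words//=.
rewrite asboolT// -addrA lerDl addr_ge0//; first by rewrite sumr_ge0.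
by rewrite sumr_ge0 // => *; rewrite sumr_ge0.
Qed.

(** An open edge is lost only if it or its reversal begins an open cycle. The union bound over
    closed words is a geometric series that starts at length two. *)
Lemma loss_le K N : uniq K -> cycle_ratio <= 2^-1 ->
  \sum_j ex K (fun c => (opn_i j c)%:R) <=
  \sum_j ex K (fun c => (FN N c 1%g (j, false))%:R) + 2 * cycle_ratio ^+ 2.
Proof.
(* [v0] is the origin of the edge in each direction; summing over [j] and the direction runs through
   all first letters of closed words. *)
move=> uK eta2; pose v0 x : G := if x.2 then s x.1 else 1%g.
have pt j : ex K (fun c => (opn_i j c)%:R) <= ex K (fun c => (FN N c 1%g (j, false))%:R) +
    \sum_b \sum_(m < N) \sum_(w <- words X m) cprob K (v0 (j, b)) ((j, b) :: w).
  rewrite /cprob; under eq_bigr do under eq_bigr do rewrite -expect_sum//.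
  under eq_bigr do rewrite -expect_sum//; rewrite -expect_sum// -expectD//.
  apply: expect_mono => // c; rewrite big_bool /v0 /=; set c' := restr K c.
  apply: le_trans (lerD (lexx _) (lerD (short_cycle_le N c' (s j) (j, true)) (short_cycle_le N c' 1%g (j, false)))).
  rewrite /tree_edge /open_edge shift1 /open_letter /=.
  have -> : step 1%g (j, false) = s j by rewrite /letter_step mul1g.
  rewrite -!natrD ler_nat /letter_bar /=.
  by case: (opn_i j c'); case: (cyc _ _ _ _); case: (cyc _ _ _ _).
apply: le_trans (ler_sum _ (fun j _ => pt j)) _; rewrite big_split lerD2l /=.
apply: (@le_trans _ _ (\sum_(m < N) (0 < m)%N%:R * cycle_ratio ^+ m.+1)).
  rewrite pair_bigA /= exchange_big /=; apply: ler_sum => m _.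
  apply: (@le_trans _ _ ((0 < m)%N%:R * decay ^+ m.+1 *
      \sum_(x : X) \sum_(w <- words X m) (wprod (sx s) (x :: w) == 1%g)%:R)).
    rewrite mulr_sumr; apply: ler_sum => -[j b] _ /=; rewrite mulr_sumr.
    rewrite big_seq [leRHS]big_seq; apply: ler_sum => w; rewrite mem_words => /eqP sw.
    by apply: le_trans (cprob_le _ _ uK) _; rewrite [size _]/= sw ltnS le_eqVlt; apply/orP; left; apply/eqP; ring.
  rewrite /cycle_ratio exprMn; apply: le_trans (ler_wpM2l _ (closed_words m)) _.
    by rewrite mulr_ge0 ?exprn_ge0 ?decay_ge0.
  by rewrite -mulrA [X in _ * X]mulrC.
case: N {pt} => [|N]; first by rewrite big_ord0 mulr_ge0 ?exprn_ge0 ?eta_ge0.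
rewrite big_ord_recl mul0r add0r.
under eq_bigr do rewrite mul1r /= exprS exprS mulrA -expr2.
rewrite -mulr_sumr [leRHS]mulrC ler_wpM2l ?exprn_ge0 ?eta_ge0//.
by apply: geometric_le; rewrite eta_ge0.
Qed.

Lemma open_cycle c i j : i != j -> s i = s j -> opn_i i c -> opn_i j c ->
  is_cycle bar step (opn_at c) 1%g [:: (i, false); (j, true)].
Proof.
move=> ij sij oi oj; have opi k : opn_at c 1%g (k, false) = opn_i k c by rewrite /open_edge shift1.
have st k : step 1%g (k, false) = s k by rewrite /letter_step mul1g.
have st2 : step 1%g (i, false) = step 1%g (j, false) by rewrite !st.
split=> //=.
- by rewrite st2 -[(j, true)]/(bar (j, false)) stepK.
- rewrite inE andbT eq_sym; apply: (@open_edge_noloop B W G L I s u t M A c); by rewrite opi.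
- by rewrite opi oi st2 -[(j, true)]/(bar (j, false)) open_edge_bar opi oj.
- by move=> x y [<- <-]; rewrite /letter_bar xpair_eqE /= andbT eq_sym.
Qed.

Lemma multi_le K : uniq K ->
  \sum_i \sum_(j | (i != j) && (s i == s j)) ex K (fun c => (opn_i i c && opn_i j c)%:R) <= cycle_ratio ^+ 2.
Proof.
move=> uK; apply: (@le_trans _ _ (decay ^+ 2 *
   \sum_(x : X) \sum_(w <- words X 1) (wprod (sx s) (x :: w) == 1%g)%:R)); last first.
  rewrite /cycle_ratio exprMn [leRHS]mulrC ler_wpM2l ?exprn_ge0 ?decay_ge0//; exact: closed_words.
rewrite mulr_sumr -(pair_bigA _ (fun i b => decay ^+ 2 *
  \sum_(w <- words X 1) (wprod (sx s) ((i, b) :: w) == 1%g)%:R)).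
apply: ler_sum => i _; rewrite big_bool; apply: ler_wpDl.
  by rewrite mulr_ge0 ?exprn_ge0 ?decay_ge0// sumr_ge0.
rewrite -[words X 1]/([seq x :: w | x <- enum {: X}, w <- [:: [::]]]).
rewrite big_allpairs_dep big_enum /= -(pair_bigA _ (fun j b =>
  \sum_(w <- [:: [::]]) (wprod (sx s) ((i, false) :: (j, b) :: w) == 1%g)%:R)) /=.
rewrite mulr_sumr [leLHS]big_mkcond; apply: ler_sum => j _.
rewrite big_bool /= !big_seq1; set p := (_ == 1%g); set q := (_ == 1%g).
case: ifP => [/andP[ij /eqP sij]|_]; last first.
  by rewrite mulr_ge0 ?exprn_ge0 ?decay_ge0// addr_ge0.
apply: (@le_trans _ _ (cprob K 1%g [:: (i, false); (j, true)])).
  apply: expect_mono => // c; rewrite ler_nat; case: andP => // -[oi oj].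
  by rewrite asboolT//; exact: open_cycle.
apply: le_trans (cprob_le _ _ uK) _; rewrite /= mulr1 mulrC ler_wpM2l ?exprn_ge0 ?decay_ge0//.
by rewrite lerDl.
Qed.

(** The diagonal gives the expected number of open edges. The other terms come from pairs of
    parallel open edges, which are cycles of length two. *)
Lemma sqn_open_vec : sqn (open_vec R L sg u t M A) <=
  \sum_j ex K0 (fun c => (opn_i j c)%:R) + cycle_ratio ^+ 2.
Proof.
have uK : uniq K0 by exact: undup_uniq.
have hl := @lin_lamp_proj R B W G L; have hi := @lamp_proj_idem R B W G L.
have hs := @lamp_proj_sym R B W G L; have hc := @lamp_proj_comm R B W G L.
apply: le_trans (lerD (lexx _) (multi_le uK)).
rewrite /sqn /open_vec dot_suml -big_split; apply: ler_sum => i _ /=.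
rewrite dot_sumr (bigD1 i) //; apply: lerD.
  rewrite pair_diag//; apply: expect_mono => // c; rewrite /open_ind -natrM mulnb.
  by rewrite andbb.
rewrite [leLHS]big_mkcond [leRHS]big_mkcond; apply: ler_sum => j _ /=.
rewrite eq_sym; case: (eqVneq i j) => //= ij.
case: eqP => [sij|nsij]; last by rewrite pair_zero// => e _; case: nsij; move: e; rewrite !pi_letter_lift.
(* Lifts of the same element of [G] may differ in [W], so the scalar product is not itself an
   expectation; as [F] is an indicator, Cauchy-Schwarz bounds it by one. *)
pose F c : R := open_ind R L sg u t M A i c * open_ind R L sg u t M A j c.
have F2 c : F c * F c = F c.
  by rewrite /F /open_ind; case: (opn_i i c); case: (opn_i j c); rewrite ?mulr1 ?mulr0.
rewrite (op_dot hl hi hs hc)//.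
have -> : op (@lamp_proj R B W G L) K0 (fun c => open_ind R L sg u t M A i c * open_ind R L sg u t M A j c) (delta R (letter_lift L sg (i, false))) =
    op (@lamp_proj R B W G L) K0 F (op (@lamp_proj R B W G L) K0 F (delta R (letter_lift L sg (i, false)))).
  by rewrite op_op//; congr op; apply/funext => c; rewrite F2.
rewrite (op_sym hl hi hs hc)//; apply: le_trans (ler_norm _) _; apply: le_trans (dot_le _ _) _.
have nE (g : W) : nrm (op (@lamp_proj R B W G L) K0 F (delta R g)) ^+ 2 = ex K0 F.
  by rewrite nrm_sqr /sqn pair_diag//; congr ex; apply/funext => c.
have -> : ex K0 (fun c => (opn_i i c && opn_i j c)%:R) = ex K0 F.
  by congr ex; apply/funext => c; rewrite /F /open_ind -natrM mulnb.
move: (nE (letter_lift L sg (i, false))) (nE (letter_lift L sg (j, false))) => <-.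
set x := nrm _; set y := nrm _; have x0 : 0 <= x by exact: nrm_ge0.
have y0 : 0 <= y by exact: nrm_ge0.
nra.
Qed.

End Losses.

(** * The main inequality and the choice of parameters *)

Section MainInequality.
Variables (R : realType) (B W G : groupType) (L : lamp_group B W G).
Variables (I : finType) (sg : I -> B) (u : nat -> G) (t M a : nat) (A : I -> seq nat).
Local Notation n := (lcard L).
Local Notation phi := (lphi L).
Local Notation pi := (lpi L).
Local Notation site := (bool * G)%type.
Local Notation X := (I * bool)%type.
Local Notation H2 := (l2 R W).
Local Notation le := (@lamp_proj R B W G L).
Local Notation fibre := (@fibre R B W G L).
Local Notation op := (op le).
Local Notation s := (letter L sg).
Local Notation ex := (@expect R B W G L).
Local Notation opn_i := (open_pos L s u t M A).
Local Notation K0 := (local_sites L sg u M).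
Local Notation TL := (@truncated_hop R B W G L I sg u t M A).
Local Notation vv := (marked_vec R L sg u t M).
Local Notation ww := (open_vec R L sg u t M A).
Local Notation yR := (@isolated_ind R B W G L u t M).
Local Notation oR := (open_ind R L sg u t M A).
Local Notation d1 := (delta R (1 : W)%g).
Local Notation alg := (@alg R B W phi).
Implicit Types (c : site -> bool) (f : H2) (K : seq site).

Hypothesis sparse : forall m i j k h h', (i < m)%N -> (j < m)%N -> (k < m)%N ->
  h \in hall L -> h' \in hall L -> u m != (u j * h * (u i)^-1 * u k * h')%g.
Hypothesis tM : (t <= M)%N.
Hypothesis Au : forall i, uniq (A i).
Hypothesis As : forall i, size (A i) = a.
Hypothesis At : forall i j, j \in A i -> (t <= j)%N.
Hypothesis AM : forall i j, j \in A i -> (j < M)%N.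
Hypothesis Aa : forall i i', i != i' -> (count [in A i'] (A i) <= t)%N.

Let hl := (@lin_lamp_proj R B W G L).
Let hi := (@lamp_proj_idem R B W G L).
Let hs := (@lamp_proj_sym R B W G L).
Let hc := (@lamp_proj_comm R B W G L).
Let uK0 : uniq K0. Proof. exact: undup_uniq. Qed.

Lemma fibre_marked_vec : fibre 1%g vv = vv.
Proof. by rewrite /marked_vec fibre_op -{1}(pi1 L) fibre_delta. Qed.

Lemma sqn_marked_vec : sqn vv <= (n%:R ^+ (2 * t))^-1.
Proof.
rewrite /sqn /marked_vec pair_diag//.
pose Z := [seq (bj.1, (1%g : G, bj.2)) | bj <- [seq (b, j) | b <- [:: true; false], j <- iota 0 t]].
have ZP z : z \in Z -> z.2.1 = 1%g /\ (z.2.2 < t)%N.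
  move=> /mapP[[b j] /allpairsP[[b' j'] [_ jt e]] ->]; split=> //=.
  by move: jt; rewrite mem_iota; case: e => _ ->.
have pZ : pairwise (fun x y => ~~ same L x y) (map (lamp_pos u) Z).
  have uZ : uniq Z.
    rewrite map_inj_uniq; last by move=> [b j] [b' j'] [-> ->].
    by apply: allpairs_uniq => //; [exact: iota_uniq|move=> [b j] [b' j'] _ _ /= [-> ->]].
  rewrite pairwise_map; move: uZ; rewrite uniq_pairwise.
  apply: (@sub_in_pairwise _ [in Z]); last by apply/allP.
  move=> z z' /ZP[z1 zt] /ZP[z'1 z't] zz'.
  apply: (@lamp_pos_same B W G L u M sparse [:: 1%g]) => //; rewrite ?z1 ?z'1 ?mem_head//.
  - by move=> v v'; rewrite !inE => /eqP -> /eqP ->; rewrite eqxx.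
  - exact: leq_trans zt tM.
  - exact: leq_trans z't tM.
have -> : (2 * t)%N = size (map (lamp_pos u) Z).
  by rewrite !size_map size_allpairs size_iota.
apply: le_trans (expect_all_le R uK0 pZ); apply: expect_mono => // c; set c' := restr K0 c.
rewrite /isolated_ind -natrM ler_nat mulnb andbb.
case y: (isolated _ _ _ _ _) => //; rewrite lt0b; apply/allP => _ /mapP[z zZ ->].
have [z1 zt] := ZP z zZ; have /andP[/allP /(_ z.2.2) + _] := y.
rewrite mem_iota zt => /(_ isT) /andP[m1 m2].
by rewrite /lamp_pos z1 mul1g; case: (z.1).
Qed.

Lemma alg_ext (C C' C2 : H2 -> H2) : alg C C' -> C2 =1 C -> alg C2 C'.
Proof. by move=> [l [h1 h2]] e; exists l; split=> // f; rewrite e h1. Qed.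

Lemma alg_adj (C C' C2 : H2 -> H2) : alg C C' -> (forall f h, dot (C f) h = dot f (C2 h)) -> alg C C2.
Proof.
move=> aC CC2; have [l [h1 h2]] := aC; exists l; split=> // f; rewrite -h2.
apply: dot_inj => h; rewrite dotC -CC2 (alg_sym (@lphiM _ _ _ L) aC) dotC //.
Qed.

Lemma alg_lamp_proj v : alg (le v) (le v).
Proof.
have pX i : (phi (lamp L v) ^+ i)%g = phi (lamp L v ^+ i)%g.
  by elim: i => [|i ih]; rewrite ?expg0 ?phi1// !expgS lphiM ih.
apply: (alg_adj (C' := fun f => n%:R^-1 *: \sum_(i < n) lact (phi (lamp L v ^+ i)%g)^-1%g f)); last exact: lamp_proj_sym.
have [l [h1 h2]] := alg_scale n%:R^-1 (alg_sum (index_enum 'I_n)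
  (fun i : 'I_n => alg_lact R (@lphiM _ _ _ L) (lamp L v ^+ i)%g)).
exists l; split=> f; last by rewrite -h2.
by rewrite -h1 /lamp_proj; congr (_ *: _); apply: eq_bigr => i _; rewrite /lampw pX.
Qed.

Lemma alg_lamp_op K F : uniq K -> alg (op K F) (op K F).
Proof.
move=> uK; suff [C aC] : exists C, alg (op K F) C.
  by apply: alg_adj aC _ => f h; rewrite (op_sym hl hi hs hc).
elim: K F {uK} => [|v K ih] F.
  exists (fun f => F (fun=> false) *: f); exact: (alg_scale _ (alg_id R (@lphiM _ _ _ L))).
have [C1 a1] := ih (fun c => F (upd c v true)); have [C2 a2] := ih (fun c => F (upd c v false)).
eexists; apply: (alg_ext (alg_add (alg_comp (@lphiM _ _ _ L) a1 (alg_lamp_proj v))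
  (alg_comp (@lphiM _ _ _ L) a2 (alg_add (alg_id R (@lphiM _ _ _ L)) (alg_scale (-1) (alg_lamp_proj v)))))) => f.
by rewrite /= scaleN1r.
Qed.

Lemma shift_restr g K c : shift g (restr (translate g K) c) = restr K (shift g c).
Proof.
apply/funext => -[z1 z2]; rewrite /shift /restr /=; congr (_ && _).
apply/mapP/idP => [[[y1 y2] yK /= [-> /mulgI ->]]//|zK].
by exists (z1, z2).
Qed.

(** The open edges at 1 as an element of the group algebra: it commutes with every operator
    commuting with left translations, and the trace compares it with its adjoint [kadj]. *)
Definition kop f : H2 := \sum_j op K0 (oR j) (lact (phi (sg j)) f).
Definition kadj f : H2 := \sum_j lact (phi (sg j))^-1%g (op K0 (oR j) f).

Lemma alg_kop : alg kop kadj.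
Proof.
by apply: (alg_sum _ (fun j => alg_comp (@lphiM _ _ _ L) (alg_lamp_op (oR j) uK0) (alg_lact R (@lphiM _ _ _ L) (sg j)))).
Qed.

Lemma kop_delta1 : kop d1 = ww.
Proof. by apply: eq_bigr => j _; rewrite lact_delta mulg1. Qed.

Lemma open_ind_isolated j c : oR j c * yR c = oR j c.
Proof.
rewrite /open_ind /isolated_ind -natrM mulnb; case o: (opn_i j c) => //=.
by rewrite (open_pos_isolated o).
Qed.

Lemma open_ind_isolated_shift j c : oR j c * yR (shift (s j) c) = oR j c.
Proof.
rewrite /open_ind /isolated_ind -natrM mulnb; case o: (opn_i j c) => //=.
by case/and4P: o => _ _ ->.
Qed.

Lemma kadj_marked_vec : kadj vv = kadj d1.
Proof.
apply: eq_bigr => j _; congr lact; rewrite op_op//; congr op.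
by apply/funext => c; exact: open_ind_isolated.
Qed.

(** Translated by the letter, the isolation of 1 becomes that of the other end of the edge, which
    openness already contains. *)
Lemma kop_marked_vec : kop vv = ww.
Proof.
rewrite -kop_delta1; apply: eq_bigr => j _; rewrite /marked_vec lact_op.
set z := lact _ d1; set K := undup (K0 ++ translate (s j) K0).
have uK : uniq K by exact: undup_uniq.
have K0K : {subset K0 <= K} by move=> y yK; rewrite mem_undup mem_cat yK.
have tK : {subset translate (s j) K0 <= K} by move=> y yK; rewrite mem_undup mem_cat yK orbT.
rewrite !(op_widen hl hi hc (oR j) _ uK K0K) (op_widen hl hi hc _ z uK tK) op_op//.
congr op; apply/funext => c.
have -> : oR j (restr K0 c) = oR j c by rewrite /open_ind open_pos_restr.
rewrite -/(s j) shift_restr.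
have -> : yR (restr K0 (shift (s j) c)) = yR (shift (s j) c) by rewrite /isolated_ind isolated_restr.
exact: open_ind_isolated_shift.
Qed.

Variable Mw : R.
Hypothesis Mw0 : 0 <= Mw.
Hypothesis MwP : forall f : l2 R G, nrm (\sum_x lact (sx s x) f) <= Mw * nrm f.
Local Notation eta := (cycle_ratio L t a Mw).
Hypothesis eta2 : eta <= 2^-1.

Variable T : H2 -> H2.
Hypothesis lT : lin T.
Hypothesis T1 : forall f, fibre 1%g f = f -> nrm (T f) <= nrm f.
Hypothesis Tcv : forall f h, (fun Lam => dot (TL Lam f) h) @ @fset_ultra G --> dot (T f) h.

Lemma pairing_limit : \sum_j ex K0 (fun c => (opn_i j c)%:R) - 2 * eta ^+ 2 <=
  dot (T vv) ww + dot vv (T ww).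
Proof.
have cv : (fun Lam => dot (TL Lam vv) ww + dot vv (TL Lam ww)) @ @fset_ultra G -->
    dot (T vv) ww + dot vv (T ww).
  rewrite [dot vv _]dotC; under eq_fun do rewrite [dot vv _]dotC.
  by apply: cvgD; exact: Tcv.
apply: cvg_ge_ev cv _.
pose Lam0 := (1%g |` [fset s j | j in I])%fset.
apply: filterS (fset_ultra_ge Lam0) => Lam /= sL.
set K := undup (K0 ++ sites_of L s u M Lam).
have uK : uniq K by exact: undup_uniq.
have L1 : 1%g \in Lam by apply: (fsubsetP sL); rewrite !inE eqxx.
have Ls j : s j \in Lam by apply: (fsubsetP sL); rewrite !inE in_imfset ?orbT.
apply: le_trans (pairing R tM AM L1 Ls (erefl K)); rewrite lerBlDr.
apply: le_trans (loss_le sparse tM Au As At AM Aa Mw0 MwP (cycle_cutoff Lam) uK eta2).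
apply: ler_sum => j _; rewrite (@expect_widen R B W G L K0 K _ uK); last by move=> y yK; rewrite mem_undup mem_cat yK.
by apply: expect_mono => // c; rewrite open_pos_restr.
Qed.

Variables (T' : H2 -> H2) (C : R).
Hypothesis C0 : 0 <= C.
Hypothesis lT' : lin T'.
Hypothesis T'C : forall f, nrm (T' f) <= C * nrm f.
Hypothesis TT' : forall b f, T (lact (phi b) f) - lact (phi b) (T f) =
  T' (lact (phi b) f) - lact (phi b) (T' f).

(** The bound [T1] controls T on [marked_vec] v, not on [open_vec] w. Since E = T - T' commutes with
    [kop], <E w, v> = <E v, kadj v>; here [kadj v] is [kadj d1], of the same norm as w by the trace
    property. So <v, T w> is traded for a term in T v and two terms in T'. *)
Lemma main_inequality : \sum_j ex K0 (fun c => (opn_i j c)%:R) - 2 * eta ^+ 2 <=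
  (2 + 2 * C) * nrm vv * nrm ww.
Proof.
apply: le_trans pairing_limit _.
pose E f := T f - T' f.
have lE : lin E by exact: linBB.
have cE b f : E (lact (phi b) f) = lact (phi b) (E f).
  rewrite /E (linB (lin_lact _)).
  have -> : T (lact (phi b) f) = lact (phi b) (T f) + (T' (lact (phi b) f) - lact (phi b) (T' f)).
    by rewrite -TT' addrC subrK.
  by rewrite -addrA; congr (_ + _); rewrite addrAC subrr sub0r.
have Eww : E ww = kop (E vv) by rewrite -kop_marked_vec (alg_commute alg_kop lE cE).
have nw : nrm (kadj d1) = nrm ww.
  by rewrite /nrm -kop_delta1 (alg_tracial (@lphiM _ _ _ L) alg_kop).
have e1 : dot (E ww) vv = dot (E vv) (kadj d1).
  by rewrite Eww (alg_sym (@lphiM _ _ _ L) alg_kop) kadj_marked_vec.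
have e2 : dot vv (T ww) = dot (T vv) (kadj d1) - dot (T' vv) (kadj d1) + dot (T' ww) vv.
  by rewrite -dotBl -e1 /E dotBl subrK dotC.
have b1 : dot (T vv) ww <= nrm vv * nrm ww.
  apply: le_trans (ler_norm _) _; apply: le_trans (dot_le _ _) _.
  by rewrite ler_wpM2r ?nrm_ge0// T1// fibre_marked_vec.
have b2 : dot (T vv) (kadj d1) <= nrm vv * nrm ww.
  apply: le_trans (ler_norm _) _; apply: le_trans (dot_le _ _) _.
  by rewrite nw ler_wpM2r ?nrm_ge0// T1// fibre_marked_vec.
have b3 : - dot (T' vv) (kadj d1) <= C * nrm vv * nrm ww.
  apply: le_trans (ler_norm _) _; rewrite normrN; apply: le_trans (dot_le _ _) _.
  by rewrite nw ler_wpM2r ?nrm_ge0.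
have b4 : dot (T' ww) vv <= C * nrm ww * nrm vv.
  apply: le_trans (ler_norm _) _; apply: le_trans (dot_le _ _) _.
  by rewrite ler_wpM2r ?nrm_ge0.
by rewrite e2; lra.
Qed.

End MainInequality.

Lemma cube_le_exp2 (K : nat) : exists t0, forall t, (t0 <= t)%N -> (K * t ^ 3 <= 2 ^ t)%N.
Proof.
have h t : (16 <= t)%N -> (t * (t * (t * t)) <= 2 ^ t)%N.
  move=> t16; rewrite -(subnK t16); elim: (t - 16)%N => [//|m ih].
  rewrite addSn expnS; set y := (m + 16)%N in ih *.
  have y16 : (16 <= y)%N by rewrite /y leq_addl.
  apply: leq_trans (leq_mul (leqnn 2) ih); nia.
exists (maxn 16 K) => t; rewrite geq_max => /andP[t16 Kt].
apply: leq_trans (h t t16); rewrite -[(t ^ 3)%N]/(t * (t * t))%N leq_mul2r Kt.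
by rewrite orbT.
Qed.

Lemma small_power (R : realType) (rho eps : R) : 0 < rho < 1 -> 0 < eps ->
  exists q, forall q', (q <= q')%N -> rho ^+ q' <= eps.
Proof.
move=> /andP[r0 r1] e0.
have : (fun m => rho ^+ m) @ \oo --> (0 : R) by apply: cvg_expr; rewrite ger0_norm ?ltW.
move=> /cvgrPdist_le /(_ _ e0) [q _ hq]; exists q => q' qq'.
by have := hq q' qq'; rewrite sub0r normrN ger0_norm// exprn_ge0 ?ltW.
Qed.

(** [A i] is the graph of the i-th word of the code, with (k, f k) encoded as k r + f k and moved
    beyond the t marking places; agreements of words are common points of graphs. *)
Lemma nearly_disjoint (a r t d : nat) : (2 <= r)%N -> (d * 2 ^ a <= r ^ t)%N ->
  exists A : 'I_d -> seq nat, [/\ forall i, uniq (A i), forall i, size (A i) = a,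
    forall i j, j \in A i -> (t <= j)%N, forall i j, j \in A i -> (j < t + a * r)%N &
    forall i i', i != i' -> (count [in A i'] (A i) <= t)%N].
Proof.
move=> r2 hd; have [S [sS pS]] := code_exists r2 hd.
have r0 : (0 < r)%N by exact: leq_trans r2.
pose f0 : {ffun 'I_a -> 'I_r} := [ffun=> Ordinal r0].
pose f (i : 'I_d) := nth f0 S i.
pose pos (g : {ffun 'I_a -> 'I_r}) (k : 'I_a) : nat := (t + (k * r + g k))%N.
have pos_inj g g' k k' : pos g k = pos g' k' -> k = k' /\ g k = g' k'.
  move=> /eqP; rewrite eqn_add2l => /eqP e.
  have ek : k = k' :> nat.
    have := congr1 (fun z => (z %/ r)%N) e.
    by rewrite !divnMDl// !divn_small ?ltn_ord// !addn0.
  split; first exact: val_inj.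
  have := congr1 (fun z => (z %% r)%N) e.
  by rewrite !modnMDl !modn_small ?ltn_ord// => /val_inj.
exists (fun i => [seq pos (f i) k | k <- enum 'I_a]); split=> i.
- by rewrite map_inj_uniq ?enum_uniq// => k k' /pos_inj[].
- by rewrite size_map size_enum_ord.
- by move=> j /mapP[k _ ->]; exact: leq_addr.
- move=> j /mapP[k _ ->]; rewrite ltn_add2l.
  apply: (@leq_trans (k.+1 * r)); first by rewrite mulSn addnC ltn_add2r.
  by rewrite leq_mul2r ltn_ord orbT.
- move=> i' ii'.
  have ag : (agree (f i) (f i') <= t)%N.
    have agC g g' : agree g g' = agree g' g.
      by rewrite /agree; apply: eq_card => k; rewrite !inE eq_sym.
    have := pS; move/(pairwiseP f0) => pS'.
    have iS (l : 'I_d) : (l : nat) \in gtn (size S) by rewrite inE sS.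
    case: (ltngtP i i') => [lt|lt|e]; first exact: pS' (iS i) (iS i') lt.
      by rewrite agC; exact: pS' (iS i') (iS i) lt.
    by move/eqP: ii'; case; exact: val_inj.
  apply: leq_trans ag; rewrite count_map /agree cardE -size_filter; apply: uniq_leq_size.
    by rewrite filter_uniq// enum_uniq.
  move=> k; rewrite mem_filter mem_enum => /andP[/mapP[k' _ /pos_inj[kk' e]] _].
  by rewrite ?mem_enum finset.inE e -kk'.
Qed.

(** [Dg] is the expected number of open edges at 1, [e] the squared cycle ratio, v and w the norms
    of the two vectors. As e <= Dg / 8, squaring the last hypothesis yields Dg <= 8 (1 + C)^2 y;
    with x y / 4 <= Dg this gives x <= 32 (1 + C)^2. *)
Lemma growth_contradiction (R : realType) (Dg e v w C y x : R) :
  0 <= C -> 0 <= v -> 0 <= w -> 0 < y -> 0 <= e -> 33 * (1 + C) ^+ 2 <= x ->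
  x * y / 4 <= Dg -> e <= x * y / 32 -> v ^+ 2 <= y -> w ^+ 2 <= Dg + e ->
  Dg - 2 * e <= (2 + 2 * C) * v * w -> False.
Proof.
move=> C0 v0 w0 y0 e0 xC xD ex vy wD h.
have c1 : 0 < (1 + C) ^+ 2 by rewrite exprn_gt0// ltr_wpDr.
have x0 : 0 < x by apply: lt_le_trans xC; rewrite mulr_gt0.
have D0 : 0 < Dg by apply: lt_le_trans xD; rewrite divr_gt0// mulr_gt0.
have eD : e <= Dg / 8 by lra.
have h1 : 3 / 4 * Dg <= (2 + 2 * C) * v * w by lra.
have h2 : (3 / 4 * Dg) ^+ 2 <= ((2 + 2 * C) * v * w) ^+ 2.
  by rewrite lerXn2r ?nnegrE// ?mulr_ge0 ?addr_ge0//; lra.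
have h3 : ((2 + 2 * C) * v * w) ^+ 2 <= 4 * (1 + C) ^+ 2 * y * (9 / 8 * Dg).
  have -> : ((2 + 2 * C) * v * w) ^+ 2 = 4 * (1 + C) ^+ 2 * v ^+ 2 * w ^+ 2 by ring.
  have a0 : 0 <= 4 * (1 + C) ^+ 2 by rewrite mulr_ge0// ltW.
  apply: ler_pM; [exact: mulr_ge0 a0 (sqr_ge0 v)|exact: sqr_ge0| |lra].
  exact: ler_wpM2l.
have h4 : Dg <= 8 * (1 + C) ^+ 2 * y.
  rewrite -(ler_pM2r D0); move: (le_trans h2 h3).
  have -> : (3 / 4 * Dg) ^+ 2 = 9 / 16 * (Dg * Dg) by field.
  by nra.
have h5 : 33 * (1 + C) ^+ 2 * y <= x * y by rewrite ler_wpM2r// ltW.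
have : 0 < (1 + C) ^+ 2 * y by rewrite mulr_gt0.
by lra.
Qed.

(** The number of letters equal to g is the coordinate at g of their sum applied to the point mass
    at 1; so few letters fall in a given small set. *)
Lemma sum_lact_count (R : realType) (G : groupType) (J : finType) (s : J -> G) (m : R) (S : seq G) :
  0 <= m -> (forall f : l2 R G, nrm (\sum_j lact (s j) f) <= m * nrm f) ->
  \sum_j (s j \in S)%:R <= (size S)%:R * m.
Proof.
move=> m0 hm; elim: S => [|g S ih]; first by rewrite big1 ?mul0r.
apply: (@le_trans _ _ (\sum_j ((s j == g)%:R + (s j \in S)%:R))).
  by apply: ler_sum => j _; rewrite inE -natrD ler_nat; case: eqP.
rewrite big_split /= -add1n natrD mulrDl mul1r; apply: lerD ih.
set f := \sum_j lact (s j) (delta R 1%g).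
have -> : \sum_j (s j == g)%:R = f g.
  by rewrite l2_sum; apply: eq_bigr => j _; rewrite lact_delta mulg1 deltaE eq_sym.
have := hm (delta R 1%g); rewrite -/f {2}/nrm sqn_delta sqrtr1 mulr1 => nf.
apply: le_trans (ler_norm _) _; apply: le_trans nf.
rewrite -(@ler_pXn2r _ 2)// ?nnegrE ?nrm_ge0// nrm_sqr real_normK ?num_real//.
exact: coord_le_sqn.
Qed.

Section Sizes.
Variables (R : realType) (B W G : groupType) (L : lamp_group B W G).
Variables (I : finType) (sg : I -> B) (u : nat -> G) (t M : nat) (A : I -> seq nat).
Local Notation s := (letter L sg).

Lemma size_overlap_le : (size (overlap L u M) <= M * M * size (hall L))%N.
Proof.
rewrite size_filter; apply: leq_trans (count_size _ _) _.
by rewrite size_map !size_allpairs !size_iota.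
Qed.

Lemma size_diagonal : size (diagonal L u M) = (M * size (hall L))%N.
Proof. by rewrite size_map size_allpairs size_iota. Qed.

Lemma size_bad : size (bad L u M) =
  (1 + 2 * size (overlap L u M) + 2 * (size (overlap L u M) * size (diagonal L u M)))%N.
Proof. by rewrite /= !size_cat size_map !size_allpairs; lia. Qed.

Lemma core_sub (i : I) : (t <= M)%N -> (forall i j, j \in A i -> (j < M)%N) ->
  {subset core s u t A i <= local_sites L sg u M}.
Proof.
move=> tM AM _ /mapP[z /(core_posP tM AM)[zT zM] ->].
have zB : (z.2.1 * u z.2.2)%g \in base_sites L s u M.
  have q : z.2.1 \in 1%g :: [seq sx s x | x <- enum {: I * bool}].
    move: zT; rewrite !inE => /orP[] /eqP ->; first by rewrite eqxx.
    by apply/orP; right; apply/mapP; exists (i, false); rewrite ?mem_enum.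
  by have := base_sitesP q (mem_head 1%g (overlap L u M)) zM; rewrite mulg1.
have := @near_sitesP B W G L I s u M (enum_fset ([fset 1%g]%fset : {fset G})) (cycle_cutoff ([fset 1%g]%fset : {fset G}))
  1%g [::] _ z.1 (fset11 _) isT zB.
by rewrite /= !mul1g.
Qed.

End Sizes.

(** * Choice of the parameters *)

Section ChoiceOfConstants.
Variables (R : realType) (B W G : groupType) (L : lamp_group B W G).
Hypothesis nam : ~ amenable R G.
Local Notation n := (lcard L).

(* Constants of the form [K t^3] are absorbed by [n^t]. *)
Lemma parameters (b : nat) (rho : R) (X h : nat) : (2 <= b)%N -> 0 < rho < 1 -> (0 < X)%N ->
  exists q t a, [/\ (4 <= t)%N, (t <= a)%N, (b ^ (q * t) * 2 ^ a <= (b ^ (2 * q)) ^ t)%N,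
    [/\ (X * n ^ (2 * t + a) <= b ^ (q * t))%N,
        (b ^ (q * t) < X * n ^ (2 * t + a).+1)%N,
        (128 * n * X <= n ^ t)%N & (0 < q)%N] &
    [/\ rho ^+ (q * t) <= (n%:R ^+ (3 * t))^-1 &
      forall ov, (ov <= (t + a * b ^ (2 * q)) * (t + a * b ^ (2 * q)) * h)%N ->
        (4 * ov <= n ^ (t - 4))%N /\
        (2 * (1 + 2 * ov + 2 * (ov * ((t + a * b ^ (2 * q)) * h))) <= n ^ t)%N]].
Proof.
move=> b2 rho01 X0; have n2 : (2 <= n)%N := lcard_gt1 L.
have n0 : 0 < n%:R :> R by rewrite ltr0n (leq_trans _ n2).
have [q0 hq0] : exists q, forall q', (q <= q')%N -> rho ^+ q' <= (n%:R ^+ 3)^-1.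
  by apply: small_power => //; rewrite invr_gt0 exprn_gt0.
(* [q0] beats n^-3 by [rho ^+ q], and 4 n makes b^q at least n^4, so that a = t is admissible below.
   The alphabet size r = b^(2q) leaves room for a code of b^(q t) words. *)
pose q := maxn q0 (4 * n); pose r := (b ^ (2 * q))%N; pose cM := (1 + b * q * r)%N.
have bq : (n ^ 4 <= b ^ q)%N.
  apply: (@leq_trans (2 ^ (4 * n))%N).
    by rewrite [(4 * n)%N]mulnC expnM leq_exp2r// ltnW// ltn_expl.
  apply: (@leq_trans (b ^ (4 * n))%N); first by rewrite leq_exp2r// muln_gt0 /= (leq_trans _ n2).
  by rewrite leq_exp2l ?leq_maxr.
pose K := (128 * n * X + 4 * n ^ 4 * (cM * cM * h) + 2 * (1 + 2 * (cM * cM * h) + 2 * (cM * cM * h * (cM * h))))%N.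
have [t0 ht0] := cube_le_exp2 K.
pose t := maxn t0 4.
have t4 : (4 <= t)%N by rewrite leq_maxr.
have Kt : (K * t ^ 3 <= n ^ t)%N.
  apply: leq_trans (ht0 t (leq_maxl _ _)) _; rewrite leq_exp2r ?(leq_trans _ t4)//.
have t3 : (1 <= t ^ 3)%N by rewrite expn_gt0 (leq_trans _ t4).
have XK : (128 * n * X <= n ^ t)%N.
  apply: leq_trans Kt; rewrite -[X in (X <= _)%N]muln1 leq_mul// /K -addnA leq_addr //.
have Xnt : (X <= n ^ t)%N by apply: leq_trans XK; rewrite leq_pmull// muln_gt0 /= (leq_trans _ n2).
(* [a] will be the largest number with x = b^(q t) / n^(2t+a) >= X; maximality also gives x < X n,
   so x stays bounded as t grows. *)
pose P a := (X * n ^ (2 * t + a) <= b ^ (q * t))%N.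
have Pt : P t.
  rewrite /P; apply: (@leq_trans (n ^ t * n ^ (2 * t + t))%N); first by rewrite leq_mul2r Xnt orbT.
  rewrite -expnD (_ : (t + (2 * t + t))%N = (4 * t)%N); last by lia.
  by rewrite expnM [(b ^ _)%N]expnM leq_exp2r ?(leq_trans _ t4).
have na a : P a -> (n ^ a <= b ^ (q * t))%N.
  apply: leq_trans; rewrite expnD mulnA leq_pmull// muln_gt0 X0 expn_gt0.
  by rewrite (leq_trans _ n2).
have Pb a : P a -> (a <= b ^ (q * t))%N.
  by move=> /na; apply: leq_trans; rewrite ltnW// ltn_expl.
have exP : exists a, P a by exists t.
case: (ex_maxnP exP Pb) => a Pa amax.
have ta : (t <= a)%N by exact: amax.
exists q, t, a; split=> //.
- have h2 : (2 ^ a <= b ^ (q * t))%N.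
    by apply: leq_trans (na a Pa); rewrite leq_exp2r// (leq_trans _ ta)// (leq_trans _ t4).
  rewrite -expnM (_ : (2 * q * t)%N = (q * t + q * t)%N); last by lia.
  by rewrite expnD leq_mul2l h2 orbT.
- split=> //; last by rewrite leq_max muln_gt0 /= (leq_trans _ n2) ?orbT.
  rewrite ltnNge; apply/negP => h1; have := amax a.+1; rewrite /P addnS h1 => /(_ isT); by rewrite ltnn.
split.
  apply: (@le_trans _ _ ((n%:R ^+ 3)^-1 ^+ t)); last by rewrite exprVn -exprM.
  rewrite exprM; apply: lerXn2r; rewrite ?nnegrE ?invr_ge0 ?exprn_ge0//.
    by case/andP: rho01 => /ltW.
  by apply: hq0; rewrite leq_maxl.
have aM : (t + a * r <= cM * t)%N.
  (* From 2^a <= n^a <= b^(q t) <= 2^(b q t). Hence the window length is linear in t, the number of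
     overlaps quadratic, and that of bad elements cubic. *)
  have ab : (a <= b * q * t)%N.
    rewrite -(@leq_exp2l 2)//; apply: (@leq_trans (b ^ (q * t))%N).
      by apply: leq_trans (na a Pa); rewrite leq_exp2r// (leq_trans _ ta)// (leq_trans _ t4).
    rewrite -mulnA [(2 ^ _)%N]expnM leq_exp2r ?muln_gt0; first by rewrite ltnW// ltn_expl.
    rewrite (leq_trans _ t4)// andbT /q leq_max muln_gt0 /= (leq_trans _ n2) ?orbT//.
  rewrite /cM mulnDl mul1n leq_add2l.
  by apply: leq_trans (leq_mul ab (leqnn r)) _; rewrite mulnAC.
rewrite -/r; set M := (t + a * r)%N in aM * => ov hov.
have hov' : (ov <= cM * cM * h * (t * t))%N.
  apply: leq_trans hov _; apply: (@leq_trans (cM * t * (cM * t) * h)%N).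
    by rewrite leq_mul2r; apply/orP; right; exact: leq_mul.
  by rewrite leq_eqVlt; apply/orP; left; apply/eqP; ring.
have tt : (t * t <= t ^ 3)%N by rewrite -[(t ^ 3)%N]/(t * (t * t))%N leq_pmull// (leq_trans _ t4).
have hov3 : (ov <= cM * cM * h * t ^ 3)%N by apply: leq_trans hov' _; rewrite leq_mul2l tt orbT.
split.
  have e4 : (n ^ t = n ^ 4 * n ^ (t - 4))%N by rewrite -expnD subnKC.
  have n4 : (0 < n ^ 4)%N by rewrite expn_gt0 (leq_trans _ n2).
  rewrite -(leq_pmul2l n4) -e4; apply: leq_trans Kt.
  apply: (@leq_trans (4 * n ^ 4 * (cM * cM * h) * t ^ 3)%N).
    by rewrite mulnCA mulnA -[X in (_ <= X)%N]mulnA leq_mul2l hov3 orbT.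
  by rewrite leq_mul2r; apply/orP; right; rewrite /K; lia.
apply: leq_trans Kt.
have od : (ov * (M * h) <= cM * cM * h * (cM * h) * t ^ 3)%N.
  apply: (@leq_trans (cM * cM * h * (t * t) * (cM * t * h))%N).
    by apply: leq_mul => //; rewrite leq_mul2r aM orbT.
  by rewrite -[(t ^ 3)%N]/(t * (t * t))%N leq_eqVlt; apply/orP; left; apply/eqP; ring.
apply: (@leq_trans (2 * (1 + 2 * (cM * cM * h) + 2 * (cM * cM * h * (cM * h))) * t ^ 3)%N).
  move: od hov3 t3; set o := (ov * (M * h))%N; set c2 := (cM * cM * h)%N.
  set c3 := (c2 * (cM * h))%N; set T := (t ^ 3)%N => od hov3 t3.
  have -> : (2 * (1 + 2 * c2 + 2 * c3) * T = 2 * (T + 2 * (c2 * T) + 2 * (c3 * T)))%N by ring.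
  by lia.
by rewrite leq_mul2r; apply/orP; right; rewrite /K; lia.
Qed.

End ChoiceOfConstants.
(** Here p = n^t, [th] is [rho ^+ (q * t)] and [e] the cycle ratio. Then e <= 2 x / p^2, and 128 x
    <= p turns its square 4 x^2 / p^4 into at most x / (32 p^2). *)
Lemma decay_estimate (R : realType) (th x p e : R) :
  0 <= th -> 0 <= x -> 1 <= p -> th <= (p ^+ 3)^-1 -> 128 * x <= p -> e = 2 * th * x * p ->
  e <= 2^-1 /\ e ^+ 2 <= x * (p ^+ 2)^-1 / 32.
Proof.
move=> th0 x0 p1 thp xp eE; have p0 : 0 < p by exact: lt_le_trans p1.
set y := (p ^+ 2)^-1; have y0 : 0 < y by rewrite invr_gt0 exprn_gt0.
have e0 : 0 <= e by rewrite eE !mulr_ge0// ltW.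
have ey : e <= 2 * x * y.
  rewrite eE; apply: (@le_trans _ _ (2 * (p ^+ 3)^-1 * x * p)).
    by rewrite ler_wpM2r ?(ltW p0)// ler_wpM2r// ler_wpM2l.
  by rewrite le_eqVlt; apply/orP; left; apply/eqP; rewrite /y; field; rewrite gt_eqF.
have xy : 128 * (x * y) <= 1.
  rewrite /y mulrA ler_pdivrMr ?exprn_gt0// mul1r; apply: le_trans xp _.
  by rewrite expr2 ler_peMl// ltW.
have xy0 : 0 <= x * y by rewrite mulr_ge0 ?(ltW y0).
split; first by apply: le_trans ey _; lra.
apply: (@le_trans _ _ ((2 * x * y) ^+ 2)).
  by rewrite lerXn2r ?nnegrE// mulr_ge0 ?(ltW y0)// mulr_ge0.
rewrite (_ : (2 * x * y) ^+ 2 = 4 * ((x * y) * (x * y))); last by ring.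
by move: (x * y) xy xy0 => k; nra.
Qed.

Section UnboundedFamily.
Variables (R : realType) (B W G : groupType) (L : lamp_group B W G).
Hypothesis nam : ~ amenable R G.
Local Notation n := (lcard L).
Local Notation phi := (lphi L).
Local Notation H2 := (l2 R W).

Lemma letters_bound (J : finType) (s : J -> G) (m : R) :
  (forall f : l2 R G, nrm (\sum_i lact (s i) f) <= m * nrm f /\
                      nrm (\sum_i lact (s i)^-1%g f) <= m * nrm f) ->
  forall f : l2 R G, nrm (\sum_x lact (sx s x) f) <= 2 * m * nrm f.
Proof.
move=> sm f; rewrite -(pair_bigA _ (fun i b => lact (sx s (i, b)) f)).
under eq_bigr do rewrite big_bool; rewrite big_split.
apply: le_trans (nrmD _ _) _; have [h1 h2] := sm f.
by apply: le_trans (lerD h2 h1) _; rewrite mulr_natl mulr2n mulrDl.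
Qed.

Section Instance.
Variables (I : finType) (sg : I -> B) (u : nat -> G) (t M a : nat) (A : I -> seq nat).
Hypothesis sparse : forall m i j k h h', (i < m)%N -> (j < m)%N -> (k < m)%N ->
  h \in hall L -> h' \in hall L -> u m != (u j * h * (u i)^-1 * u k * h')%g.
Hypothesis tM : (t <= M)%N.
Hypothesis Au : forall i, uniq (A i).
Hypothesis As : forall i, size (A i) = a.
Hypothesis At : forall i j, j \in A i -> (t <= j)%N.
Hypothesis AM : forall i j, j \in A i -> (j < M)%N.
Hypothesis Aa : forall i i', i != i' -> (count [in A i'] (A i) <= t)%N.
Variables (m C : R).
Hypothesis m0 : 0 <= m.
Hypothesis C0 : 0 <= C.
Hypothesis lettersP : forall f : l2 R G,
  nrm (\sum_i lact (letter L sg i) f) <= m * nrm f /\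
  nrm (\sum_i lact (letter L sg i)^-1%g f) <= m * nrm f.
Let D : R := #|I|%:R.
Let x : R := D / n%:R ^+ (2 * t + a).
Let y : R := (n%:R ^+ (2 * t))^-1.
Hypothesis eta2 : cycle_ratio L t a (2 * m) <= 2^-1.
Hypothesis etasq : cycle_ratio L t a (2 * m) ^+ 2 <= x * y / 32.
Hypothesis xC : 33 * (1 + C) ^+ 2 <= x.
Hypothesis bad_few : 2 * ((size (bad L u M))%:R * m) <= D.
Hypothesis t4 : (4 <= t)%N.
Hypothesis ovP : (4 * size (overlap L u M) <= n ^ (t - 4))%N.

Let N : R := n%:R.
Let N0 : 0 < N. Proof. by rewrite ltr0n ltnW// lcard_gt1. Qed.

(** At least half of the D letters are good, and a good edge is open with probability at least half
    of n^-(4t+a); the product x y is D n^-(4t+a). *)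
Lemma open_lower_bound :
  x * y / 4 <= \sum_j @expect R B W G L (local_sites L sg u M) (fun c => (open_pos L (letter L sg) u t M A j c)%:R).
Proof.
have uK : uniq (local_sites L sg u M) by exact: undup_uniq.
set pr : R := (N ^+ (4 * t + a))^-1; have pr0 : 0 <= pr by rewrite invr_ge0 exprn_ge0// ltW.
have xyE : x * y / 4 = (D - D / 2) * (pr / 2).
  have N1 : N != 0 by rewrite gt_eqF.
  have -> : pr = (N ^+ (2 * t + a) * N ^+ (2 * t))^-1.
    by rewrite /pr -exprD addnAC -mulnDl.
  rewrite /x /y -/N.
  have : N ^+ (2 * t + a) != 0 by rewrite expf_neq0.
  have : N ^+ (2 * t) != 0 by rewrite expf_neq0.
  move: (N ^+ (2 * t)) (N ^+ (2 * t + a)) D => P1 P2 D' P10 P20.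
  by field; rewrite P10.
rewrite xyE; apply: (@le_trans _ _ (\sum_j (1 - (letter L sg j \in bad L u M)%:R) * (pr / 2))).
  rewrite -mulr_suml ler_wpM2r ?divr_ge0// sumrB sumr_const lerB//.
  have := sum_lact_count (bad L u M) m0 (fun f => (lettersP f).1).
  by move: bad_few; lra.
apply: ler_sum => j _; have [jb|jb] := boolP (letter L sg j \in bad L u M).
  by rewrite subrr mul0r expect_ge0.
rewrite subr0 mul1r.
apply: le_trans (open_probability R sparse tM Au As At AM jb uK (core_sub tM AM)).
rewrite (exprD _ (4 * t + a)) invfM -/N -/pr.
set w : R := N ^+ (t - 4); have w0 : 0 < w by exact: exprn_gt0.
have ow : 4 * (size (overlap L u M))%:R <= w by rewrite /w /N -natrX -natrM ler_nat.
have : 4 * (size (overlap L u M))%:R * w^-1 <= 1 by rewrite ler_pdivrMr ?mul1r.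
move: (w^-1) => w'; move: (size _)%:R => o; nra.
Qed.

Lemma unbounded_instance : exists T : H2 -> H2,
  [/\ lin T, forall b f, nrm (T (lact (phi b) f) - lact (phi b) (T f)) <= 2 * nrm f &
   forall T', lin T' -> (forall f, nrm (T' f) <= C * nrm f) ->
     ~ forall b f, T (lact (phi b) f) - lact (phi b) (T f) =
                   T' (lact (phi b) f) - lact (phi b) (T' f)].
Proof.
have [T [lT T1 TD Tcv]] := hopping_operator R L sg u tM AM.
exists T; split=> // T' lT' T'C TT'.
have m20 : 0 <= 2 * m by rewrite mulr_ge0.
have MwP := letters_bound lettersP.
have main := main_inequality sparse tM Au As At AM Aa m20 MwP eta2 lT T1 Tcv lT' T'C TT'.
have svv := sqn_marked_vec R sg sparse tM.
have sww := sqn_open_vec sparse tM Au As At AM Aa m20 MwP.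
rewrite -nrm_sqr in svv; rewrite -nrm_sqr in sww.
have y0 : 0 < y by rewrite invr_gt0 exprn_gt0.
apply: (growth_contradiction C0 (nrm_ge0 _) (nrm_ge0 _) y0 _ xC open_lower_bound etasq svv sww main).
exact: sqr_ge0.
Qed.

End Instance.

Lemma unbounded_family (C : R) : 0 <= C -> exists T : H2 -> H2,
  [/\ lin T, forall b f, nrm (T (lact (phi b) f) - lact (phi b) (T f)) <= 2 * nrm f &
   forall T', lin T' -> (forall f, nrm (T' f) <= C * nrm f) ->
     ~ forall b f, T (lact (phi b) f) - lact (phi b) (T f) =
                   T' (lact (phi b) f) - lact (phi b) (T' f)].
Proof.
move=> C0; have [b [rho [b2 rho01 kest]]] := kesten_letters nam.
pose X := Num.bound (33 * (1 + C) ^+ 2).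
have XC : 33 * (1 + C) ^+ 2 < X%:R by apply: archi_boundP; rewrite mulr_ge0 ?sqr_ge0.
have X0 : (0 < X)%N.
  by rewrite -(ltr0n R); apply: le_lt_trans XC; rewrite mulr_ge0 ?sqr_ge0.
clearbody X.
have [q [t [a [t4 ta code [Xd dX nX q0] [rhot ovP]]]]] := parameters L (size (hall L)) b2 rho01 X0.
set r := (b ^ (2 * q))%N in code ovP; set M := (t + a * r)%N in ovP.
have r2 : (2 <= r)%N.
  apply: (@leq_trans (b ^ 1)); first by rewrite expn1.
  by rewrite leq_exp2l// muln_gt0.
have [u sparse] := sparse_exists (hall L) (nonamenable_infinite nam).
have [A [Au As At AM Aa]] := nearly_disjoint r2 code.
have [s0 s0P] := kest (q * t)%N.
have [sg sgP] : exists sg : 'I_(b ^ (q * t)) -> B, forall i, letter L sg i = s0 i.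
  by have [sg h] := choice (fun i => lpi_surj L (s0 i)); exists sg.
have tM : (t <= M)%N by exact: leq_addr.
rewrite -/M in AM.
set m := (rho * b%:R) ^+ (q * t) in s0P.
have [rho0 rho1] := andP rho01.
have m0 : 0 <= m by rewrite exprn_ge0// mulr_ge0// ltW.
have sE : letter L sg = s0 by apply/funext.
have lettersP : forall f : l2 R G, nrm (\sum_i lact (letter L sg i) f) <= m * nrm f /\
  nrm (\sum_i lact (letter L sg i)^-1%g f) <= m * nrm f by rewrite sE.
have n2 : (2 <= n)%N := lcard_gt1 L.
have [ov1 ov2] := ovP _ (size_overlap_le L u M).
set N : R := n%:R; have N1 : 1 <= N by rewrite ler1n ltnW.
have N0 : 0 < N by exact: lt_le_trans N1.
set D : R := (b ^ (q * t))%:R.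
have D0 : 0 <= D by rewrite ler0n.
set p : R := N ^+ t; have p1 : 1 <= p by exact: exprn_ege1.
have p0 : 0 < p by exact: lt_le_trans p1.
set z : R := N ^+ a; have z0 : 0 < z by exact: exprn_gt0.
set x : R := D / (p ^+ 2 * z); set y : R := (p ^+ 2)^-1.
have y0 : 0 < y by rewrite invr_gt0 exprn_gt0.
have pz0 : 0 < p ^+ 2 * z by rewrite mulr_gt0 ?exprn_gt0.
have x0 : 0 <= x by rewrite divr_ge0// ltW.
have e2t k : N ^+ (k * t) = p ^+ k by rewrite mulnC exprM.
have Xx : X%:R <= x.
  by rewrite /x ler_pdivlMr// -e2t /z -exprD /N -natrX -natrM /D ler_nat.
have xX : x <= X%:R * N.
  rewrite /x ler_pdivrMr//; move: dX; rewrite -(ltr_nat R) natrM -/D [(n ^ _)%:R]natrX -/N exprSr exprD e2t -/z.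
  by move=> /ltW h; apply: le_trans h _; rewrite le_eqVlt; apply/orP; left; apply/eqP; ring.
have xp : 128 * x <= p.
  move: nX; rewrite -(ler_nat R) !natrM natrX -/N -/p; lra.
set th : R := rho ^+ (q * t) in rhot.
have th0 : 0 <= th by rewrite exprn_ge0// ltW.
have thp : th <= (p ^+ 3)^-1 by rewrite -e2t.
have mE : m = th * D by rewrite /m exprMn -natrX.
have etaE : cycle_ratio L t a (2 * m) = 2 * th * x * p.
  rewrite /cycle_ratio /decay -/N mE.
  have -> : (2 * t + (a - t) = t + a)%N by clear -ta; lia.
  rewrite exprD -/p -/z /x; field.
  by rewrite !gt_eqF.
have [eta2 etasq] := decay_estimate th0 x0 p1 thp xp etaE.
have xC : 33 * (1 + C) ^+ 2 <= x.
  move: XC => /ltW h1.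
  move: h1 Xx.
  exact: le_trans.
have bad_few : 2 * ((size (bad L u M))%:R * m) <= D.
  have hb : 2 * (size (bad L u M))%:R <= p.
    by rewrite size_bad size_diagonal /p /N -natrX -natrM ler_nat.
  rewrite mE mulrA mulrA -[leRHS]mul1r ler_wpM2r//.
  apply: (@le_trans _ _ (p * (p ^+ 3)^-1)); first by rewrite ler_pM// mulr_ge0.
  by rewrite ler_pdivrMr ?exprn_gt0// mul1r exprS ler_peMr ?(ltW p0)// exprn_ege1.
have DE : #|'I_(b ^ (q * t))|%:R = D by rewrite card_ord.
have yE : (N ^+ (2 * t))^-1 = (p ^+ 2)^-1 by rewrite e2t.
have xE : D / N ^+ (2 * t + a) = x by rewrite exprD e2t.
apply: (@unbounded_instance _ sg u t M a A sparse tM Au As At AM Aa m C m0 C0 lettersP) => //.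
- by rewrite DE xE yE.
- by rewrite DE xE.
- by rewrite DE.
Qed.

End UnboundedFamily.

(** * Countable direct sums *)

Section DirectSum.
Variables (R : realType) (W : choiceType).
Local Notation J := (nat * W)%type.

Let e (k : nat) (i : W) : J := (k, i).
Let pe k i : (e k i).1 = k. Proof. by []. Qed.
Let qe k i : (e k i).2 = i. Proof. by []. Qed.
Let epq (j : J) : e j.1 j.2 = j. Proof. by case: j. Qed.

Definition slice (k : nat) : l2 R J -> l2 R W := fib (e := e) (q := snd) qe k.
Lemma lin_slice k : lin (slice k). Proof. exact: lin_fib. Qed.

Lemma slice_ext f g : (forall k, slice k f = slice k g) -> f = g.
Proof. exact: (fib_ext epq). Qed.

Lemma sqn_slice_le k f : sqn (slice k f) <= sqn f.
Proof. exact: sqn_pull_le. Qed.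

Lemma fibrewise (A : nat -> l2 R W -> l2 R W) (c : R) :
  0 <= c -> (forall k, lin (A k)) -> (forall k f, sqn (A k f) <= c * sqn f) ->
  exists D : l2 R J -> l2 R J, [/\ lin D, forall f, sqn (D f) <= c * sqn f &
    forall k f, slice k (D f) = A k (slice k f)].
Proof.
move=> c0 lA Ac.
have ex f : exists g, (forall k, slice k g = A k (slice k f)) /\ sqn g <= c * sqn f.
  have bd (S : {fset nat}) : \sum_(k <- S) sqn (A k (slice k f)) <= c * sqn f.
    apply: (@le_trans _ _ (\sum_(k <- S) c * sqn (slice k f))); first exact: ler_sum.
    by rewrite -mulr_sumr ler_wpM2l//; exact: (sum_sqn_fib_le pe).
  by have [g g1 g2] := assemble pe qe epq bd; exists g.
have [D DP] := choice ex; exists D; split=> [a f g|f|k f]; last exact: (DP f).1.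
  apply: slice_ext => k; rewrite (lin_slice k) !(DP _).1.
  by rewrite (lin_slice k) (lA k).
exact: (DP f).2.
Qed.

Lemma slice_inclusion j : exists D : l2 R W -> l2 R J,
  [/\ lin D, forall f, sqn (D f) <= sqn f &
    forall k f, slice k (D f) = if k == j then f else 0].
Proof.
have ex (f : l2 R W) : exists g, (forall k, slice k g = if k == j then f else 0) /\ sqn g <= sqn f.
  have bd (S : {fset nat}) : \sum_(k <- S) sqn (if k == j then f else 0) <= sqn f.
    have [jS|jS] := boolP (j \in S).
      rewrite (bigD1_seq j) ?fset_uniq//= eqxx big1 ?addr0// => k /negbTE ->.
      exact: sqn0.
    rewrite big_seq big1 ?sqn_ge0// => k kS; case: eqP => [kj|_]; last exact: sqn0.
    by rewrite kj (negbTE jS) in kS.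
  by have [g g1 g2] := assemble pe qe epq bd; exists g.
have [D DP] := choice ex; exists D; split=> [a f g|f|k f]; last exact: (DP f).1.
  apply: slice_ext => k; rewrite (lin_slice k) !(DP _).1.
  by case: eqP => // _; rewrite scaler0 addr0.
exact: (DP f).2.
Qed.

End DirectSum.

(** No bound common to the [T k] is available, so only their commutators, of norm at most 2, are
    summed. If a bounded T' implemented the sum, its compression to a slice [j] above its norm bound
    would contradict the choice of [T j]. *)
Lemma lamp_not_unitarizable (R : realType) (B W G : groupType) (L : lamp_group B W G) :
  ~ amenable R G -> ~ unitarizable R B.
Proof.
move=> nam uB.
have [T TP] := choice (fun k : nat => unbounded_family L nam (ler0n R k)).
have lT k : lin (T k) by have [] := TP k.
pose la b (f : l2 R W) := lact (lphi L b) f.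
have lla b : lin (la b) by exact: lin_lact.
have [lam lamP] := choice (fun b => @fibrewise R W (fun=> la b) 1 ler01 (fun=> lla b)
  (fun=> (fun f => eq_ind_r (fun z => z <= 1 * sqn f) (eq_ind_r (fun z => sqn f <= z) (lexx _) (mul1r _)) (sqn_lact (lphi L b) f)))).
pose da b k (f : l2 R W) := T k (la b f) - la b (T k f).
have lda b k : lin (da b k).
  by apply: linBB; [exact: lin_comp|exact: lin_comp].
have dab b k f : sqn (da b k f) <= 4 * sqn f.
  have [_ h _] := TP k; have := h b f.
  rewrite nrm_le_sqn ?mulr_ge0 ?nrm_ge0// exprMn nrm_sqr -natrX; exact.
have [D DP] := choice (fun b => @fibrewise R W (da b) 4 (ler0n _ _) (lda b) (dab b)).
have lamS b k f : slice k (lam b f) = la b (slice k f) by have [_ _] := lamP b.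
have DS b k f : slice k (D b f) = da b k (slice k f) by have [_ _] := DP b.
have lam1 f : lam 1%g f = f.
  by apply: slice_ext => k; rewrite lamS /la phi1 lact1.
have lamM b b' f : lam (b * b')%g f = lam b (lam b' f).
  by apply: slice_ext => k; rewrite !lamS /la lphiM lactM.
have lam_le b f : sqn (lam b f) <= sqn f by have [_ + _] := lamP b; move=> /(_ f); rewrite mul1r.
have [T' [C [lT' C0 T'C T'D]]] : exists T' C, [/\ lin T', 0 <= C,
    forall f, sqn (T' f) <= C * sqn f & forall b f, D b f = T' (lam b f) - lam b (T' f)].
  apply: (@unitarizable_inner R B (nat * W)%type lam D 4) => //.
  - by move=> b; have [] := lamP b.
  - by move=> b; have [] := DP b.
  - move=> b f; apply: le_anti; rewrite lam_le /=.
    by rewrite -{1}[f]lam1 -(mulVg b) lamM lam_le.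
  - by move=> b f; have [_ + _] := DP b; exact.
  - move=> b b' f; apply: slice_ext => k.
    rewrite (linD (lin_slice k)) lamS !DS lamS /da /la lphiM !lactM.
    rewrite (linB (lin_lact _)) addrA subrK.
    by [].
pose c := Num.sqrt C; pose j := Num.bound c.
have cj : c <= j%:R by rewrite ltW// archi_boundP// sqrtr_ge0.
have [inc [linc inc_le incP]] := @slice_inclusion R W j.
have incS f : slice j (inc f) = f by rewrite incP eqxx.
have [_ _ /(_ (fun f => slice j (T' (inc f))))] := TP j; apply.
- by move=> x f g; rewrite linc lT' (lin_slice j).
- move=> f; rewrite nrm_le_sqn ?mulr_ge0 ?nrm_ge0// exprMn nrm_sqr.
  apply: le_trans (sqn_slice_le _ _) _; apply: le_trans (T'C _) _.
  apply: ler_pM; rewrite ?sqn_ge0//.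
  by rewrite -[C]sqr_sqrtr// lerXn2r ?nnegrE ?sqrtr_ge0.
move=> b f; have inclam : inc (la b f) = lam b (inc f).
  apply: slice_ext => k; rewrite lamS !incP; case: eqP => // _.
  by rewrite (lin0 (lla b)).
rewrite -[lact _ f]/(la b f) inclam -[LHS]/(da b j f) -{1}[f]incS -DS T'D.
by rewrite (linB (lin_slice j)) lamS.
Qed.

(** * Lamps over the Burnside group *)

Lemma burnside_ind (m p : nat) (P : burnside m p -> Prop) : P 1%g ->
  (forall i x, P x -> P (burnside_gen p i * x)%g) ->
  (forall i x, P x -> P ((burnside_gen p i)^-1 * x)%g) -> forall x, P x.
Proof.
move=> P1 Pm PV x; rewrite -(quo_classK x) -(free_classK (repr x)).
elim: {x}(repr (repr x)) => [//|[i b] w ih].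
have -> : quo_class _ (free_class ((i, b) :: w)) =
    ((if b then (burnside_gen p i)^-1 else burnside_gen p i) *
     (quo_class _ (free_class w) : burnside m p))%g.
  rewrite -cat1s -free_classM -[RHS]/(quo_mul _ _).
  case: b; last by rewrite quo_classM.
  by rewrite -[(_^-1)%g]/(quo_inv _) quo_classV quo_classM
    -[(free_gen i)^-1%g]/(free_inv _) free_classV.
by case: b; [exact: PV|exact: Pm].
Qed.

Section LampLighter.
Variables (n : nat) (G : groupType).

(** The base consists of all lamp functions, as in an unrestricted wreath product, so the group laws
    carry no support condition. *)
Definition lampl : Type := ((bool * G -> 'Z_n) * G)%type.
HB.instance Definition _ := gen_eqMixin lampl.
HB.instance Definition _ := gen_choiceMixin lampl.
Implicit Types w : lampl.

Definition lampl_mul (w w' : lampl) : lampl :=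
  (fun z => w.1 z + w'.1 (z.1, w.2^-1 * z.2)%g, (w.2 * w'.2)%g).
Definition lampl_one : lampl := (fun=> 0, 1%g).
Definition lampl_inv (w : lampl) : lampl := (fun z => - w.1 (z.1, w.2 * z.2)%g, w.2^-1%g).

Lemma lamplP (w w' : lampl) : w.1 =1 w'.1 -> w.2 = w'.2 -> w = w'.
Proof. by case: w w' => f g [f' g'] /= /funext -> ->. Qed.

Lemma lampl_mulA : associative lampl_mul.
Proof.
move=> a b c; apply: lamplP => [z|] /=; last by rewrite mulgA.
by rewrite addrA invgM mulgA.
Qed.
Lemma lampl_mul1g : left_id lampl_one lampl_mul.
Proof. by move=> a; apply: lamplP => [[b z]|] /=; rewrite ?invg1 ?mul1g ?add0r. Qed.
Lemma lampl_mulg1 : right_id lampl_one lampl_mul.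
Proof. by move=> a; apply: lamplP => [z|] /=; rewrite ?mulg1 ?addr0. Qed.
Lemma lampl_mulVg : left_inverse lampl_one lampl_inv lampl_mul.
Proof. by move=> a; apply: lamplP => [z|] /=; rewrite ?mulVg// invgK addNr. Qed.
Lemma lampl_mulgV : right_inverse lampl_one lampl_inv lampl_mul.
Proof. by move=> a; apply: lamplP => [[b z]|] /=; rewrite ?mulgV// mulVKg subrr. Qed.

HB.instance Definition _ := isGroup.Build lampl
  lampl_mulA lampl_mul1g lampl_mulg1 lampl_mulVg lampl_mulgV.

Lemma lampl_mulE (w w' : lampl) z : (w * w')%g.1 z = w.1 z + w'.1 (z.1, w.2^-1 * z.2)%g.
Proof. by []. Qed.
Lemma lampl_mul2 (w w' : lampl) : (w * w')%g.2 = (w.2 * w'.2)%g.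
Proof. by []. Qed.

Lemma lampl_exp2 w k : (w ^+ k)%g.2 = (w.2 ^+ k)%g.
Proof. by elim: k => [|k ih]; rewrite ?expg0 // !expgSr lampl_mul2 ih. Qed.

Lemma lampl_expE w k z : (w ^+ k)%g.1 z = \sum_(i < k) w.1 (z.1, w.2 ^- i * z.2)%g.
Proof.
elim: k z => [|k ih] z; first by rewrite big_ord0 expg0.
by rewrite expgSr lampl_mulE ih big_ord_recr /= lampl_exp2.
Qed.

Hypothesis n1 : (1 < n)%N.

Lemma lampl_exp_base (w : lampl) : w.2 = 1%g -> (w ^+ n)%g = 1%g.
Proof.
move=> w1; apply: lamplP => [z|]; last by rewrite lampl_exp2 w1 expg1n.
rewrite lampl_expE w1 (eq_bigr (fun=> w.1 z)) => [|i _]; last first.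
  by rewrite expg1n invg1 mul1g -surjective_pairing.
by rewrite sumr_const card_ord -mulr_natl pchar_Zp// mul0r.
Qed.

End LampLighter.

Section BurnsideLamps.
Variables (n p : nat).
Hypothesis n1 : (1 < n)%N.
Hypothesis p1 : (1 < p)%N.
Local Notation G := (burnside 2 p).
Local Notation B := (burnside 2 (n * p)).
Local Notation W := (lampl n G).

Definition gen (b : bool) : G := burnside_gen p (if b then ord_max else ord0 : 'I_2).
Definition lgen (b : bool) : W := (fun z => (z == (b, 1%g))%:R, gen b).

Lemma exists_lamp_hom : exists2 f : B -> W, {morph f : x y / (x * y)%g} &
  forall b, f (burnside_gen (n * p) (if b then ord_max else ord0 : 'I_2)) = lgen b.
Proof.
have [|f fM fg] := @burnside_lift 2 (n * p) W (fun i => lgen (i != ord0)).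
  move=> w; rewrite mulnC expgnA; apply: lampl_exp_base => //.
  by rewrite lampl_exp2 burnside_exp.
by exists f => // b; rewrite fg; case: b.
Qed.

Definition bphi : B -> W := sval (cid2 exists_lamp_hom).
Lemma bphiM : {morph bphi : x y / (x * y)%g}. Proof. by rewrite /bphi; case: cid2. Qed.
Lemma bphi_gen b : bphi (burnside_gen (n * p) (if b then ord_max else ord0 : 'I_2)) = lgen b.
Proof. by rewrite /bphi; case: cid2. Qed.

Definition bpi (w : W) : G := w.2.
Lemma bpiM : {morph bpi : x y / (x * y)%g}. Proof. by []. Qed.

Lemma bphi1 : bphi 1%g = 1%g.
Proof. by apply: (mulgI (bphi 1%g)); rewrite -bphiM !mulg1. Qed.
Lemma bphiV x : bphi x^-1%g = (bphi x)^-1%g.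
Proof. by apply: (mulIg (bphi x)); rewrite -bphiM !mulVg bphi1. Qed.
Lemma bphiX x k : bphi (x ^+ k)%g = (bphi x ^+ k)%g.
Proof. by elim: k => [|k ih]; rewrite ?expg0 ?bphi1// !expgS bphiM ih. Qed.

Lemma genE (i : 'I_2) : burnside_gen p i = gen (i != ord0).
Proof. by rewrite /gen; congr burnside_gen; apply/val_inj; case: i => -[|[|]]. Qed.

Lemma bpi_surj g : exists b, bpi (bphi b) = g.
Proof.
elim/burnside_ind: g => [|i x [b <-]|i x [b <-]].
- by exists 1%g; rewrite bphi1.
- exists (burnside_gen (n * p) (if i != ord0 then ord_max else ord0 : 'I_2) * b)%g.
  by rewrite bphiM bphi_gen bpiM genE.
- exists ((burnside_gen (n * p) (if i != ord0 then ord_max else ord0 : 'I_2))^-1 * b)%g.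
  by rewrite bphiM bphiV bphi_gen bpiM genE.
Qed.

Definition hom_section g : B := sval (cid (bpi_surj g)).
Lemma liftP g : bpi (bphi (hom_section g)) = g. Proof. by rewrite /hom_section; case: cid. Qed.

(** It depends on the choice of a section; its image in [W], computed in [blampE], does not. *)
Definition blamp (v : bool * G) : B :=
  (hom_section v.2 * burnside_gen (n * p) (if v.1 then ord_max else ord0 : 'I_2) ^+ p * (hom_section v.2)^-1)%g.

Definition bsub (b : bool) : seq G := [seq (gen b ^+ i)%g | i <- iota 0 p].

(** The exponent of one generator modulo p, from the universal property. It shows that [gen b] has
    order exactly p and, being invariant under conjugation, that conjugates of the two cyclic
    subgroups meet trivially. *)
Lemma exists_exponent (b : bool) : exists2 f : G -> 'Z_p, {morph f : x y / (x * y)%g >-> x + y} &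
  forall b', f (gen b') = (b == b')%:R.
Proof.
have Zexp (x : 'Z_p) : (x ^+ p = 1)%g.
  by rewrite Zp_expg; apply/val_inj => /=; move: (nat_of_ord x) => k; rewrite Zp_cast// modnMl.
have [f fM fg] := @burnside_lift 2 p 'Z_p (fun i => (b == (i != ord0))%:R) Zexp.
exists f; first by move=> x y; rewrite fM.
by move=> b'; rewrite /gen fg; case: b'.
Qed.

Definition expo b : G -> 'Z_p := sval (cid2 (exists_exponent b)).
Lemma expoM b : {morph expo b : x y / (x * y)%g >-> x + y}. Proof. by rewrite /expo; case: cid2. Qed.
Lemma expo_gen b b' : expo b (gen b') = (b == b')%:R. Proof. by rewrite /expo; case: cid2. Qed.
Lemma expo1 b : expo b 1%g = 0.
Proof. by apply: (addrI (expo b 1%g)); rewrite -expoM mulg1 addr0. Qed.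
Lemma expoV b x : expo b x^-1%g = - expo b x.
Proof. by apply: (addrI (expo b x)); rewrite -expoM mulgV expo1 subrr. Qed.
Lemma expoX b b' i : expo b (gen b' ^+ i)%g = (b == b')%:R *+ i.
Proof. by elim: i => [|i ih]; rewrite ?expg0 ?expo1// expgS expoM ih expo_gen mulrS. Qed.

Lemma gen_exp_inj b i j : (i < p)%N -> (j < p)%N -> (gen b ^+ i = gen b ^+ j)%g -> i = j.
Proof.
move=> ip jp /(congr1 (expo b)); rewrite !expoX eqxx => /(congr1 val).
by rewrite /= !val_Zp_nat// !modn_small.
Qed.

Lemma bsubP b h : reflect (exists2 i, (i < p)%N & h = (gen b ^+ i)%g) (h \in bsub b).
Proof.
apply: (iffP mapP) => [[i ip ->]|[i ip ->]]; exists i => //; first by move: ip; rewrite mem_iota.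
by rewrite mem_iota.
Qed.

Lemma gen_expE b i : (gen b ^+ i)%g \in bsub b.
Proof.
apply/bsubP; exists (i %% p)%N; first by rewrite ltn_mod ltnW.
by rewrite {1}(divn_eq i p) expgnDr mulnC expgnA burnside_exp expg1n mul1g.
Qed.

Lemma bsub1 b : 1%g \in bsub b. Proof. by rewrite -(expg0 (gen b)) gen_expE. Qed.
Lemma bsubM b h k : h \in bsub b -> k \in bsub b -> (h * k)%g \in bsub b.
Proof. by move=> /bsubP[i _ ->] /bsubP[j _ ->]; rewrite -expgnDr gen_expE. Qed.
Lemma bsubV b h : h \in bsub b -> h^-1%g \in bsub b.
Proof.
move=> /bsubP[i ip ->]; have -> : (gen b ^- i = gen b ^+ (p - i))%g.
  by apply: (mulgI (gen b ^+ i)%g); rewrite mulgV -expgnDr subnKC ?burnside_exp// ltnW.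
exact: gen_expE.
Qed.

Lemma bsub_conj u u' h h' : h \in bsub false -> h' \in bsub true ->
  (u * h * u^-1 = u' * h' * u'^-1)%g -> h = 1%g.
Proof.
move=> /bsubP[i ip ->] /bsubP[j jp ->] /(congr1 (expo false)).
rewrite !expoM !expoV addrC addKr [RHS]addrC addKr !expoX /= mul0rn => e0.
suff -> : i = 0%N by [].
by apply: (@gen_exp_inj false) => //; [exact: ltnW|move: e0 => /(congr1 val); rewrite /= val_Zp_nat// modn_small// => ->].
Qed.

Lemma blampE v : bphi (blamp v) =
  (fun z => ((v.1 == z.1) && (v.2^-1 * z.2 \in bsub v.1)%g)%:R, 1%g) :> W.
Proof.
(* The factors of the p-th power light the lamps at the powers of the generator, each once because
   its order is p. *)
have gp : ((lgen v.1 : W) ^+ p)%g = (fun z => ((v.1 == z.1) && (z.2 \in bsub v.1))%:R, 1%g) :> W.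
  apply: lamplP => [z|]; last by rewrite lampl_exp2 burnside_exp.
  rewrite lampl_expE /=; case: z => b z /=.
  have E i : ((b, gen v.1 ^- i * z)%g == (v.1, 1%g)) = (v.1 == b) && (z == gen v.1 ^+ i)%g.
    rewrite xpair_eqE eq_sym; congr (_ && _).
    by apply/eqP/eqP => [h|->]; [rewrite -[z](mulVKg (gen v.1 ^+ i)%g) h mulg1|rewrite mulVg].
  have [vb|vb] := eqVneq v.1 b; last first.
    by rewrite big1// => i _; rewrite E (negbTE vb).
  have [/bsubP[i ip zE]|zb] := boolP (z \in bsub v.1).
    subst z.
    rewrite (bigD1 (Ordinal ip)) // E (introT eqP vb) -[nat_of_ord (Ordinal ip)]/i !eqxx.
    rewrite big1 => [|j ji]; first exact: addr0.
    rewrite E; case: eqP => //= _; case: eqP => // h; move/eqP: ji; case.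
    by apply/val_inj; exact: (gen_exp_inj (ltn_ord j) ip (esym h)).
  rewrite big1// => i _; rewrite E; case: eqP => //= _; case: eqP => // h.
  by rewrite h gen_expE in zb.
have l2 : (bphi (hom_section v.2)).2 = v.2 := liftP v.2.
rewrite /blamp !bphiM bphiV bphiX bphi_gen gp; apply: lamplP => [z|].
  rewrite !lampl_mulE !lampl_mul2 /= l2 mulg1 mulVKg.
  by rewrite -surjective_pairing addrAC subrr add0r.
by rewrite !lampl_mul2 /= l2 mulg1 mulgV.
Qed.

Definition burnside_lamps : lamp_group B W G.
Proof.
refine (@LampGroup B W G bphi bpi n bsub blamp (fun w v => w.1 v) bphiM bpiM bpi_surj n1
  _ _ _ _ _ _ bsub1 bsubV bsubM bsub_conj).
- move=> b v; rewrite !blampE; apply: lamplP => [z|].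
    by rewrite !lampl_mulE /= invg1 mul1g -surjective_pairing addrC invgM mulgA.
  by rewrite !lampl_mul2 /= mulg1 mul1g.
- move=> u v; rewrite !blampE; apply: lamplP => [z|]; last by rewrite !lampl_mul2.
  by rewrite !lampl_mulE /= invg1 mul1g addrC.
- by move=> v; apply: lampl_exp_base => //; rewrite blampE.
- by move=> v; rewrite blampE.
- by [].
- move=> u w v; rewrite blampE lampl_mulE /= invg1 mul1g -surjective_pairing addrC //.
Defined.

End BurnsideLamps.

Lemma burnside_exp1 (x : burnside 2 1) : x = 1%g.
Proof. by rewrite -[x]expg1 burnside_exp. Qed.

Theorem corollary15 (R : realType) (p : nat) (hp : (0 < p)%N)
    (hna : ~ amenable R (burnside 2 p)) (n : nat) (hn : (2 <= n)%N) :
  ~ unitarizable R (burnside 2 (n * p)).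
Proof.
(* The trivial group obtained for p = 1 is finite, hence amenable; for p > 1 the type ['Z_p] really
   is Z/p. *)
have p1 : (1 < p)%N.
  rewrite ltn_neqAle hp andbT; apply/eqP => p1; subst p.
  have [g] := nonamenable_infinite hna [:: 1%g].
  by rewrite (burnside_exp1 g) mem_head.
exact: (lamp_not_unitarizable (burnside_lamps hn p1) hna).
Qed.
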